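(* Let $k$ be an infinite field of characteristic $p\ge0$. The assignment $Q_+\mapsto\mathbf F$, $Q_-\mapsto\mathbf E$ on generating objects, and $\eta_1,\eta_2,\epsilon_1,\epsilon_2,\tau\mapsto\eta_1,\eta_2,\epsilon_1,\epsilon_2,\tau$ on generating morphisms, gives a well-defined $k$-linear monoidal functor $\Omega':\mathcal H'\to\mathrm{End}_L(\mathcal P)$.
   Context: **Khovanov's category (over $k$).** $\mathcal H'$ is the $k$-linear additive monoidal category generated by objects $Q_+,Q_-$ (write $Q_\varepsilon$ for the product indexed by a sign sequence $\varepsilon$, $Q_\emptyset=1$) and morphisms $\eta_1:1\to Q_{+-}$, $\epsilon_1:Q_{-+}\to1$, $\eta_2:1\to Q_{-+}$, $\epsilon_2:Q_{+-}\to1$, $\tau:Q_{++}\to Q_{++}$, subject to: (R0) morphisms are planar diagrams up to boundary-fixing isotopy, i.e. $(\epsilon_1Q_-)(Q_-\eta_1)=\mathrm{id}$, $(Q_+\epsilon_1)(\eta_1Q_+)=\mathrm{id}$, $(\epsilon_2Q_+)(Q_+\eta_2)=\mathrm{id}$, $(Q_-\epsilon_2)(\eta_2Q_-)=\mathrm{id}$, and the two mates of $\tau$ on $Q_{--}$ coincide: $(\epsilon_1^{(2)}Q_{--})(Q_{--}\tau Q_{--})(Q_{--}\eta_1^{(2)})=(Q_{--}\epsilon_2^{(2)})(Q_{--}\tau Q_{--})(\eta_2^{(2)}Q_{--})$, where $\eta_1^{(2)}=(Q_+\eta_1Q_-)\eta_1$, $\epsilon_1^{(2)}=\epsilon_1(Q_-\epsilon_1Q_+)$,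 $\eta_2^{(2)}=(Q_-\eta_2Q_+)\eta_2$, $\epsilon_2^{(2)}=\epsilon_2(Q_+\epsilon_2Q_-)$; (R1) $\epsilon_1\eta_2=\mathrm{id}$; (R2) $\tau^2=\mathrm{id}$; (R3) $(Q_+\tau)(\tau Q_+)(Q_+\tau)=(\tau Q_+)(Q_+\tau)(\tau Q_+)$; (R4) $(\epsilon_1Q_+)(Q_-\tau)(\eta_2Q_+)=0$; and with $\triangle=(Q_{-+}\epsilon_2)(Q_-\tau Q_-)(\eta_2Q_{+-}):Q_{+-}\to Q_{-+}$ and $\square=(\epsilon_1Q_{+-})(Q_-\tau Q_-)(Q_{-+}\eta_1):Q_{-+}\to Q_{+-}$: (R5) $\square\triangle=\mathrm{id}$; (R6) $\triangle\square=\mathrm{id}-\eta_2\epsilon_1$. **$\mathcal P$ and its endofunctors.** $\mathcal V_k$ is the category of finite-dimensional $k$-vector spaces. Objects of $\mathcal P$ (strict polynomial functors of finite degree) are functors $M:\mathcal V_k\to\mathcal V_k$ such that all maps $\mathrm{Hom}(V,W)\to\mathrm{Hom}(M(V),M(W))$ are polynomial and the degrees of $\mathrm{End}(V)\to\mathrm{End}(M(V))$ are bounded uniformly in $V$; morphisms are natural transformations; tensor product is pointwise; $I$ is the identity functor. $\mathrm{End}_L(\mathcal P)$ is the category of exact endofunctors of $\mathcal P$ admitting a left adjoint, with natural transformations as morphisms, monoidal under composition. $GL(k)$ acts on $M(V\oplus k)$ through $M(1_V\oplus g)$; $M(V\oplus k)_i$ is the weight $i$ subspace, $(\cdot)_i$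 the projection to it. $\mathbf E(M)(V)=M(V\oplus k)_1$, $\mathbf F(M)=M\otimes I$. Thus $\mathbf E\mathbf F(M)(V)=M(V\oplus k)_1\otimes V\oplus M(V\oplus k)_0\otimes k$, $\mathbf F\mathbf E(M)(V)=M(V\oplus k)_1\otimes V$. $\eta_1:1\to\mathbf F\mathbf E$, $m\mapsto\sum_i(M(\tilde\xi_i)(m))_1\otimes e_i$ ($\{e_i\}$ a basis of $V$, $\{\xi_i\}$ the dual basis, $\tilde\xi(v)=(v,\xi(v))$). $\epsilon_1:\mathbf E\mathbf F\to1$, $(n\otimes v,m\otimes1)\mapsto M(p_V)(m)$, $p_V:V\oplus k\to V$ the projection. $\eta_2:1\to\mathbf E\mathbf F$, $m\mapsto(0,M(i_V)(m)\otimes1)$, $i_V:V\to V\oplus k$ the inclusion. $\epsilon_2:\mathbf F\mathbf E\to1$, $m\otimes v\mapsto M(\tilde v)(m)$, $\tilde v(w,a)=w+av$. $\tau:\mathbf F^2\to\mathbf F^2$, $m\otimes v\otimes w\mapsto m\otimes w\otimes v$ on $M(V)\otimes V\otimes V$. *)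

(* Defs.v *)
From HB Require Import structures.
From mathcomp Require Import all_boot all_order all_algebra.
From mathcomp.multinomials Require Import mpoly.
From Stdlib Require Import ClassicalEpsilon.

Set Implicit Arguments.
Unset Strict Implicit.
Unset Printing Implicit Defensive.

Import GRing.Theory.
Local Open Scope ring_scope.

(** * Categories

  Morphism sets carry an equivalence relation [heq] that plays the role of
  equality.  For a category presented by generators and relations it is the
  congruence generated by the relations, for a category of functors it is
  componentwise equality, and for vector spaces it is Leibniz equality. *)

Record category := Category {
  ob :> Type;
  hom : ob -> ob -> Type;
  heq : forall A B, hom A B -> hom A B -> Prop;
  idm : forall A, hom A A;
  comp : forall A B C, hom B C -> hom A B -> hom A C;
  heq_refl : forall A B (f : hom A B), heq f f;
  heq_sym : forall A B (f g : hom A B), heq f g -> heq g f;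
  heq_trans : forall A B (f g h : hom A B), heq f g -> heq g h -> heq f h;
  comp_heq : forall A B C (g g' : hom B C) (f f' : hom A B),
    heq g g' -> heq f f' -> heq (comp g f) (comp g' f');
  compA : forall A B C D (h : hom C D) (g : hom B C) (f : hom A B),
    heq (comp h (comp g f)) (comp (comp h g) f);
  comp1m : forall A B (f : hom A B), heq (comp (idm B) f) f;
  compm1 : forall A B (f : hom A B), heq (comp f (idm A)) f }.

Arguments hom {c} A B.
Arguments heq {c A B} f g.
Arguments idm {c} A.
Arguments comp {c A B C} g f.

Declare Scope cat_scope.
Delimit Scope cat_scope with C.
Local Open Scope cat_scope.
Notation "f =h g" := (heq f g) (at level 70, no associativity) : cat_scope.
Notation "g <o> f" := (comp g f)
  (at level 41, right associativity) : cat_scope.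

Record lincat (k : fieldType) := LinCat {
  lin_cat :> category;
  hzero : forall A B : lin_cat, hom A B;
  hadd : forall A B : lin_cat, hom A B -> hom A B -> hom A B;
  hscale : forall A B : lin_cat, k -> hom A B -> hom A B;
  hadd_heq : forall (A B : lin_cat) (f f' g g' : hom A B),
    f =h f' -> g =h g' -> hadd f g =h hadd f' g';
  hscale_heq : forall (A B : lin_cat) (c : k) (f f' : hom A B),
    f =h f' -> hscale c f =h hscale c f';
  haddA : forall (A B : lin_cat) (f g h : hom A B),
    hadd f (hadd g h) =h hadd (hadd f g) h;
  haddC : forall (A B : lin_cat) (f g : hom A B), hadd f g =h hadd g f;
  hadd0 : forall (A B : lin_cat) (f : hom A B), hadd (hzero A B) f =h f;
  hscaleA : forall (A B : lin_cat) (a b : k) (f : hom A B),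
    hscale a (hscale b f) =h hscale (a * b) f;
  hscale1 : forall (A B : lin_cat) (f : hom A B), hscale 1 f =h f;
  hscale0 : forall (A B : lin_cat) (f : hom A B), hscale 0 f =h hzero A B;
  hscaleDl : forall (A B : lin_cat) (a b : k) (f : hom A B),
    hscale (a + b) f =h hadd (hscale a f) (hscale b f);
  hscaleDr : forall (A B : lin_cat) (a : k) (f g : hom A B),
    hscale a (hadd f g) =h hadd (hscale a f) (hscale a g);
  compDl : forall (A B C : lin_cat) (g g' : hom B C) (f : hom A B),
    hadd g g' <o> f =h hadd (g <o> f) (g' <o> f);
  compDr : forall (A B C : lin_cat) (g : hom B C) (f f' : hom A B),
    g <o> hadd f f' =h hadd (g <o> f) (g <o> f');
  compZl : forall (A B C : lin_cat) (a : k) (g : hom B C) (f : hom A B),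
    hscale a g <o> f =h hscale a (g <o> f);
  compZr : forall (A B C : lin_cat) (a : k) (g : hom B C) (f : hom A B),
    g <o> hscale a f =h hscale a (g <o> f) }.

Arguments hzero {k l} A B.
Arguments hadd {k l A B} f g.
Arguments hscale {k l A B} c f.

Notation "f +h g" := (hadd f g) (at level 50, left associativity) : cat_scope.
Notation "c *h f" := (hscale c f) (at level 40, left associativity) : cat_scope.

Lemma comp_congl (C : category) (X Y Z : C) (g g' : hom Y Z) (f : hom X Y) :
  g =h g' -> g <o> f =h g' <o> f.
Proof. by move=> e; apply: comp_heq => //; exact: heq_refl. Qed.

Lemma comp_congr (C : category) (X Y Z : C) (g : hom Y Z) (f f' : hom X Y) :
  f =h f' -> g <o> f =h g <o> f'.
Proof. by move=> e; apply: comp_heq => //; exact: heq_refl. Qed.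

(** * Functors and natural transformations *)

Record functor (C D : category) := Functor {
  fob :> C -> D;
  fmap : forall A B : C, hom A B -> hom (fob A) (fob B);
  fmap_heq : forall (A B : C) (f g : hom A B), f =h g -> fmap f =h fmap g;
  fmap1 : forall A : C, fmap (idm A) =h idm (fob A);
  fmapM : forall (A B E : C) (g : hom B E) (f : hom A B),
    fmap (g <o> f) =h fmap g <o> fmap f }.

Arguments fmap {C D} f {A B} _ : rename.

Record nattrans (C D : category) (F G : functor C D) := NatTrans {
  ncomp :> forall A : C, hom (F A) (G A);
  nat_sq : forall (A B : C) (f : hom A B),
    ncomp B <o> fmap F f =h fmap G f <o> ncomp A }.

Definition functor_id (C : category) : functor C C :=
  @Functor C C (fun A => A) (fun A B f => f)
    (fun A B f g e => e) (fun A => heq_refl (idm A))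
    (fun A B E g f => heq_refl (g <o> f)).

Section FunctorComp.
Variables (C D E : category) (G : functor D E) (F : functor C D).

Fact fcomp_heq (A B : C) (f g : hom A B) :
  f =h g -> fmap G (fmap F f) =h fmap G (fmap F g).
Proof. by move=> e; do 2!apply: fmap_heq. Qed.

Fact fcomp_1 (A : C) : fmap G (fmap F (idm A)) =h idm (G (F A)).
Proof. by apply: heq_trans (fmap1 G _); apply: fmap_heq; exact: fmap1. Qed.

Fact fcomp_M (A B H : C) (g : hom B H) (f : hom A B) :
  fmap G (fmap F (g <o> f)) =h fmap G (fmap F g) <o> fmap G (fmap F f).
Proof. by apply: heq_trans (fmapM G _ _); apply: fmap_heq; exact: fmapM. Qed.

Definition functor_comp : functor C E :=
  Functor fcomp_heq fcomp_1 fcomp_M.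
End FunctorComp.

Section NatCat.
Variables C D : category.

Definition nat_id (F : functor C D) : nattrans F F.
Proof.
exists (fun A => idm (F A)) => A B f.
by apply: heq_trans (comp1m _) _; apply: heq_sym; exact: compm1.
Defined.

Definition nat_comp (F G H : functor C D) (b : nattrans G H)
  (a : nattrans F G) : nattrans F H.
Proof.
exists (fun A => b A <o> a A) => A B f.
apply: heq_trans (heq_sym (compA _ _ _)) _.
apply: heq_trans (comp_congr _ (nat_sq a f)) _.
apply: heq_trans (compA _ _ _) _.
apply: heq_trans (comp_congl _ (nat_sq b f)) _.
by apply: heq_sym; exact: compA.
Defined.

Definition nat_heq (F G : functor C D) (a b : nattrans F G) : Prop :=
  forall A : C, a A =h b A.

Definition funcat : category.
Proof.
refine (@Category (functor C D) (@nattrans C D) nat_heq nat_id nat_comp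
  _ _ _ _ _ _ _).
- by move=> F G a A; exact: heq_refl.
- by move=> F G a b e A; apply: heq_sym; exact: e.
- by move=> F G a b c e e' A; exact: heq_trans (e A) (e' A).
- by move=> F G H b b' a a' eb ea A; exact: comp_heq (eb A) (ea A).
- by move=> F G H K c b a A; exact: compA.
- by move=> F G a A; exact: comp1m.
- by move=> F G a A; exact: compm1.
Defined.

(** The natural isomorphism underlying an equality of functors. *)
Definition nat_of_eq (F G : functor C D) (e : F = G) : nattrans F G :=
  match e in _ = G' return nattrans F G' with erefl => nat_id F end.
End NatCat.

(** Horizontal composition. *)
Definition nat_hcomp (C D E : category) (G G' : functor D E)
  (F F' : functor C D) (b : nattrans G G') (a : nattrans F F') :
  nattrans (functor_comp G F) (functor_comp G' F').
Proof.
exists (fun A => (b (F' A) <o> fmap G (a A) : hom (functor_comp G F A) _)).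
move=> A B f /=.
apply: heq_trans (heq_sym (compA _ _ _)) _.
apply: heq_trans (comp_congr _ (heq_sym (fmapM G _ _))) _.
apply: heq_trans (comp_congr _ (fmap_heq G (nat_sq a f))) _.
apply: heq_trans (comp_congr _ (fmapM G _ _)) _.
apply: heq_trans (compA _ _ _) _.
apply: heq_trans (comp_congl _ (nat_sq b _)) _.
by apply: heq_sym; exact: compA.
Defined.

Definition linear_functor (k : fieldType) (C D : lincat k)
  (F : functor C D) : Prop :=
  (forall (A B : C) (f g : hom A B), fmap F (f +h g) =h fmap F f +h fmap F g) /\
  (forall (A B : C) (c : k) (f : hom A B), fmap F (c *h f) =h c *h fmap F f).

(** Natural transformations between functors into a k-linear category. *)
Section LinFunCat.
Variables (k : fieldType) (C : category) (D : lincat k).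

Definition nat_zero (F G : functor C D) : nattrans F G.
Proof.
exists (fun A => hzero (F A) (G A)) => A B f.
have z0 (X Y : D) : hzero X Y =h 0 *h hzero X Y.
  by apply: heq_sym; exact: hscale0.
apply: heq_trans (comp_congl _ (z0 _ _)) _.
apply: heq_trans (compZl _ _ _) _.
apply: heq_trans (hscale0 _) _.
apply: heq_sym.
apply: heq_trans (comp_congr _ (z0 _ _)) _.
apply: heq_trans (compZr _ _ _) _.
exact: hscale0.
Defined.

Definition nat_add (F G : functor C D) (a b : nattrans F G) : nattrans F G.
Proof.
exists (fun A => a A +h b A) => A B f.
apply: heq_trans (compDl _ _ _) _.
apply: heq_trans (hadd_heq (nat_sq a f) (nat_sq b f)) _.
by apply: heq_sym; exact: compDr.
Defined.

Definition nat_scale (F G : functor C D) (c : k) (a : nattrans F G) :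
  nattrans F G.
Proof.
exists (fun A => c *h a A) => A B f.
apply: heq_trans (compZl _ _ _) _.
apply: heq_trans (hscale_heq c (nat_sq a f)) _.
by apply: heq_sym; exact: compZr.
Defined.

Definition lin_funcat : lincat k.
Proof.
refine (@LinCat k (funcat C D) nat_zero nat_add nat_scale
          _ _ _ _ _ _ _ _ _ _ _ _ _ _).
- by move=> F G f f' g g' e e' A; exact: hadd_heq (e A) (e' A).
- by move=> F G c f f' e A; exact: hscale_heq (e A).
- by move=> F G f g h A; exact: haddA.
- by move=> F G f g A; exact: haddC.
- by move=> F G f A; exact: hadd0.
- by move=> F G a b f A; exact: hscaleA.
- by move=> F G f A; exact: hscale1.
- by move=> F G f A; exact: hscale0.
- by move=> F G a b f A; exact: hscaleDl.
- by move=> F G a f g A; exact: hscaleDr.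
- by move=> F G H g g' f A; exact: compDl.
- by move=> F G H g f f' A; exact: compDr.
- by move=> F G H a g f A; exact: compZl.
- by move=> F G H a g f A; exact: compZr.
Defined.
End LinFunCat.

(** The full subcategory on the objects [i x]. *)
Section FullSub.
Variables (k : fieldType) (C : lincat k) (X : Type) (i : X -> C).

Definition full_sub_cat : category :=
  @Category X (fun x y => hom (i x) (i y)) (fun x y => @heq C (i x) (i y))
    (fun x => idm (i x)) (fun x y z g f => g <o> f)
    (fun x y f => heq_refl f) (fun x y => @heq_sym C (i x) (i y))
    (fun x y => @heq_trans C (i x) (i y))
    (fun x y z => @comp_heq C (i x) (i y) (i z))
    (fun x y z t h g f => compA h g f)
    (fun x y f => comp1m f) (fun x y f => compm1 f).

Definition full_sub : lincat k :=
  @LinCat k full_sub_cat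
    (fun x y => hzero (i x) (i y)) (fun x y f g => f +h g)
    (fun x y c f => c *h f)
    (fun x y => @hadd_heq k C (i x) (i y))
    (fun x y => @hscale_heq k C (i x) (i y))
    (fun x y => @haddA k C (i x) (i y)) (fun x y => @haddC k C (i x) (i y))
    (fun x y => @hadd0 k C (i x) (i y)) (fun x y => @hscaleA k C (i x) (i y))
    (fun x y => @hscale1 k C (i x) (i y)) (fun x y => @hscale0 k C (i x) (i y))
    (fun x y => @hscaleDl k C (i x) (i y))
    (fun x y => @hscaleDr k C (i x) (i y))
    (fun x y z => @compDl k C (i x) (i y) (i z))
    (fun x y z => @compDr k C (i x) (i y) (i z))
    (fun x y z => @compZl k C (i x) (i y) (i z))
    (fun x y z => @compZr k C (i x) (i y) (i z)).
End FullSub.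

(** * Adjoints and exactness *)

Definition adjunction (C D : category) (L : functor D C) (R : functor C D) :=
  exists (u : nattrans (functor_id D) (functor_comp R L))
         (c : nattrans (functor_comp L R) (functor_id C)),
    (forall A : D, c (L A) <o> fmap L (u A) =h idm (L A)) /\
    (forall B : C, fmap R (c B) <o> u (R B) =h idm (R B)).

Definition has_left_adjoint (C D : category) (R : functor C D) : Prop :=
  exists L : functor D C, adjunction L R.

Section Exact.
Variables (k : fieldType).

Definition is_kernel (C : lincat k) (A B D : C) (f : hom A B) (g : hom B D) :=
  g <o> f =h hzero A D /\
  forall (X : C) (h : hom X B), g <o> h =h hzero X D ->
    exists u : hom X A, f <o> u =h h /\
      forall u' : hom X A, f <o> u' =h h -> u' =h u.

Definition is_cokernel (C : lincat k) (A B D : C)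
    (f : hom A B) (g : hom B D) :=
  g <o> f =h hzero A D /\
  forall (X : C) (h : hom B X), h <o> f =h hzero A X ->
    exists u : hom D X, u <o> g =h h /\
      forall u' : hom D X, u' <o> g =h h -> u' =h u.

(** 0 -> A -f-> B -g-> D -> 0 is exact. *)
Definition short_exact (C : lincat k) (A B D : C)
    (f : hom A B) (g : hom B D) :=
  is_kernel f g /\ is_cokernel f g.

(** Exact functors between k-linear categories are taken to be k-linear, not
  only additive: composition of natural transformations is k-bilinear only
  then. *)
Definition exact_functor (C D : lincat k) (F : functor C D) : Prop :=
  linear_functor F /\
  forall (A B E : C) (f : hom A B) (g : hom B E),
    short_exact f g -> short_exact (fmap F f) (fmap F g).
End Exact.

(** * Monoidal k-linear categories and strong monoidal functors *)

Record monlincat (k : fieldType) := MonLinCat {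
  mon_cat :> lincat k;
  tens : mon_cat -> mon_cat -> mon_cat;
  unit_ob : mon_cat;
  tensm : forall A A' B B' : mon_cat,
    hom A A' -> hom B B' -> hom (tens A B) (tens A' B');
  assoc : forall A B C : mon_cat,
    hom (tens (tens A B) C) (tens A (tens B C));
  associ : forall A B C : mon_cat,
    hom (tens A (tens B C)) (tens (tens A B) C);
  lunit : forall A : mon_cat, hom (tens unit_ob A) A;
  luniti : forall A : mon_cat, hom A (tens unit_ob A);
  runit : forall A : mon_cat, hom (tens A unit_ob) A;
  runiti : forall A : mon_cat, hom A (tens A unit_ob);
  tensm_heq : forall (A A' B B' : mon_cat) (f f' : hom A A') (g g' : hom B B'),
    f =h f' -> g =h g' -> tensm f g =h tensm f' g';
  tensm1 : forall A B : mon_cat, tensm (idm A) (idm B) =h idm (tens A B);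
  tensmM : forall (A A' A'' B B' B'' : mon_cat)
    (f' : hom A' A'') (f : hom A A') (g' : hom B' B'') (g : hom B B'),
    tensm (f' <o> f) (g' <o> g) =h tensm f' g' <o> tensm f g;
  tensmDl : forall (A A' B B' : mon_cat) (f f' : hom A A') (g : hom B B'),
    tensm (f +h f') g =h tensm f g +h tensm f' g;
  tensmDr : forall (A A' B B' : mon_cat) (f : hom A A') (g g' : hom B B'),
    tensm f (g +h g') =h tensm f g +h tensm f g';
  tensmZl : forall (A A' B B' : mon_cat) (c : k) (f : hom A A') (g : hom B B'),
    tensm (c *h f) g =h c *h tensm f g;
  tensmZr : forall (A A' B B' : mon_cat) (c : k) (f : hom A A') (g : hom B B'),
    tensm f (c *h g) =h c *h tensm f g;
  assocK : forall A B C : mon_cat, associ A B C <o> assoc A B C =h idm _;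
  associK : forall A B C : mon_cat, assoc A B C <o> associ A B C =h idm _;
  lunitK : forall A : mon_cat, luniti A <o> lunit A =h idm _;
  lunitiK : forall A : mon_cat, lunit A <o> luniti A =h idm _;
  runitK : forall A : mon_cat, runiti A <o> runit A =h idm _;
  runitiK : forall A : mon_cat, runit A <o> runiti A =h idm _;
  assoc_nat : forall (A A' B B' C C' : mon_cat)
    (f : hom A A') (g : hom B B') (h : hom C C'),
    assoc A' B' C' <o> tensm (tensm f g) h =h
    tensm f (tensm g h) <o> assoc A B C;
  lunit_nat : forall (A A' : mon_cat) (f : hom A A'),
    lunit A' <o> tensm (idm unit_ob) f =h f <o> lunit A;
  runit_nat : forall (A A' : mon_cat) (f : hom A A'),
    runit A' <o> tensm f (idm unit_ob) =h f <o> runit A;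
  pentagon : forall A B C D : mon_cat,
    assoc A B (tens C D) <o> assoc (tens A B) C D =h
    tensm (idm A) (assoc B C D) <o> assoc A (tens B C) D <o>
      tensm (assoc A B C) (idm D);
  triangle : forall A B : mon_cat,
    tensm (idm A) (lunit B) <o> assoc A unit_ob B =h tensm (runit A) (idm B) }.

Arguments tens {k m} A B.
Arguments unit_ob {k m}.
Arguments tensm {k m A A' B B'} f g.
Arguments assoc {k m} A B C.
Arguments associ {k m} A B C.
Arguments lunit {k m} A.
Arguments luniti {k m} A.
Arguments runit {k m} A.
Arguments runiti {k m} A.

Notation "A (x) B" := (tens A B) (at level 37, right associativity) : cat_scope.
Notation "f <x> g" := (tensm f g) (at level 37, right associativity) : cat_scope.

Record monfunctor (k : fieldType) (C D : monlincat k) := MonFunctor {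
  mf_fun :> functor C D;
  mu : forall A B : C, hom (mf_fun A (x) mf_fun B) (mf_fun (A (x) B));
  mui : forall A B : C, hom (mf_fun (A (x) B)) (mf_fun A (x) mf_fun B);
  mu0 : hom (@unit_ob k D) (mf_fun unit_ob);
  mu0i : hom (mf_fun unit_ob) (@unit_ob k D);
  muK : forall A B : C, mui A B <o> mu A B =h idm _;
  muiK : forall A B : C, mu A B <o> mui A B =h idm _;
  mu0K : mu0i <o> mu0 =h idm _;
  mu0iK : mu0 <o> mu0i =h idm _;
  mu_nat : forall (A A' B B' : C) (f : hom A A') (g : hom B B'),
    mu A' B' <o> (fmap mf_fun f <x> fmap mf_fun g) =h
    fmap mf_fun (f <x> g) <o> mu A B;
  mu_assoc : forall A B E : C,
    fmap mf_fun (assoc A B E) <o> mu (A (x) B) E <o>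
      (mu A B <x> idm (mf_fun E)) =h
    mu A (B (x) E) <o> (idm (mf_fun A) <x> mu B E) <o> assoc _ _ _;
  mu_lunit : forall A : C,
    fmap mf_fun (lunit A) <o> mu unit_ob A <o> (mu0 <x> idm (mf_fun A)) =h
    lunit (mf_fun A);
  mu_runit : forall A : C,
    fmap mf_fun (runit A) <o> mu A unit_ob <o> (idm (mf_fun A) <x> mu0) =h
    runit (mf_fun A) }.

(** * Finite-dimensional vector spaces *)

Section Vect.
Variable k : fieldType.

Definition Vect_cat : category :=
  @Category (vectType k) (fun U V => 'Hom(U, V)) (fun U V f g => f = g)
    (fun U => \1%VF) (fun U V W g f => (g \o f)%VF)
    (fun U V f => erefl f) (fun U V f g e => esym e)
    (fun U V f g h e e' => etrans e e')
    (fun U V W g g' f f' e e' => f_equal2 (fun g f => (g \o f)%VF) e e')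
    (fun U V W X h g f => comp_lfunA h g f)
    (fun U V f => comp_lfun1l f) (fun U V f => comp_lfun1r f).

Definition Vect : lincat k.
Proof.
refine (@LinCat k Vect_cat (fun U V => 0 : 'Hom(U, V))
  (fun U V f g => f + g : 'Hom(U, V)) (fun U V c f => c *: f : 'Hom(U, V))
  _ _ _ _ _ _ _ _ _ _ _ _ _ _).
- by move=> U V f f' g g' -> ->.
- by move=> U V c f f' ->.
- by move=> U V f g h; exact: addrA.
- by move=> U V f g; exact: addrC.
- by move=> U V f; exact: add0r.
- by move=> U V a b f; exact: scalerA.
- by move=> U V f; exact: scale1r.
- by move=> U V f; exact: scale0r.
- by move=> U V a b f; exact: scalerDl.
- by move=> U V a f g; exact: scalerDr.
- by move=> U V W g g' f; exact: comp_lfunDl.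
- by move=> U V W g f f'; exact: comp_lfunDr.
- by move=> U V W a g f; rewrite /= comp_lfunZl.
- by move=> U V W a g f; rewrite /= comp_lfunZr.
Defined.

Implicit Types U V W : vectType k.

Lemma linfunE U V (f : U -> V) : linear f -> linfun f =1 f.
Proof.
move=> lf x.
pose g : {linear U -> V} := HB.pack f (GRing.isLinear.Build k U V *:%R f lf).
by rewrite -[f]/(GRing.Linear.sort g) lfunE.
Qed.

(** ** Maps that are polynomial in coordinates

  Coordinates are taken in the library's chosen basis; neither polynomiality
  nor the bound on the degree depends on this choice. *)

Definition coords U (x : U) : 'I_(\dim {:U}) -> k :=
  fun i => coord (vbasis {:U}) i x.

Definition poly_fun_le (d : nat) U (g : U -> k) : Prop :=
  exists P : {mpoly k[\dim {:U}]},
    (msize P <= d.+1)%N /\ forall x, g x = P.@[coords x].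

Definition poly_map_le (d : nat) U W (f : U -> W) : Prop :=
  forall j : 'I_(\dim {:W}), poly_fun_le d (fun x => coords (f x) j).

Definition poly_map U W (f : U -> W) : Prop := exists d, poly_map_le d f.

Lemma poly_fun_eq d U (g g' : U -> k) :
  g =1 g' -> poly_fun_le d g -> poly_fun_le d g'.
Proof. by move=> e [P [sP hP]]; exists P; split=> // x; rewrite -e hP. Qed.

Lemma poly_fun_mono d d' U (g : U -> k) :
  (d <= d')%N -> poly_fun_le d g -> poly_fun_le d' g.
Proof.
by move=> le [P [sP hP]]; exists P; split=> //; apply: leq_trans sP _.
Qed.

Lemma poly_fun_const U c : @poly_fun_le 0 U (fun _ => c).
Proof.
exists c%:MP; split=> [|x]; last by rewrite mevalC.
by rewrite msizeC; case: eqP.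
Qed.

Lemma poly_fun_add d U (g g' : U -> k) :
  poly_fun_le d g -> poly_fun_le d g' -> poly_fun_le d (fun x => g x + g' x).
Proof.
move=> [P [sP hP]] [P' [sP' hP']]; exists (P + P').
split=> [|x]; last by rewrite mevalD hP hP'.
by apply: leq_trans (msizeD_le _ _) _; rewrite geq_max sP.
Qed.

Lemma poly_fun_scale d U c (g : U -> k) :
  poly_fun_le d g -> poly_fun_le d (fun x => c * g x).
Proof.
move=> [P [sP hP]]; exists (c *: P).
split=> [|x]; last by rewrite mevalZ hP.
exact: leq_trans (msizeZ_le _ _) sP.
Qed.

Lemma poly_fun_sum d U (I : Type) (r : seq I) (g : I -> U -> k) :
  (forall i, poly_fun_le d (g i)) ->
  poly_fun_le d (fun x => \sum_(i <- r) g i x).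
Proof.
move=> h; elim: r => [|i r IH].
  apply: (@poly_fun_eq _ _ (fun _ => 0)); first by move=> x; rewrite big_nil.
  by apply: poly_fun_mono (poly_fun_const _ _).
apply: (@poly_fun_eq _ _ (fun x => g i x + \sum_(j <- r) g j x)).
  by move=> x; rewrite big_cons.
exact: poly_fun_add.
Qed.

Lemma poly_fun_mul d d' U (g g' : U -> k) :
  poly_fun_le d g -> poly_fun_le d' g' ->
  poly_fun_le (d + d') (fun x => g x * g' x).
Proof.
move=> [P [sP hP]] [P' [sP' hP']]; exists (P * P').
split=> [|x]; last by rewrite mevalM hP hP'.
have [->|P0] := eqVneq P 0; first by rewrite mul0r msize0.
have [->|P'0] := eqVneq P' 0; first by rewrite mulr0 msize0.
rewrite msizeM // -subn1 leq_subLR add1n -addSn -addnS.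
exact: leq_add.
Qed.

Lemma poly_fun_exp U (g : U -> k) n :
  poly_fun_le 1 g -> poly_fun_le n (fun x => g x ^+ n).
Proof.
move=> h; elim: n => [|n IH]; first exact: poly_fun_const.
apply: (@poly_fun_eq _ _ (fun x => g x * g x ^+ n)).
  by move=> x; rewrite exprS.
by rewrite -add1n; exact: poly_fun_mul.
Qed.

Lemma poly_fun_prod U (I : Type) (r : seq I) (g : I -> U -> k) (e : I -> nat) :
  (forall i, poly_fun_le (e i) (g i)) ->
  poly_fun_le (\sum_(i <- r) e i)%N (fun x => \prod_(i <- r) g i x).
Proof.
move=> h; elim: r => [|i r IH].
  rewrite big_nil.
  apply: (@poly_fun_eq _ _ (fun _ => 1)); first by move=> x; rewrite big_nil.
  exact: poly_fun_const.
apply: (@poly_fun_eq _ _ (fun x => g i x * \prod_(j <- r) g j x)).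
  by move=> x; rewrite big_cons.
by rewrite big_cons; exact: poly_fun_mul.
Qed.

Lemma coords_sum U (x : U) : x = \sum_i coords x i *: (vbasis {:U})`_i.
Proof. by apply: coord_vbasis; exact: memvf. Qed.

Lemma poly_fun_coord U i : poly_fun_le 1 (fun x : U => coords x i).
Proof.
by exists 'X_i; split=> [|x]; rewrite ?mevalXU // msizeX mdeg1.
Qed.

Lemma poly_fun_lin d U W (f : U -> W) (l : W -> k^o) :
  linear l -> poly_map_le d f -> poly_fun_le d (fun x => l (f x)).
Proof.
move=> ll hf.
apply: (@poly_fun_eq _ _
  (fun x => \sum_(i < \dim {:W})
     (linfun l ((vbasis {:W})`_i) : k) * coords (f x) i)).
  move=> x; rewrite -(linfunE ll) {2}[f x]coords_sum linear_sum.
  by apply: eq_bigr => i _; rewrite linearZ /= mulrC.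
by apply: poly_fun_sum => i; apply: poly_fun_scale; exact: hf.
Qed.

Lemma poly_map_id U : poly_map_le 1 (@id U).
Proof. by move=> j; exact: poly_fun_coord. Qed.

Lemma poly_map_post d U W W' (f : U -> W) (L : W -> W') :
  linear L -> poly_map_le d f -> poly_map_le d (fun x => L (f x)).
Proof.
move=> lL hf j.
apply: (@poly_fun_lin _ _ _ f (fun w => coords (L w) j)) => //.
by move=> a u v /=; rewrite (lL a u v) /coords linearP.
Qed.

Lemma poly_map_pre d U U' W (f : U -> W) (A : U' -> U) :
  poly_map_le 1 A -> poly_map_le d f -> poly_map_le d (fun x => f (A x)).
Proof.
move=> hA hf j; case: (hf j) => P [sP hP].
apply: (@poly_fun_eq _ _ (fun x => \sum_(m <- msupp P | m \in msupp P)
    (P@_m * \prod_i coords (A x) i ^+ m i))).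
  by move=> x; rewrite hP mevalE -big_seq.
apply: (@poly_fun_eq _ _ (fun x => \sum_(m <- msupp P)
    (if m \in msupp P then P@_m * \prod_i coords (A x) i ^+ m i else 0))).
  by move=> x; rewrite [RHS]big_mkcond.
apply: poly_fun_sum => m /=; have [mP|_] := boolP (m \in msupp P); last first.
  by apply: poly_fun_mono (poly_fun_const _ _).
apply: poly_fun_scale.
apply: (@poly_fun_mono (mdeg m)).
  by rewrite -ltnS; apply: leq_trans (msize_mdeg_lt mP) sP.
rewrite mdegE; apply: poly_fun_prod => i; apply: poly_fun_exp; exact: hA.
Qed.

Lemma poly_map_add d U W (f g : U -> W) :
  poly_map_le d f -> poly_map_le d g -> poly_map_le d (fun x => f x + g x).
Proof.
move=> hf hg j.
apply: (@poly_fun_eq _ _ (fun x => coords (f x) j + coords (g x) j)).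
  by move=> x; rewrite /coords linearD.
by apply: poly_fun_add; [exact: hf | exact: hg].
Qed.

Lemma poly_map_const U W (w : W) : @poly_map_le 0 U W (fun _ => w).
Proof. by move=> j; exact: poly_fun_const. Qed.

Lemma poly_map_eq d U W (f g : U -> W) :
  f =1 g -> poly_map_le d f -> poly_map_le d g.
Proof.
by move=> e hf j; apply: poly_fun_eq (hf j) => x; rewrite /= e.
Qed.

Lemma poly_map_mono d d' U W (f : U -> W) :
  (d <= d')%N -> poly_map_le d f -> poly_map_le d' f.
Proof. by move=> le hf j; apply: poly_fun_mono le _. Qed.

Lemma poly_map_bilin d d' U W1 W2 W (f : U -> W1) (g : U -> W2)
    (b : W1 -> W2 -> W) :
  (forall w, linear (b^~ w)) -> (forall w, linear (b w)) ->
  poly_map_le d f -> poly_map_le d' g ->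
  poly_map_le (d + d') (fun x => b (f x) (g x)).
Proof.
move=> bl br hf hg j.
pose e1 i := (vbasis {:W1})`_i; pose e2 i := (vbasis {:W2})`_i.
apply: (@poly_fun_eq _ _ (fun x => \sum_(i < \dim {:W1}) \sum_(i' < \dim {:W2})
   coords (b (e1 i) (e2 i')) j * (coords (f x) i * coords (g x) i'))).
  move=> x; rewrite {2}[f x]coords_sum.
  rewrite -(linfunE (bl _)) linear_sum /coords linear_sum.
  apply: eq_bigr => i _; rewrite linearZ /= linearZ /= (linfunE (bl _)).
  rewrite {2}[g x]coords_sum -(linfunE (br _)) linear_sum linear_sum /=.
  rewrite mulr_sumr; apply: eq_bigr => i' _.
  by rewrite linearZ /= linearZ /= (linfunE (br _)) mulrC -mulrA.
apply: poly_fun_sum => i; apply: poly_fun_sum => i'; apply: poly_fun_scale.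
by apply: poly_fun_mul; [exact: hf | exact: hg].
Qed.

(** ** Tensor products

  In finite dimension U (x) V is realised as Hom(V^*, U), the pure tensor
  u (x) v being xi |-> xi(v) u; see [tensor_univ]. *)

Definition dual V : vectType k := 'Hom(V, k^o).
Definition tensor U V : vectType k := 'Hom(dual V, U).

Definition pure U V (u : U) (v : V) : tensor U V :=
  linfun (fun xi : dual V => (xi v : k) *: u).

Definition dual_map V V' (g : 'Hom(V, V')) : 'Hom(dual V', dual V) :=
  linfun (fun xi : dual V' => (xi \o g)%VF : dual V).

Definition tensor_map U U' V V' (f : 'Hom(U, U')) (g : 'Hom(V, V')) :
  'Hom(tensor U V, tensor U' V') :=
  linfun (fun t : tensor U V => (f \o t \o dual_map g)%VF : tensor U' V').

Lemma pureE U V (u : U) (v : V) xi : pure u v xi = (xi v : k) *: u.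
Proof.
rewrite linfunE // => a x y.
by rewrite add_lfunE scale_lfunE scalerDl -scalerA.
Qed.

Lemma dual_mapE V V' (g : 'Hom(V, V')) xi : dual_map g xi = (xi \o g)%VF.
Proof.
by rewrite linfunE // => a x y; rewrite comp_lfunDl comp_lfunZl.
Qed.

Lemma tensor_mapE U U' V V' (f : 'Hom(U, U')) (g : 'Hom(V, V')) t :
  tensor_map f g t = (f \o t \o dual_map g)%VF.
Proof.
rewrite linfunE // => a x y.
by rewrite comp_lfunDr comp_lfunDl -comp_lfunZr -comp_lfunZl.
Qed.

Lemma tensor_map_pure U U' V V' (f : 'Hom(U, U')) (g : 'Hom(V, V')) u v :
  tensor_map f g (pure u v) = pure (f u) (g v).
Proof.
apply/lfunP => xi; rewrite tensor_mapE !comp_lfunE !pureE dual_mapE.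
by rewrite comp_lfunE linearZ.
Qed.

Lemma pure_linl U V (v : V) : linear (fun u : U => pure u v).
Proof.
move=> a x y; apply/lfunP => xi.
by rewrite add_lfunE scale_lfunE !pureE scalerDr !scalerA mulrC.
Qed.

Lemma pure_linr U V (u : U) : linear (fun v : V => pure u v).
Proof.
move=> a x y; apply/lfunP => xi.
by rewrite add_lfunE scale_lfunE !pureE linearP scalerDl scalerA.
Qed.

Definition coord_form V (i : 'I_(\dim {:V})) : dual V :=
  linfun (fun v => coords v i : k^o).

Lemma coord_formE V i (v : V) : coord_form i v = coords v i.
Proof. by rewrite linfunE // => a x y; rewrite /coords linearP. Qed.

Lemma dual_sum V (xi : dual V) :
  xi = \sum_(i < \dim {:V}) (xi (vbasis {:V})`_i : k) *: coord_form i.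
Proof.
apply/lfunP => v; rewrite {1}[v]coords_sum linear_sum sum_lfunE.
apply: eq_bigr => i _; rewrite linearZ /= scale_lfunE coord_formE.
exact: mulrC.
Qed.

Lemma tensor_sum U V (t : tensor U V) :
  t = \sum_(i < \dim {:V}) pure (t (coord_form i)) (vbasis {:V})`_i.
Proof.
apply/lfunP => xi; rewrite {1}[xi]dual_sum linear_sum sum_lfunE.
by apply: eq_bigr => i _; rewrite linearZ pureE.
Qed.

Lemma tensor_univ U V W (b : U -> V -> W) :
  (forall v, linear (b^~ v)) -> (forall u, linear (b u)) ->
  exists h : 'Hom(tensor U V, W), (forall u v, h (pure u v) = b u v) /\
    forall h' : 'Hom(tensor U V, W), (forall u v, h' (pure u v) = b u v) ->
      h' = h.
Proof.
move=> bl br.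
pose h := linfun (fun t : tensor U V =>
  \sum_(i < \dim {:V}) b (t (coord_form i)) (vbasis {:V})`_i).
have hE t : h t = \sum_(i < \dim {:V}) b (t (coord_form i)) (vbasis {:V})`_i.
  rewrite linfunE // => a x y; rewrite scaler_sumr -big_split.
  by apply: eq_bigr => i _; rewrite add_lfunE scale_lfunE bl.
have hP u v : h (pure u v) = b u v.
  rewrite hE {2}[v]coords_sum -(linfunE (br u)) linear_sum.
  apply: eq_bigr => i _; rewrite pureE coord_formE linearZ /= (linfunE (br u)).
  by rewrite -(linfunE (bl _)) linearZ /= (linfunE (bl _)).
exists h; split=> // h' h'P; apply/lfunP => t.
rewrite [t]tensor_sum !linear_sum.
by apply: eq_bigr => i _; rewrite /= h'P hP.
Qed.

Lemma tensor_map1 U V : tensor_map \1 \1 = \1%VF :> 'End(tensor U V).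
Proof.
apply/lfunP => t; rewrite tensor_mapE id_lfunE comp_lfun1l.
by apply/lfunP => xi; rewrite comp_lfunE dual_mapE comp_lfun1r.
Qed.

Lemma tensor_mapM U U' U'' V V' V'' (f' : 'Hom(U', U'')) (f : 'Hom(U, U'))
    (g' : 'Hom(V', V'')) (g : 'Hom(V, V')) :
  tensor_map (f' \o f) (g' \o g) = (tensor_map f' g' \o tensor_map f g)%VF.
Proof.
apply/lfunP => t; rewrite comp_lfunE !tensor_mapE; apply/lfunP => xi.
by rewrite !comp_lfunE !dual_mapE comp_lfunA.
Qed.

Lemma tensor_map_linl U U' V V' (g : 'Hom(V, V')) :
  linear (fun f : 'Hom(U, U') => tensor_map f g).
Proof.
move=> a x y; apply/lfunP => t; rewrite add_lfunE scale_lfunE !tensor_mapE.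
by rewrite !comp_lfunDl -!comp_lfunZl.
Qed.

Lemma tensor_map_linr U U' V V' (f : 'Hom(U, U')) :
  linear (fun g : 'Hom(V, V') => tensor_map f g).
Proof.
move=> a x y; apply/lfunP => t; rewrite add_lfunE scale_lfunE !tensor_mapE.
apply/lfunP => xi; rewrite add_lfunE scale_lfunE !comp_lfunE !dual_mapE.
by rewrite comp_lfunDr -comp_lfunZr !linearP.
Qed.

(** ** Direct sums *)

Definition dsum_map V V' W W' (f : 'Hom(V, V')) (g : 'Hom(W, W')) :
  'Hom((V * W)%type, (V' * W')%type) :=
  linfun (fun x : V * W => (f x.1, g x.2)).

Lemma dsum_mapE V V' W W' (f : 'Hom(V, V')) (g : 'Hom(W, W')) x :
  dsum_map f g x = (f x.1, g x.2).
Proof. by rewrite linfunE // => a y z; rewrite !linearP. Qed.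

Lemma dsum_map1 V W : dsum_map \1 \1 = \1%VF :> 'End((V * W)%type).
Proof. by apply/lfunP => -[x y]; rewrite dsum_mapE !id_lfunE. Qed.

Lemma dsum_mapM V V' V'' W W' W'' (f' : 'Hom(V', V'')) (f : 'Hom(V, V'))
    (g' : 'Hom(W', W'')) (g : 'Hom(W, W')) :
  dsum_map (f' \o f) (g' \o g) = (dsum_map f' g' \o dsum_map f g)%VF.
Proof. by apply/lfunP => x; rewrite comp_lfunE !dsum_mapE /= !comp_lfunE. Qed.

Lemma dsum_map_poly V V' W W' (g : 'Hom(W, W')) :
  poly_map_le 1 (fun f : 'Hom(V, V') => dsum_map f g).
Proof.
apply: (@poly_map_eq _ _ _ (fun f => dsum_map f 0 + dsum_map 0 g)).
  move=> f; apply/lfunP => x; rewrite add_lfunE !dsum_mapE !zero_lfunE.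
  by congr (_, _); rewrite ?addr0 ?add0r.
apply: poly_map_add; last exact: poly_map_mono (poly_map_const _ _).
apply: (@poly_map_post _ _ _ _ id (fun f => dsum_map f 0)); last first.
  exact: poly_map_id.
move=> a x y; apply/lfunP => z.
rewrite add_lfunE scale_lfunE !dsum_mapE add_lfunE scale_lfunE !zero_lfunE.
by congr (_, _); rewrite /= scaler0 addr0.
Qed.

(** ** The subspace cut out by a predicate closed under linear combinations *)

Definition is_subspace V (P : V -> Prop) : Prop :=
  P 0 /\ forall a x y, P x -> P y -> P (a *: x + y).

Lemma subspace_ex V (P : V -> Prop) : is_subspace P ->
  exists S : {vspace V}, forall x, (x \in S) <-> P x.
Proof.
move=> [P0 Pl].
suff IH : forall n (S : {vspace V}), (forall x, x \in S -> P x) ->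
    (\dim {:V} - \dim S <= n)%N -> exists S : {vspace V}, forall x, (x \in S) <-> P x.
  apply: (IH _ 0%VS _ (leqnn _)) => x.
  by rewrite memv0 => /eqP ->.
elim=> [|n IHn] S SP hn.
  exists S => x; split; first exact: SP.
  have /eqP -> : S == fullv.
    by rewrite eqEdim subvf -subn_eq0 -leqn0.
  by rewrite memvf.
case: (classic (forall x, P x -> x \in S)) => [h|].
  by exists S => x; split; [exact: SP | exact: h].
move=> h; have [x hx] := not_all_ex_not _ _ h.
have [Px xS] := imply_to_and _ _ hx.
apply: (IHn (S + <[x]>)%VS).
  move=> y /memv_addP [s sS [z /vlineP [a ->] ->]].
  by rewrite addrC; apply: Pl => //; exact: SP.
have lt : (\dim S < \dim (S + <[x]>)%VS)%N.
  rewrite ltn_neqAle dimvS ?addvSl // andbT; apply/negP => /eqP e.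
  have /eqP e' : S == (S + <[x]>)%VS by rewrite eqEdim addvSl -e leqnn.
  by apply: xS; rewrite e'; apply: (subvP (addvSr _ _)); exact: memv_line.
by rewrite -ltnS; apply: leq_trans hn; rewrite ltn_sub2l //;
  apply: leq_trans lt (dimvS (subvf _)).
Qed.

Definition subspace_of V (P : V -> Prop) : {vspace V} :=
  epsilon (inhabits 0%VS) (fun S : {vspace V} => forall x, (x \in S) <-> P x).

Lemma subspace_ofP V (P : V -> Prop) x :
  is_subspace P -> (x \in subspace_of P) <-> P x.
Proof.
move=> h; exact: (epsilon_spec (inhabits 0%VS)
  (fun S : {vspace V} => forall x, (x \in S) <-> P x) (subspace_ex h) x).
Qed.

End Vect.

(** * Strict polynomial functors *)

Record polyfun (k : fieldType) := PolyFun {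
  pf_fun :> functor (Vect k) (Vect k);
  pf_poly : forall V W : vectType k,
    poly_map (fun f : 'Hom(V, W) => fmap pf_fun f : 'Hom(pf_fun V, pf_fun W));
  pf_bounded : exists d, forall V : vectType k,
    poly_map_le d (fun f : 'End(V) => fmap pf_fun f : 'End(pf_fun V)) }.

(** The category P. *)
Definition Pol (k : fieldType) : lincat k :=
  full_sub (C := lin_funcat (Vect k) (Vect k)) (@pf_fun k).

Section Pol.
Variable k : fieldType.
Implicit Types (M N : polyfun k) (U V W X : vectType k).

Definition pf_ob M V : vectType k := pf_fun M V.
Definition pf_map M V W (f : 'Hom(V, W)) : 'Hom(pf_ob M V, pf_ob M W) :=
  fmap (pf_fun M) f.

Lemma pf_map1 M V : pf_map M (\1%VF : 'End(V)) = \1%VF.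
Proof. exact: (fmap1 (pf_fun M) V). Qed.

Lemma pf_mapM M V W X (g : 'Hom(W, X)) (f : 'Hom(V, W)) :
  pf_map M (g \o f)%VF = (pf_map M g \o pf_map M f)%VF.
Proof. exact: (fmapM (pf_fun M) g f). Qed.

(** The component M(V) -> N(V) of a morphism of P. *)
Definition pol_comp M N (a : nattrans (pf_fun M) (pf_fun N)) V :
  'Hom(pf_ob M V, pf_ob N V) := a V.

Lemma pol_nat M N (a : nattrans (pf_fun M) (pf_fun N)) V W (f : 'Hom(V, W)) :
  (pol_comp a W \o pf_map M f = pf_map N f \o pol_comp a V)%VF.
Proof. exact: (nat_sq a f). Qed.

(** ** The functor F *)

Section F_ob.
Variable M : polyfun k.

Definition F_fun : functor (Vect k) (Vect k).
Proof.
refine (@Functor (Vect k) (Vect k) (fun V => tensor (pf_ob M V) V)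
  (fun V W f => tensor_map (pf_map M f) f) _ _ _).
- by move=> V W f g ->.
- by move=> V; rewrite /= pf_map1 tensor_map1.
- by move=> U V W g f; rewrite /= pf_mapM tensor_mapM.
Defined.

Lemma F_poly_le d V W :
  poly_map_le d (fun f : 'Hom(V, W) => pf_map M f) ->
  poly_map_le (d + 1) (fun f : 'Hom(V, W) => tensor_map (pf_map M f) f).
Proof.
move=> hM.
apply: (@poly_map_bilin k d 1 _ _ _ _ (fun f : 'Hom(V, W) => pf_map M f) id
  (fun f g => tensor_map f g)) => //.
- by move=> g; exact: tensor_map_linl.
- by move=> f; exact: tensor_map_linr.
- exact: poly_map_id.
Qed.

Definition F_ob : polyfun k.
Proof.
exists F_fun.
- by move=> V W; have [d hd] := pf_poly M V W; exists (d + 1)%N; exact: F_poly_le.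
- by have [d hd] := pf_bounded M; exists (d + 1)%N => V; exact: F_poly_le.
Defined.
End F_ob.

Definition F_mor M N (a : nattrans (pf_fun M) (pf_fun N)) :
  nattrans (pf_fun (F_ob M)) (pf_fun (F_ob N)).
Proof.
exists (fun V => tensor_map (pol_comp a V) \1%VF :
  'Hom(pf_ob (F_ob M) V, pf_ob (F_ob N) V)) => V W f /=.
by rewrite -!tensor_mapM pol_nat comp_lfun1l comp_lfun1r.
Defined.

Definition F_functor : functor (Pol k) (Pol k).
Proof.
refine (@Functor (Pol k) (Pol k) F_ob F_mor _ _ _).
- by move=> M N a b e V /=; rewrite /pol_comp (e V).
- by move=> M V; exact: tensor_map1.
- move=> M N R b a V /=; rewrite -tensor_mapM comp_lfun1l.
  by [].
Defined.

(** ** Weight spaces and the functor E *)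

Definition line : vectType k := k^o.
Definition plus_line V : vectType k := (V * line)%type.

(** 1_V (+) g on V (+) k. *)
Definition torus V (g : k) : 'End(plus_line V) := dsum_map \1%VF (g *: \1%VF).

Definition weight M V (i : nat) (m : pf_ob M (plus_line V)) : Prop :=
  forall g : k, g != 0 -> pf_map M (torus V g) m = g ^+ i *: m.

Lemma weight_is_subspace M V i : is_subspace (@weight M V i).
Proof.
split=> [g _|a x y hx hy g g0]; first by rewrite linear0 scaler0.
by rewrite linearP /= hx // hy // scalerDr !scalerA mulrC.
Qed.

(** M(V (+) k)_i *)
Definition weight_space M V i : {vspace pf_ob M (plus_line V)} :=
  subspace_of (@weight M V i).

Lemma weight_spaceP M V i m : (m \in weight_space M V i) <-> weight i m.
Proof. exact: subspace_ofP (weight_is_subspace M V i). Qed.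

(** The projection of M(V (+) k) to its weight i subspace: it is the identity
  on that subspace and kills the other weight subspaces.  These together span
  when k is infinite. *)
Definition is_weight_proj M V i (p : 'End(pf_ob M (plus_line V))) : Prop :=
  forall j m, weight j m -> p m = if j == i then m else 0.

Definition weight_proj M V i : 'End(pf_ob M (plus_line V)) :=
  epsilon (inhabits 0) (is_weight_proj i).

Lemma torus_comm V W (f : 'Hom(V, W)) g :
  (torus W g \o dsum_map f \1%VF = dsum_map f \1%VF \o torus V g)%VF.
Proof. by rewrite -!dsum_mapM !comp_lfun1l !comp_lfun1r. Qed.

Lemma weight_map M V W i (f : 'Hom(V, W)) m :
  weight i m -> weight i (pf_map M (dsum_map f \1%VF :
    'Hom(plus_line V, plus_line W)) m).
Proof.
move=> hm g g0; rewrite -comp_lfunE -pf_mapM torus_comm pf_mapM comp_lfunE.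
by rewrite hm // linearZ.
Qed.

Lemma weight_nat M N (a : nattrans (pf_fun M) (pf_fun N)) V i m :
  weight i m -> weight i (pol_comp a (plus_line V) m).
Proof.
move=> hm g g0.
by rewrite -comp_lfunE -pol_nat comp_lfunE hm // linearZ.
Qed.

(** Restriction of a linear map to subspaces, meant for [h] mapping S to S'. *)
Definition restrict V W (S : {vspace V}) (S' : {vspace W}) (h : 'Hom(V, W)) :
  'Hom(subvs_of S, subvs_of S') :=
  (linfun (vsproj S') \o h \o linfun (vsval : subvs_of S -> V))%VF.

Lemma restrictE V W (S : {vspace V}) (S' : {vspace W}) (h : 'Hom(V, W)) x :
  h (vsval x) \in S' -> vsval (restrict S S' h x) = h (vsval x).
Proof. by move=> hx; rewrite !comp_lfunE !lfunE /= vsprojK. Qed.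

Lemma restrict_linear V W (S : {vspace V}) (S' : {vspace W}) :
  linear (@restrict V W S S').
Proof.
move=> a f g; apply/lfunP => x.
by rewrite add_lfunE scale_lfunE !comp_lfunE add_lfunE scale_lfunE linearP.
Qed.

Section E_ob.
Variable M : polyfun k.

Definition E_map V W (f : 'Hom(V, W)) :
  'Hom(subvs_of (weight_space M V 1), subvs_of (weight_space M W 1)) :=
  restrict _ _ (pf_map M (dsum_map f \1%VF : 'Hom(plus_line V, plus_line W))).

Lemma E_mapE V W (f : 'Hom(V, W)) x :
  vsval (E_map f x) =
  pf_map M (dsum_map f \1%VF : 'Hom(plus_line V, plus_line W)) (vsval x).
Proof.
rewrite restrictE //; apply/weight_spaceP/weight_map.
by apply/weight_spaceP; exact: subvsP.
Qed.

Definition E_fun : functor (Vect k) (Vect k).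
Proof.
refine (@Functor (Vect k) (Vect k)
  (fun V => subvs_of (weight_space M V 1)) E_map _ _ _).
- by move=> V W f g ->.
- move=> V; apply/lfunP => x; apply/val_inj.
  by rewrite /= E_mapE dsum_map1 pf_map1 !id_lfunE.
- move=> U V W g f; apply/lfunP => x; apply/val_inj.
  rewrite /= comp_lfunE !E_mapE -comp_lfunE -pf_mapM -dsum_mapM.
  by rewrite comp_lfun1l.
Defined.

Lemma E_poly_le d V W :
  poly_map_le d
    (fun f : 'Hom(plus_line V, plus_line W) => pf_map M f) ->
  poly_map_le d (fun f : 'Hom(V, W) => E_map f).
Proof.
move=> hM.
apply: (@poly_map_post k d _ _ _
  (fun f : 'Hom(V, W) => pf_map M (dsum_map f \1%VF :
     'Hom(plus_line V, plus_line W)))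
  (fun h => restrict _ _ h)); first exact: restrict_linear.
pose h := fun f : 'Hom(V, W) =>
  dsum_map f \1%VF : 'Hom(plus_line V, plus_line W).
have hh : poly_map_le 1 h by exact: dsum_map_poly.
exact: (poly_map_pre hh hM).
Qed.

Definition E_ob : polyfun k.
Proof.
exists E_fun.
- move=> V W; have [d hd] := pf_poly M (plus_line V) (plus_line W).
  by exists d; exact: E_poly_le.
- by have [d hd] := pf_bounded M; exists d => V; exact: E_poly_le.
Defined.
End E_ob.

Lemma E_mor_in M N (a : nattrans (pf_fun M) (pf_fun N)) V
    (x : subvs_of (weight_space M V 1)) :
  pol_comp a (plus_line V) (vsval x) \in weight_space N V 1.
Proof.
apply/weight_spaceP/weight_nat; apply/weight_spaceP; exact: subvsP.
Qed.

Definition E_mor M N (a : nattrans (pf_fun M) (pf_fun N)) :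
  nattrans (pf_fun (E_ob M)) (pf_fun (E_ob N)).
Proof.
exists (fun V => restrict _ _ (pol_comp a (plus_line V)) :
  'Hom(pf_ob (E_ob M) V, pf_ob (E_ob N) V)) => V W f /=.
apply/lfunP => x; apply/val_inj; rewrite /= (comp_lfunE _ (E_map M f)) (comp_lfunE (E_map N f)).
rewrite restrictE ?E_mor_in // !E_mapE restrictE ?E_mor_in //.
by rewrite -!comp_lfunE pol_nat.
Defined.

Definition E_functor : functor (Pol k) (Pol k).
Proof.
refine (@Functor (Pol k) (Pol k) E_ob E_mor _ _ _).
- by move=> M N a b e V /=; rewrite /pol_comp (e (plus_line V)).
- move=> M V; apply/lfunP => x; apply/val_inj.
  have hx := E_mor_in (nat_id (pf_fun M)) x.
  by rewrite /= restrictE // /pol_comp /= !id_lfunE.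
- move=> M N R b a V; apply/lfunP => x; apply/val_inj.
  rewrite /= comp_lfunE.
  have hx := E_mor_in (nat_comp b a : nattrans (pf_fun M) (pf_fun R)) x.
  rewrite !restrictE ?E_mor_in //; first by rewrite /pol_comp /= comp_lfunE.
  by move: hx; rewrite /pol_comp /= comp_lfunE.
Defined.

End Pol.

(** * The monoidal category of exact endofunctors admitting a left adjoint *)

Section Hcomp.
Variables C D E : category.

Lemma hcomp_heq (G G' : functor D E) (F F' : functor C D)
    (b b' : nattrans G G') (a a' : nattrans F F') :
  nat_heq b b' -> nat_heq a a' -> nat_heq (nat_hcomp b a) (nat_hcomp b' a').
Proof. by move=> eb ea A; exact: comp_heq (eb _) (fmap_heq _ (ea A)). Qed.

Lemma hcomp_id (G : functor D E) (F : functor C D) :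
  nat_heq (nat_hcomp (nat_id G) (nat_id F)) (nat_id (functor_comp G F)).
Proof. by move=> A; apply: heq_trans (comp1m _) (fmap1 G _). Qed.

Lemma hcomp_comp (G G' G'' : functor D E) (F F' F'' : functor C D)
    (b' : nattrans G' G'') (b : nattrans G G')
    (a' : nattrans F' F'') (a : nattrans F F') :
  nat_heq (nat_hcomp (nat_comp b' b) (nat_comp a' a))
          (nat_comp (nat_hcomp b' a') (nat_hcomp b a)).
Proof.
move=> A /=.
apply: heq_trans (comp_congr _ (fmapM G _ _)) _.
apply: heq_trans (compA _ _ _) _.
apply: heq_trans _ (heq_sym (compA _ _ _)).
apply: comp_congl.
apply: heq_trans (heq_sym (compA _ _ _)) _.
apply: heq_trans (comp_congr _ (nat_sq b _)) _.
exact: compA.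
Qed.
End Hcomp.

Lemma adjunction_id (C : category) :
  adjunction (functor_id C) (functor_id C).
Proof.
have sq (A B : C) (f : hom A B) : idm B <o> f =h f <o> idm A.
  by apply: heq_trans (comp1m _) _; apply: heq_sym; exact: compm1.
exists (@NatTrans _ _ (functor_id C) (functor_comp (functor_id C) (functor_id C))
          (fun A => idm A) sq).
exists (@NatTrans _ _ (functor_comp (functor_id C) (functor_id C)) (functor_id C)
          (fun A => idm A) sq).
by split=> A; exact: comp1m.
Qed.

Section AdjComp.
Variables (C D E : category) (R1 : functor C D) (L1 : functor D C).
Variables (R2 : functor D E) (L2 : functor E D).

Lemma adjunction_comp : adjunction L1 R1 -> adjunction L2 R2 ->
  adjunction (functor_comp L1 L2) (functor_comp R2 R1).
Proof.
move=> [u1 [c1 [tl1 tr1]]] [u2 [c2 [tl2 tr2]]].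
pose u (A : E) : hom A (R2 (R1 (L1 (L2 A)))) := fmap R2 (u1 (L2 A)) <o> u2 A.
pose c (B : C) : hom (L1 (L2 (R2 (R1 B)))) B := c1 B <o> fmap L1 (c2 (R1 B)).
have un (A B : E) (f : hom A B) :
    u B <o> f =h fmap R2 (fmap R1 (fmap L1 (fmap L2 f))) <o> u A.
  apply: heq_trans (heq_sym (compA _ _ _)) _.
  apply: heq_trans (comp_congr _ (nat_sq u2 f)) _.
  apply: heq_trans (compA _ _ _) _.
  apply: heq_trans _ (heq_sym (compA _ _ _)); apply: comp_congl.
  apply: heq_trans (heq_sym (fmapM R2 _ _)) _.
  apply: heq_trans _ (fmapM R2 _ _).
  by apply: fmap_heq; exact: (nat_sq u1 (fmap L2 f)).
have cn (A B : C) (f : hom A B) :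
    c B <o> fmap L1 (fmap L2 (fmap R2 (fmap R1 f))) =h f <o> c A.
  apply: heq_trans (heq_sym (compA _ _ _)) _.
  apply: heq_trans (comp_congr _ (heq_sym (fmapM L1 _ _))) _.
  apply: heq_trans (comp_congr _ (fmap_heq L1 (nat_sq c2 (fmap R1 f)))) _.
  apply: heq_trans (comp_congr _ (fmapM L1 _ _)) _.
  apply: heq_trans (compA _ _ _) _.
  apply: heq_trans (comp_congl _ (nat_sq c1 f)) _.
  by apply: heq_sym; exact: compA.
exists (@NatTrans _ _ (functor_id E)
  (functor_comp (functor_comp R2 R1) (functor_comp L1 L2)) u un).
exists (@NatTrans _ _
  (functor_comp (functor_comp L1 L2) (functor_comp R2 R1)) (functor_id C) c cn).
split=> [A|B] /=.
- apply: heq_trans (comp_congr _ (fmap_heq L1 (fmapM L2 _ _))) _.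
  apply: heq_trans (heq_sym (compA _ _ _)) _.
  apply: heq_trans (comp_congr _ (heq_sym (fmapM L1 _ _))) _.
  have step : c2 (R1 (L1 (L2 A))) <o>
      fmap L2 (fmap R2 (u1 (L2 A))) <o> fmap L2 (u2 A) =h u1 (L2 A).
    apply: heq_trans (compA _ _ _) _.
    apply: heq_trans (comp_congl _ (nat_sq c2 (u1 (L2 A)))) _.
    apply: heq_trans (heq_sym (compA _ _ _)) _.
    apply: heq_trans (comp_congr _ (tl2 A)) _.
    exact: compm1.
  apply: heq_trans (comp_congr _ (fmap_heq L1 step)) _.
  exact: tl1.
- apply: heq_trans (compA _ _ _) _.
  apply: heq_trans (comp_congl _ (heq_sym (fmapM R2 _ _))) _.
  have step : fmap R1 (c1 B <o> fmap L1 (c2 (R1 B))) <o>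
      u1 (L2 (R2 (R1 B))) =h c2 (R1 B).
    apply: heq_trans (comp_congl _ (fmapM R1 _ _)) _.
    apply: heq_trans (heq_sym (compA _ _ _)) _.
    apply: heq_trans (comp_congr _ (heq_sym (nat_sq u1 (c2 (R1 B))))) _.
    apply: heq_trans (compA _ _ _) _.
    apply: heq_trans (comp_congl _ (tr1 B)) _.
    exact: comp1m.
  apply: heq_trans (comp_congl _ (fmap_heq R2 step)) _.
  exact: tr2.
Qed.
End AdjComp.

Lemma has_left_adjoint_id (C : category) : has_left_adjoint (functor_id C).
Proof. by exists (functor_id C); exact: adjunction_id. Qed.

Lemma has_left_adjoint_comp (C D E : category)
    (G : functor D E) (F : functor C D) :
  has_left_adjoint G -> has_left_adjoint F ->
  has_left_adjoint (functor_comp G F).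
Proof.
move=> [LG aG] [LF aF]; exists (functor_comp LF LG).
exact: adjunction_comp.
Qed.

Lemma exact_functor_id (k : fieldType) (C : lincat k) :
  @exact_functor k C C (functor_id C).
Proof.
split; last by [].
by split=> [A B f g|A B c f]; exact: heq_refl.
Qed.

Lemma exact_functor_comp (k : fieldType) (C D E : lincat k)
    (G : functor D E) (F : functor C D) :
  exact_functor G -> exact_functor F -> @exact_functor k C E (functor_comp G F).
Proof.
move=> [[GD GZ] Gex] [[FD FZ] Fex]; split; last first.
  by move=> A B X f g fg; apply: Gex; exact: Fex.
split=> [A B f g|A B c f].
  exact: heq_trans (fmap_heq G (FD _ _ f g)) (GD _ _ _ _).
exact: heq_trans (fmap_heq G (FZ _ _ c f)) (GZ _ _ _ _).
Qed.

Record endL (k : fieldType) := EndLOb {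
  el_fun :> functor (Pol k) (Pol k);
  el_exact : exact_functor el_fun;
  el_left : has_left_adjoint el_fun }.

Definition EndL_lin (k : fieldType) : lincat k :=
  full_sub (C := lin_funcat (Pol k) (Pol k)) (@el_fun k).

Section EndL.
Variable k : fieldType.
Implicit Types X Y Z : endL k.

Definition el_id : endL k :=
  EndLOb (exact_functor_id (Pol k)) (has_left_adjoint_id (Pol k)).

Definition el_comp X Y : endL k :=
  EndLOb (exact_functor_comp (el_exact X) (el_exact Y))
         (has_left_adjoint_comp (el_left X) (el_left Y)).

(** Composition of functors being associative and unital on the nose, all the
  structure isomorphisms have identity components. *)
Definition nat_assoc (F G H : functor (Pol k) (Pol k)) :
  nattrans (functor_comp (functor_comp F G) H)
           (functor_comp F (functor_comp G H)).
Proof.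
refine (@NatTrans _ _ (functor_comp (functor_comp F G) H) (functor_comp F (functor_comp G H))
  (fun A => idm (F (G (H A)))) _) => A B f.
by apply: heq_trans (comp1m _) _; apply: heq_sym; exact: compm1.
Defined.

Definition nat_associ (F G H : functor (Pol k) (Pol k)) :
  nattrans (functor_comp F (functor_comp G H))
           (functor_comp (functor_comp F G) H).
Proof.
refine (@NatTrans _ _ (functor_comp F (functor_comp G H)) (functor_comp (functor_comp F G) H)
  (fun A => idm (F (G (H A)))) _) => A B f.
by apply: heq_trans (comp1m _) _; apply: heq_sym; exact: compm1.
Defined.

Definition nat_lunit (F : functor (Pol k) (Pol k)) :
  nattrans (functor_comp (functor_id _) F) F.
Proof.
refine (@NatTrans _ _ (functor_comp (functor_id _) F) F
  (fun A => idm (F A)) _) => A B f.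
by apply: heq_trans (comp1m _) _; apply: heq_sym; exact: compm1.
Defined.

Definition nat_luniti (F : functor (Pol k) (Pol k)) :
  nattrans F (functor_comp (functor_id _) F).
Proof.
refine (@NatTrans _ _ F (functor_comp (functor_id _) F)
  (fun A => idm (F A)) _) => A B f.
by apply: heq_trans (comp1m _) _; apply: heq_sym; exact: compm1.
Defined.

Definition nat_runit (F : functor (Pol k) (Pol k)) :
  nattrans (functor_comp F (functor_id _)) F.
Proof.
refine (@NatTrans _ _ (functor_comp F (functor_id _)) F
  (fun A => idm (F A)) _) => A B f.
by apply: heq_trans (comp1m _) _; apply: heq_sym; exact: compm1.
Defined.

Definition nat_runiti (F : functor (Pol k) (Pol k)) :
  nattrans F (functor_comp F (functor_id _)).
Proof.
refine (@NatTrans _ _ F (functor_comp F (functor_id _))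
  (fun A => idm (F A)) _) => A B f.
by apply: heq_trans (comp1m _) _; apply: heq_sym; exact: compm1.
Defined.

Lemma idm_fmap1 (F : functor (Pol k) (Pol k)) (N : Pol k) :
  idm (F N) <o> fmap F (idm N) =h idm (F N).
Proof. by apply: heq_trans (comp1m _) _; exact: fmap1. Qed.

Definition EndL : monlincat k.
Proof.
refine (@MonLinCat k (EndL_lin k) el_comp el_id
  (fun X X' Y Y' b a => nat_hcomp b a)
  (fun X Y Z => nat_assoc X Y Z) (fun X Y Z => nat_associ X Y Z)
  (fun X => nat_lunit X) (fun X => nat_luniti X)
  (fun X => nat_runit X) (fun X => nat_runiti X)
  _ _ _ _ _ _ _ _ _ _ _ _ _ _ _ _ _ _).
- by move=> X X' Y Y' f f' g g' ef eg; exact: hcomp_heq.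
- by move=> X Y; exact: hcomp_id.
- by move=> X X' X'' Y Y' Y'' f' f g' g; exact: hcomp_comp.
- by move=> X X' Y Y' f f' g M; exact: compDl.
- move=> X X' Y Y' f g g' M.
  have [[XD _] _] := el_exact X.
  exact: heq_trans (comp_congr _ (XD _ _ (g M) (g' M))) (compDr _ _ _).
- by move=> X X' Y Y' c f g M; exact: compZl.
- move=> X X' Y Y' c f g M.
  have [[_ XZ] _] := el_exact X.
  exact: heq_trans (comp_congr _ (XZ _ _ c (g M))) (compZr _ _ _).
- by move=> X Y Z M; exact: comp1m.
- by move=> X Y Z M; exact: comp1m.
- by move=> X M; exact: comp1m.
- by move=> X M; exact: comp1m.
- by move=> X M; exact: comp1m.
- by move=> X M; exact: comp1m.
- move=> X X' Y Y' Z Z' f g h M.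
  apply: heq_trans (comp1m _) _; apply: heq_trans _ (heq_sym (compm1 _)).
  apply: heq_trans (heq_sym (compA _ _ _)) _; apply: comp_congr.
  by apply: heq_sym; apply: (fmapM X).
- move=> X X' f M.
  apply: heq_trans (comp1m _) _; apply: heq_trans _ (heq_sym (compm1 _)).
  exact: comp1m.
- move=> X X' f M.
  apply: heq_trans (comp1m _) _; apply: heq_trans _ (heq_sym (compm1 _)).
  by apply: heq_trans (comp_congr _ (fmap1 X _)) _; exact: compm1.
- move=> X Y Z T M.
  apply: heq_trans (comp1m _) _; apply: heq_sym.
  apply: heq_trans (comp_congl _ (idm_fmap1 X _)) _.
  apply: heq_trans (comp1m _) _; apply: heq_trans (comp1m _) _.
  exact: heq_trans (comp1m _)
    (fmap1 (functor_comp (functor_comp X Y) Z) (el_fun T M)).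
- move=> X Y M.
  apply: heq_trans (compm1 _) _.
  exact: heq_trans (idm_fmap1 X _) (heq_sym (idm_fmap1 X _)).
Defined.
End EndL.

(** * Khovanov's category

  The free k-linear additive monoidal category on the given generators modulo
  the given relations.  Objects are expressions in Q+, Q-, tensor products and
  finite direct sums; morphisms are well-typed expressions modulo the smallest
  congruence [kheq] that contains the axioms of a k-linear monoidal category,
  those of finite direct sums, and the defining relations.  The monoidal
  structure is not strict, hence the associators and unitors that appear in the
  defining relations; by coherence, the result does not depend on how they are
  inserted. *)

Inductive kob : Type :=
  | Qp | Qm | K1 | Ktens of kob & kob | K0 | Ksum of kob & kob.

Declare Scope kob_scope.
Delimit Scope kob_scope with K.
Bind Scope kob_scope with kob.
Notation "A * B" := (Ktens A B) : kob_scope.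
Local Open Scope kob_scope.

Section Khovanov.
Variable k : fieldType.

Inductive khom : kob -> kob -> Type :=
  | kid A : khom A A
  | kcomp A B C of khom B C & khom A B : khom A C
  | kzero A B : khom A B
  | kadd A B of khom A B & khom A B : khom A B
  | kscale A B of k & khom A B : khom A B
  | ktens A A' B B' of khom A A' & khom B B' : khom (A * B) (A' * B')
  | kassoc A B C : khom ((A * B) * C) (A * (B * C))
  | kassoci A B C : khom (A * (B * C)) ((A * B) * C)
  | klunit A : khom (K1 * A) A
  | kluniti A : khom A (K1 * A)
  | krunit A : khom (A * K1) A
  | kruniti A : khom A (A * K1)
  | kinl A B : khom A (Ksum A B)
  | kinr A B : khom B (Ksum A B)
  | kprl A B : khom (Ksum A B) A
  | kprr A B : khom (Ksum A B) B
  | keta1 : khom K1 (Qp * Qm)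
  | keps1 : khom (Qm * Qp) K1
  | keta2 : khom K1 (Qm * Qp)
  | keps2 : khom (Qp * Qm) K1
  | ktau : khom (Qp * Qp) (Qp * Qp).

Arguments kid {A}.
Arguments kassoc {A B C}.
Arguments kassoci {A B C}.
Arguments klunit {A}.
Arguments kluniti {A}.
Arguments krunit {A}.
Arguments kruniti {A}.

Local Notation "g # f" := (kcomp g f) (at level 41, right associativity).
Local Notation "f ** g" := (ktens f g) (at level 37, right associativity).
Local Notation "f <* A" := (ktens f (@kid A)) (at level 30).
Local Notation "A *> f" := (ktens (@kid A) f) (at level 30).

(** (A u B) u : 1 -> A A B B for u : 1 -> A B, and dually. *)
Definition kdouble_unit A B (u : khom K1 (A * B)) :
    khom K1 ((A * A) * (B * B)) :=
  kassoci # (A *> (kassoc # (u <* B) # kluniti)) # u.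

Definition kdouble_counit A B (c : khom (A * B) K1) :
    khom ((A * A) * (B * B)) K1 :=
  c # (A *> (klunit # (c <* B) # kassoci)) # kassoc.

(** Q- tau Q- on (Q- Q+) (Q+ Q-). *)
Definition kmid_tau : khom ((Qm * Qp) * (Qp * Qm)) ((Qm * Qp) * (Qp * Qm)) :=
  kassoci # (Qm *> (kassoc # (ktau <* Qm) # kassoci)) # kassoc.

Definition ktriangle : khom (Qp * Qm) (Qm * Qp) :=
  krunit # ((Qm * Qp) *> keps2) # kmid_tau # (keta2 <* (Qp * Qm)) # kluniti.

Definition ksquare : khom (Qm * Qp) (Qp * Qm) :=
  klunit # (keps1 <* (Qp * Qm)) # kmid_tau # ((Qm * Qp) *> keta1) # kruniti.

(** The two mates of tau. *)
Definition kmate1 : khom (Qm * Qm) (Qm * Qm) :=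
  klunit # (kdouble_counit keps1 <* (Qm * Qm)) # kassoci #
  ((Qm * Qm) *> (ktau <* (Qm * Qm))) #
  ((Qm * Qm) *> kdouble_unit keta1) # kruniti.

Definition kmate2 : khom (Qm * Qm) (Qm * Qm) :=
  krunit # ((Qm * Qm) *> kdouble_counit keps2) # kassoc #
  (((Qm * Qm) *> ktau) <* (Qm * Qm)) #
  (kdouble_unit keta2 <* (Qm * Qm)) # kluniti.

Local Reserved Notation "f =~ g" (at level 70, no associativity).

Inductive kheq : forall A B, khom A B -> khom A B -> Prop :=
  (* congruence *)
  | kheq_refl A B (f : khom A B) : f =~ f
  | kheq_sym A B (f g : khom A B) : f =~ g -> g =~ f
  | kheq_trans A B (f g h : khom A B) : f =~ g -> g =~ h -> f =~ h
  | kheq_comp A B C (g g' : khom B C) (f f' : khom A B) :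
      g =~ g' -> f =~ f' -> g # f =~ g' # f'
  | kheq_add A B (f f' g g' : khom A B) :
      f =~ f' -> g =~ g' -> kadd f g =~ kadd f' g'
  | kheq_scale A B c (f f' : khom A B) : f =~ f' -> kscale c f =~ kscale c f'
  | kheq_tens A A' B B' (f f' : khom A A') (g g' : khom B B') :
      f =~ f' -> g =~ g' -> f ** g =~ f' ** g'
  (* k-linear category *)
  | kcompA A B C D (h : khom C D) (g : khom B C) (f : khom A B) :
      h # (g # f) =~ (h # g) # f
  | kcomp1m A B (f : khom A B) : kid # f =~ f
  | kcompm1 A B (f : khom A B) : f # kid =~ f
  | kaddA A B (f g h : khom A B) : kadd f (kadd g h) =~ kadd (kadd f g) h
  | kaddC A B (f g : khom A B) : kadd f g =~ kadd g f
  | kadd0 A B (f : khom A B) : kadd (kzero A B) f =~ f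
  | kscaleA A B a b (f : khom A B) :
      kscale a (kscale b f) =~ kscale (a * b)%R f
  | kscale1 A B (f : khom A B) : kscale 1 f =~ f
  | kscale0 A B (f : khom A B) : kscale 0 f =~ kzero A B
  | kscaleDl A B a b (f : khom A B) :
      kscale (a + b) f =~ kadd (kscale a f) (kscale b f)
  | kscaleDr A B a (f g : khom A B) :
      kscale a (kadd f g) =~ kadd (kscale a f) (kscale a g)
  | kcompDl A B C (g g' : khom B C) (f : khom A B) :
      kadd g g' # f =~ kadd (g # f) (g' # f)
  | kcompDr A B C (g : khom B C) (f f' : khom A B) :
      g # kadd f f' =~ kadd (g # f) (g # f')
  | kcompZl A B C a (g : khom B C) (f : khom A B) :
      kscale a g # f =~ kscale a (g # f)
  | kcompZr A B C a (g : khom B C) (f : khom A B) :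
      g # kscale a f =~ kscale a (g # f)
  (* k-bilinear monoidal structure *)
  | ktens1 A B : @kid A ** @kid B =~ kid
  | ktensM A A' A'' B B' B'' (f' : khom A' A'') (f : khom A A')
      (g' : khom B' B'') (g : khom B B') :
      (f' # f) ** (g' # g) =~ (f' ** g') # (f ** g)
  | ktensDl A A' B B' (f f' : khom A A') (g : khom B B') :
      kadd f f' ** g =~ kadd (f ** g) (f' ** g)
  | ktensDr A A' B B' (f : khom A A') (g g' : khom B B') :
      f ** kadd g g' =~ kadd (f ** g) (f ** g')
  | ktensZl A A' B B' c (f : khom A A') (g : khom B B') :
      kscale c f ** g =~ kscale c (f ** g)
  | ktensZr A A' B B' c (f : khom A A') (g : khom B B') :
      f ** kscale c g =~ kscale c (f ** g)
  | kassocK A B C : kassoci # @kassoc A B C =~ kid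
  | kassociK A B C : kassoc # @kassoci A B C =~ kid
  | klunitK A : kluniti # @klunit A =~ kid
  | klunitiK A : klunit # @kluniti A =~ kid
  | krunitK A : kruniti # @krunit A =~ kid
  | krunitiK A : krunit # @kruniti A =~ kid
  | kassoc_nat A A' B B' C C' (f : khom A A') (g : khom B B') (h : khom C C') :
      kassoc # ((f ** g) ** h) =~ (f ** (g ** h)) # kassoc
  | klunit_nat A A' (f : khom A A') : klunit # (K1 *> f) =~ f # klunit
  | krunit_nat A A' (f : khom A A') : krunit # (f <* K1) =~ f # krunit
  | kpentagon A B C D :
      kassoc # kassoc =~
      (A *> @kassoc B C D) # kassoc # (@kassoc A B C <* D)
  | ktriangle_ax A B : (A *> @klunit B) # kassoc =~ @krunit A <* B
  (* zero object and direct sums *)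
  | kzero_ob : @kid K0 =~ kzero K0 K0
  | kprl_inl A B : kprl A B # kinl A B =~ kid
  | kprr_inr A B : kprr A B # kinr A B =~ kid
  | kprl_inr A B : kprl A B # kinr A B =~ kzero B A
  | kprr_inl A B : kprr A B # kinl A B =~ kzero A B
  | ksum_id A B :
      kadd (kinl A B # kprl A B) (kinr A B # kprr A B) =~ kid
  | kR0_a : klunit # (keps1 <* Qm) # kassoci # (Qm *> keta1) # kruniti
            =~ kid
  | kR0_b : krunit # (Qp *> keps1) # kassoc # (keta1 <* Qp) # kluniti
            =~ kid
  | kR0_c : klunit # (keps2 <* Qp) # kassoci # (Qp *> keta2) # kruniti
            =~ kid
  | kR0_d : krunit # (Qm *> keps2) # kassoc # (keta2 <* Qm) # kluniti
            =~ kid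
  | kR0_e : kmate1 =~ kmate2
  | kR1 : keps1 # keta2 =~ kid
  | kR2 : ktau # ktau =~ kid
  | kR3 : (Qp *> ktau) # (kassoc # (ktau <* Qp) # kassoci) # (Qp *> ktau)
          =~ (kassoc # (ktau <* Qp) # kassoci) # (Qp *> ktau) #
             (kassoc # (ktau <* Qp) # kassoci)
  | kR4 : klunit # (keps1 <* Qp) # kassoci # (Qm *> ktau) # kassoc #
          (keta2 <* Qp) # kluniti =~ kzero Qp Qp
  | kR5 : ksquare # ktriangle =~ kid
  | kR6 : ktriangle # ksquare =~ kadd kid (kscale (-1) (keta2 # keps1))
where "f =~ g" := (kheq f g).

Definition Khovanov_cat : category :=
  @Category kob khom kheq (@kid) kcomp kheq_refl kheq_sym kheq_trans
    kheq_comp kcompA kcomp1m kcompm1.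

Definition Khovanov_lin : lincat k :=
  @LinCat k Khovanov_cat kzero kadd kscale kheq_add kheq_scale
    kaddA kaddC kadd0 kscaleA kscale1 kscale0 kscaleDl kscaleDr
    kcompDl kcompDr kcompZl kcompZr.

Definition Khovanov : monlincat k :=
  @MonLinCat k Khovanov_lin Ktens K1 ktens (@kassoc) (@kassoci) (@klunit)
    (@kluniti) (@krunit) (@kruniti) kheq_tens ktens1 ktensM ktensDl ktensDr
    ktensZl ktensZr kassocK kassociK klunitK klunitiK krunitK krunitiK
    kassoc_nat klunit_nat krunit_nat kpentagon ktriangle_ax.

End Khovanov.

Arguments keta1 {k}.
Arguments keps1 {k}.
Arguments keta2 {k}.
Arguments keps2 {k}.
Arguments ktau {k}.

(** * The five natural transformations *)

Section Formulas.
Variable k : fieldType.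
Implicit Types (M : polyfun k) (V : vectType k).
Local Notation F := (F_functor k).
Local Notation E := (E_functor k).
Local Notation Id := (functor_id (Pol k)).

(** G(M)(V), and the component G(M)(V) -> G'(M)(V). *)
Definition at_ob (G : functor (Pol k) (Pol k)) M V : vectType k :=
  pf_ob (G M : polyfun k) V.

Definition at_comp (G G' : functor (Pol k) (Pol k)) (a : nattrans G G') M V :
  'Hom(at_ob G M V, at_ob G' M V) := pol_comp (a M) V.

(** v |-> (v, xi(v)) *)
Definition graph V (xi : dual V) : 'Hom(V, plus_line V) :=
  linfun (fun v => (v, xi v)).

(** (w, a) |-> w + a v *)
Definition shear V (v : V) : 'Hom(plus_line V, V) :=
  linfun (fun x : V * k^o => x.1 + (x.2 : k) *: v).

Definition proj_V V : 'Hom(plus_line V, V) := linfun (fun x : V * k^o => x.1).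
Definition inj_V V : 'Hom(V, plus_line V) := linfun (fun v => (v, 0 : k^o)).

Lemma graphE V (xi : dual V) v : graph xi v = (v, xi v).
Proof. by rewrite linfunE // => a x y; rewrite linearP. Qed.

Lemma shearE V (v : V) x : shear v x = x.1 + (x.2 : k) *: v.
Proof.
rewrite linfunE // => a [x1 x2] [y1 y2] /=.
by rewrite scalerDl scalerDr -!scalerA addrACA.
Qed.

Lemma proj_VE V x : proj_V V x = x.1.
Proof. by rewrite linfunE. Qed.

Lemma inj_VE V v : inj_V V v = (v, 0).
Proof. by rewrite linfunE // => a x y; congr (_, _); rewrite /= scaler0 addr0. Qed.

(** (m)_1 as an element of E(M)(V). *)
Definition weight1 M V (m : pf_ob M (plus_line V)) : at_ob E M V :=
  vsproj (weight_space M V 1) (weight_proj M V 1 m).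

Definition is_eta1 (a : nattrans Id (functor_comp F E)) : Prop :=
  forall M V (e : (\dim {:V}).-tuple V) (m : pf_ob M V),
    basis_of {:V} e ->
    at_comp a M V m =
    \sum_(i < \dim {:V})
       pure (weight1 (pf_map M (graph (linfun (fun v => coord e i v : k^o))) m))
            e`_i.

(** E(F(M))(V) is the weight 1 subspace of M(V (+) k) (x) (V (+) k); it is
  spanned by n (x) (v, 0) and m (x) (0, 1) with n of weight 1 and m of
  weight 0. *)
Definition is_eps1 (a : nattrans (functor_comp E F) Id) : Prop :=
  forall M V (x : at_ob (functor_comp E F) M V)
         (n m : pf_ob M (plus_line V)) (v : V),
    weight 1 n -> weight 0 m ->
    (vsval x = pure n ((v, 0) : plus_line V)
               + pure m ((0, 1) : plus_line V)) ->
    at_comp a M V x = pf_map M (proj_V V) m.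

Definition is_eta2 (a : nattrans Id (functor_comp E F)) : Prop :=
  forall M V (m : pf_ob M V),
    vsval (at_comp a M V m) =
    pure (pf_map M (inj_V V) m) ((0, 1) : plus_line V).

Definition is_eps2 (a : nattrans (functor_comp F E) Id) : Prop :=
  forall M V (m : at_ob E M V) (v : V),
    at_comp a M V (pure m v) = pf_map M (shear v) (vsval m).

Definition is_tau (a : nattrans (functor_comp F F) (functor_comp F F)) : Prop :=
  forall M V (m : pf_ob M V) (v w : V),
    at_comp a M V (pure (pure m v) w) = pure (pure m w) v.

(** [Omega] sends Q+, Q- to F, E and the generating morphisms to the natural
  transformations above.  As [Omega] is strong rather than strict monoidal,
  the latter are compared with its values on generators by means of its
  structure isomorphisms. *)
Definition extends_assignment (Omega : monfunctor (Khovanov k) (EndL k)) :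
    Prop :=
  exists (eF : el_fun (Omega Qp) = F) (eE : el_fun (Omega Qm) = E),
    let f := nat_of_eq eF in let f' := nat_of_eq (esym eF) in
    let e := nat_of_eq eE in let e' := nat_of_eq (esym eE) in
    [/\ is_eta1 (nat_comp (nat_hcomp f e)
                   (mui Omega Qp Qm <o> fmap Omega keta1 <o> mu0 Omega)),
        is_eps1 (nat_comp
                   (mu0i Omega <o> fmap Omega keps1 <o> mu Omega Qm Qp)
                   (nat_hcomp e' f')),
        is_eta2 (nat_comp (nat_hcomp e f)
                   (mui Omega Qm Qp <o> fmap Omega keta2 <o> mu0 Omega)),
        is_eps2 (nat_comp
                   (mu0i Omega <o> fmap Omega keps2 <o> mu Omega Qp Qm)
                   (nat_hcomp f' e')) &
        is_tau (nat_comp (nat_hcomp f f)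
                 (nat_comp
                   (mui Omega Qp Qp <o> fmap Omega ktau <o> mu Omega Qp Qp)
                   (nat_hcomp f' f')))].
End Formulas.

Definition infinite_field (k : fieldType) : Prop :=
  forall s : seq k, exists x, x \notin s.

(* Main.v *)
From HB Require Import structures.
From mathcomp Require Import all_boot all_algebra.
From mathcomp.multinomials Require Import mpoly.
From Stdlib Require Import ClassicalEpsilon Setoid Morphisms.
Require Import Defs.

(** Sending products of objects to composites and direct sums to pointwise direct
  sums leaves two things to prove: every value of the functor is exact and has a
  left adjoint, and the relations hold.

  Two of the zigzag relations say that E is left adjoint to F, the other two that
  F is left adjoint to E.  Endofunctors that are linear and have both a left and a
  right adjoint are exact, and these are closed under composition and direct sums.

  For the relations, let T_g be the action of g on M(V (+) k).  As k is infinite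
  and g |-> M(T_g) is polynomial, M(T_g) = \sum_i g^i pi_i, where pi_i is the
  projection to weight i.  Hence a linear map L with L M(T_g) = g^i L for all g
  satisfies L pi_i = L, and whatever commutes with all M(T_g) commutes with pi_i.
  In the same way, a polynomial map that is homogeneous of degree 1 is linear;
  this makes eta1 linear in xi, and eps2 linear in v.  Writing elements of
  M(V) (x) V as linear maps t : V^* -> M(V), one has
     eta1(m) = (xi |-> pi_1 M(graph xi) m),  eps1(x) = M(p_V)(x(a)),
     tau(t)(xi)(zeta) = t(zeta)(xi),
  with a : V (+) k -> k the projection; the two mates of tau are both the map
  induced by exchanging the two copies of k in V (+) k (+) k. *)

Set Implicit Arguments.
Unset Strict Implicit.
Unset Printing Implicit Defensive.

Import GRing.Theory.
Local Open Scope ring_scope.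
Local Open Scope cat_scope.

(** * Exactness from adjoints, and direct sums of functors *)

#[local] Hint Resolve heq_refl : core.

#[local] Instance heq_Equivalence (C : category) (A B : C) :
  Equivalence (@heq C A B).
Proof.
by split; [exact: heq_refl | exact: heq_sym | exact: heq_trans].
Qed.

#[local] Instance comp_Proper (C : category) (A B D : C) :
  Proper (@heq C B D ==> @heq C A B ==> @heq C A D)%signature (@comp C A B D).
Proof. by move=> g g' eg f f' ef; exact: comp_heq. Qed.

#[local] Instance fmap_Proper (C D : category) (F : functor C D) (A B : C) :
  Proper (@heq C A B ==> @heq D (F A) (F B))%signature (@fmap C D F A B).
Proof. by move=> f f' e; exact: fmap_heq. Qed.

#[local] Instance hadd_Proper (k : fieldType) (C : lincat k) (A B : C) :
  Proper (@heq C A B ==> @heq C A B ==> @heq C A B)%signature (@hadd k C A B).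
Proof. by move=> f f' ef g g' eg; exact: hadd_heq. Qed.

Definition has_right_adjoint (C D : category) (L : functor C D) : Prop :=
  exists R : functor D C, adjunction L R.

Section LinCat.
Variables (k : fieldType) (C : lincat k).
Implicit Types A B D : C.

Lemma comp0m A B D (f : hom A B) : hzero B D <o> f =h hzero A D.
Proof.
by rewrite -(hscale0 (hzero B D)) compZl hscale0.
Qed.

Lemma compm0 A B D (g : hom B D) : g <o> hzero A B =h hzero A D.
Proof. by rewrite -(hscale0 (hzero A B)) compZr hscale0. Qed.

Lemma haddr0 A B (f : hom A B) : f +h hzero A B =h f.
Proof. by rewrite haddC hadd0. Qed.
End LinCat.

Lemma linear_functor0 (k : fieldType) (C D : lincat k) (F : functor C D)
    (A B : C) : linear_functor F -> fmap F (hzero A B) =h hzero (F A) (F B).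
Proof. by case=> _ FZ; rewrite -(hscale0 (hzero A B)) FZ hscale0. Qed.

(** A map [h] killed by [fmap R g] corresponds under the adjunction to a map [L X -> B] killed by
    [g]. That map factors uniquely through the kernel [f], and the factorization is transposed back.
    Linearity gives [R 0 = 0]. *)
Lemma right_adjoint_kernel (k : fieldType) (C D : lincat k) (R : functor C D)
    (A B E : C) (f : hom A B) (g : hom B E) :
  linear_functor R -> has_left_adjoint R -> is_kernel f g ->
  is_kernel (fmap R f) (fmap R g).
Proof.
move=> linR [L [u [c [tL tR]]]] [gf0 univ]; split.
  by rewrite -fmapM gf0 linear_functor0.
move=> X h gh0.
have c_nat Y Z (a : hom Y Z) : c Z <o> fmap L (fmap R a) =h a <o> c Y.
  exact: (nat_sq c a).
have u_nat Y Z (a : hom Y Z) : u Z <o> a =h fmap R (fmap L a) <o> u Y.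
  exact: (nat_sq u a).
have tL' Y : c (L Y) <o> fmap L (u Y) =h idm (L Y) by exact: tL.
have tR' Y : fmap R (c Y) <o> u (R Y) =h idm (R Y) by exact: tR.
have [] := univ (L X) (c B <o> fmap L h).
  rewrite compA -c_nat -compA -fmapM gh0.
  have -> : hzero X (R E) =h fmap R (hzero (L X) E) <o> u X.
    by rewrite linear_functor0 // comp0m.
  by rewrite fmapM compA c_nat comp0m comp0m.
move=> v [fv uniq_v]; exists (fmap R v <o> u X); split=> [|u' fu'].
  by rewrite compA -fmapM fv fmapM -compA -u_nat compA tR' comp1m.
have e : c A <o> fmap L u' =h v.
  by apply: uniq_v; rewrite compA -c_nat -compA -fmapM fu'.
by rewrite -e fmapM -compA -u_nat compA tR' comp1m.
Qed.

(** Dual to the previous argument: transpose [h] to a map into [R X], factor it through the cokernel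
    [g], and transpose back with the counit. *)
Lemma left_adjoint_cokernel (k : fieldType) (C D : lincat k) (L : functor D C)
    (A B E : D) (f : hom A B) (g : hom B E) :
  linear_functor L -> has_right_adjoint L -> is_cokernel f g ->
  is_cokernel (fmap L f) (fmap L g).
Proof.
move=> linL [R [u [c [tL tR]]]] [gf0 univ]; split.
  by rewrite -fmapM gf0 linear_functor0.
move=> X h hf0.
have c_nat Y Z (a : hom Y Z) : c Z <o> fmap L (fmap R a) =h a <o> c Y.
  exact: (nat_sq c a).
have u_nat Y Z (a : hom Y Z) : u Z <o> a =h fmap R (fmap L a) <o> u Y.
  exact: (nat_sq u a).
have tL' Y : c (L Y) <o> fmap L (u Y) =h idm (L Y) by exact: tL.
have [] := univ (R X) (fmap R h <o> u B).
  rewrite -compA u_nat compA -fmapM hf0.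
  have -> : hzero (L A) X =h c X <o> fmap L (hzero A (R X)).
    by rewrite linear_functor0 // compm0.
  by rewrite fmapM -compA -u_nat compm0 compm0.
move=> v [vg uniq_v]; exists (c X <o> fmap L v); split=> [|u' u'g].
  by rewrite -compA -fmapM vg fmapM compA c_nat -compA tL' compm1.
have e : fmap R u' <o> u E =h v.
  by apply: uniq_v; rewrite -compA u_nat compA -fmapM u'g.
by rewrite -e fmapM compA c_nat -compA tL' compm1.
Qed.

Lemma exact_of_adjoints (k : fieldType) (C D : lincat k) (F : functor C D) :
  linear_functor F -> has_left_adjoint F -> has_right_adjoint F ->
  exact_functor F.
Proof.
move=> linF lF rF; split=> // A B E f g [kfg cfg].
by split; [exact: right_adjoint_kernel | exact: left_adjoint_cokernel].
Qed.

(** * Biproducts, and adjunctions between direct sums of functors *)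

Record biproduct (k : fieldType) (C : lincat k) (A B : C) := Biproduct {
  bp_ob : C;
  bp_inl : hom A bp_ob;
  bp_inr : hom B bp_ob;
  bp_prl : hom bp_ob A;
  bp_prr : hom bp_ob B;
  bp_prl_inl : bp_prl <o> bp_inl =h idm A;
  bp_prr_inr : bp_prr <o> bp_inr =h idm B;
  bp_prl_inr : bp_prl <o> bp_inr =h hzero B A;
  bp_prr_inl : bp_prr <o> bp_inl =h hzero A B;
  bp_sum : bp_inl <o> bp_prl +h bp_inr <o> bp_prr =h idm bp_ob }.

Section SumFunctor.
Variables (k : fieldType) (C : category) (D : lincat k).
Variable bp : forall A B : D, biproduct A B.

Definition sum_map (A A' B B' : D) (f : hom A A') (g : hom B B') :
    hom (bp_ob (bp A B)) (bp_ob (bp A' B')) :=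
  (bp_inl (bp A' B') <o> f <o> bp_prl (bp A B))
  +h (bp_inr (bp A' B') <o> g <o> bp_prr (bp A B)).

#[local] Instance sum_map_Proper (A A' B B' : D) :
  Proper (@heq D A A' ==> @heq D B B' ==> @heq D _ _)%signature (@sum_map A A' B B').
Proof. by move=> f f' ef g g' eg; rewrite /sum_map ef eg. Qed.

Lemma sum_map_inl (A A' B B' : D) (f : hom A A') (g : hom B B') :
  sum_map f g <o> bp_inl (bp A B) =h bp_inl (bp A' B') <o> f.
Proof.
by rewrite compDl -!compA bp_prl_inl bp_prr_inl !compm0 compm1 haddr0.
Qed.

Lemma sum_map_inr (A A' B B' : D) (f : hom A A') (g : hom B B') :
  sum_map f g <o> bp_inr (bp A B) =h bp_inr (bp A' B') <o> g.
Proof.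
by rewrite compDl -!compA bp_prl_inr bp_prr_inr !compm0 compm1 hadd0.
Qed.

Lemma prl_sum_map (A A' B B' : D) (f : hom A A') (g : hom B B') :
  bp_prl (bp A' B') <o> sum_map f g =h f <o> bp_prl (bp A B).
Proof.
by rewrite compDr !compA bp_prl_inl bp_prl_inr !comp0m comp1m haddr0.
Qed.

Lemma prr_sum_map (A A' B B' : D) (f : hom A A') (g : hom B B') :
  bp_prr (bp A' B') <o> sum_map f g =h g <o> bp_prr (bp A B).
Proof.
by rewrite compDr !compA bp_prr_inr bp_prr_inl !comp0m comp1m hadd0.
Qed.

Variables F G : functor C D.

Definition sum_functor : functor C D.
Proof.
refine (@Functor C D (fun A => bp_ob (bp (F A) (G A)))
  (fun A B f => sum_map (fmap F f) (fmap G f)) _ _ _).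
- by move=> A B f g e; rewrite e.
- by move=> A; rewrite /sum_map !fmap1 !comp1m bp_sum.
- move=> A B E g f; rewrite {3}/sum_map compDr !compA sum_map_inl sum_map_inr.
  by rewrite /sum_map !fmapM -!compA.
Defined.

Definition sum_inl : nattrans F sum_functor.
Proof.
exists (fun A => bp_inl (bp (F A) (G A))) => A B f /=.
by rewrite sum_map_inl.
Defined.

Definition sum_inr : nattrans G sum_functor.
Proof.
exists (fun A => bp_inr (bp (F A) (G A))) => A B f /=.
by rewrite sum_map_inr.
Defined.

Definition sum_prl : nattrans sum_functor F.
Proof.
exists (fun A => bp_prl (bp (F A) (G A))) => A B f /=.
by rewrite prl_sum_map.
Defined.

Definition sum_prr : nattrans sum_functor G.
Proof.
exists (fun A => bp_prr (bp (F A) (G A))) => A B f /=.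
by rewrite prr_sum_map.
Defined.
End SumFunctor.

Lemma sum_functor_linear (k : fieldType) (C D : lincat k)
    (bp : forall A B : D, biproduct A B) (F G : functor C D) :
  linear_functor F -> linear_functor G ->
  @linear_functor k C D (sum_functor bp F G).
Proof.
move=> [FD FZ] [GD GZ]; split=> [A B f g|A B c f] /=; rewrite /sum_map.
  rewrite FD GD !compDl !compDr -!haddA; apply: hadd_heq; first by [].
  by rewrite haddC -haddA; apply: hadd_heq; first by []; rewrite haddC.
by rewrite FZ GZ !compZl !compZr hscaleDr.
Qed.

Section SumAdjunction.
Variables (k : fieldType) (C D : lincat k).
Variables (bC : forall A B : C, biproduct A B).
Variables (bD : forall A B : D, biproduct A B).
Variables (L L' : functor D C) (R R' : functor C D).

(** The unit and the counit are assembled from those of the two summands by means of the inclusions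
    and projections. The biproduct equations remove the mixed terms, and each triangle identity
    splits into those of the two given adjunctions. *)
Lemma sum_adjunction : adjunction L R -> adjunction L' R' ->
  adjunction (sum_functor bC L L' : functor D C)
             (sum_functor bD R R' : functor C D).
Proof.
move=> [u [c [tL tR]]] [u' [c' [tL' tR']]].
have c_nat Y Z (a : hom Y Z) : c Z <o> fmap L (fmap R a) =h a <o> c Y.
  exact: (nat_sq c a).
have u_nat Y Z (a : hom Y Z) : u Z <o> a =h fmap R (fmap L a) <o> u Y.
  exact: (nat_sq u a).
have c'_nat Y Z (a : hom Y Z) : c' Z <o> fmap L' (fmap R' a) =h a <o> c' Y.
  exact: (nat_sq c' a).
have u'_nat Y Z (a : hom Y Z) : u' Z <o> a =h fmap R' (fmap L' a) <o> u' Y.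
  exact: (nat_sq u' a).
have tl Y : c (L Y) <o> fmap L (u Y) =h idm (L Y) by exact: tL.
have tr Y : fmap R (c Y) <o> u (R Y) =h idm (R Y) by exact: tR.
have tl' Y : c' (L' Y) <o> fmap L' (u' Y) =h idm (L' Y) by exact: tL'.
have tr' Y : fmap R' (c' Y) <o> u' (R' Y) =h idm (R' Y) by exact: tR'.
pose LL := sum_functor bC L L' : functor D C.
pose RR := sum_functor bD R R' : functor C D.
have LLm (X Y : D) (a : hom X Y) :
  fmap LL a = sum_map bC (fmap L a) (fmap L' a) by [].
have RRm (X Y : C) (a : hom X Y) :
  fmap RR a = sum_map bD (fmap R a) (fmap R' a) by [].
pose uu (A : D) : hom A (RR (LL A)) :=
  (bp_inl (bD (R (LL A)) (R' (LL A))) <o>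
     fmap R (bp_inl (bC (L A) (L' A))) <o> u A)
  +h (bp_inr (bD (R (LL A)) (R' (LL A))) <o>
     fmap R' (bp_inr (bC (L A) (L' A))) <o> u' A).
pose cc (B : C) : hom (LL (RR B)) B :=
  (c B <o> fmap L (bp_prl (bD (R B) (R' B))) <o>
     bp_prl (bC (L (RR B)) (L' (RR B))))
  +h (c' B <o> fmap L' (bp_prr (bD (R B) (R' B))) <o>
     bp_prr (bC (L (RR B)) (L' (RR B)))).
have uu_nat (A B : D) (f : hom A B) : uu B <o> f =h fmap RR (fmap LL f) <o> uu A.
  rewrite /uu compDl compDr -!compA u_nat u'_nat.
  rewrite ![in X in _ =h X]compA sum_map_inl sum_map_inr.
  rewrite !compA -[in X in _ =h X](compA _ (fmap R _) (fmap R _)).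
  rewrite -[in X in _ =h X](compA _ (fmap R' _) (fmap R' _)).
  rewrite -!fmapM sum_map_inl sum_map_inr !fmapM.
  by rewrite !compA.
have cc_nat (A B : C) (f : hom A B) : cc B <o> fmap LL (fmap RR f) =h f <o> cc A.
  rewrite LLm /cc compDl [X in _ =h X]compDr -!compA prl_sum_map prr_sum_map.
  rewrite !compA -(compA (c B)) -(compA (c' B)) -!fmapM.
  by rewrite RRm prl_sum_map prr_sum_map !fmapM !compA c_nat c'_nat.
have prl_uu A : bp_prl _ <o> uu A =h fmap R (bp_inl (bC (L A) (L' A))) <o> u A.
  by rewrite /uu compDr !compA bp_prl_inl bp_prl_inr !comp0m comp1m haddr0.
have prr_uu A : bp_prr _ <o> uu A =h fmap R' (bp_inr (bC (L A) (L' A))) <o> u' A.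
  by rewrite /uu compDr !compA bp_prr_inl bp_prr_inr !comp0m comp1m hadd0.
have cc_inl B : cc B <o> bp_inl _ =h c B <o> fmap L (bp_prl (bD (R B) (R' B))).
  by rewrite /cc compDl -!compA bp_prl_inl bp_prr_inl !compm0 compm1 haddr0.
have cc_inr B : cc B <o> bp_inr _ =h c' B <o> fmap L' (bp_prr (bD (R B) (R' B))).
  by rewrite /cc compDl -!compA bp_prl_inr bp_prr_inr !compm0 compm1 hadd0.
exists (@NatTrans _ _ (functor_id D) (functor_comp RR LL) uu uu_nat).
exists (@NatTrans _ _ (functor_comp LL RR) (functor_id C) cc cc_nat).
split=> [A|B] /=.
  rewrite {1}/cc compDl -!compA prl_sum_map prr_sum_map.
  rewrite !compA -(compA (c _)) -(compA (c' _)) -!fmapM prl_uu prr_uu !fmapM.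
  rewrite !compA c_nat c'_nat -(compA _ (c _)) -(compA _ (c' _)) tl tl'.
  by rewrite !compm1 bp_sum.
rewrite /uu compDr !compA sum_map_inl sum_map_inr.
rewrite -(compA _ _ (fmap R (bp_inl _))) -(compA _ _ (fmap R' (bp_inr _))).
rewrite -!fmapM cc_inl cc_inr !fmapM -!compA -u_nat -u'_nat !(compA _ (u _)) !(compA _ (u' _)).
by rewrite tr tr' !comp1m bp_sum.
Qed.
End SumAdjunction.

Section ConstFunctor.
Variables (C D : category) (Z : D).

Definition const_functor : functor C D :=
  @Functor C D (fun _ => Z) (fun _ _ _ => idm Z) (fun _ _ _ _ _ => heq_refl _)
    (fun _ => heq_refl _) (fun _ _ _ _ _ => heq_sym (comp1m (idm Z))).
End ConstFunctor.

Section ZeroFunctor.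
Variables (k : fieldType) (C D : lincat k).
Variables (X : C) (Z : D).
Hypotheses (X0 : idm X =h hzero X X) (Z0 : idm Z =h hzero Z Z).

Lemma hom_to_zero (Y : D) (f g : hom Y Z) : f =h g.
Proof. by rewrite -(comp1m f) -(comp1m g) Z0 !comp0m. Qed.

Lemma hom_from_zero (Y : C) (f g : hom X Y) : f =h g.
Proof. by rewrite -(compm1 f) -(compm1 g) X0 !compm0. Qed.

Lemma zero_functor_linear : @linear_functor k C D (const_functor C Z).
Proof. by split=> *; exact: hom_to_zero. Qed.

(** Any two maps into [Z], and any two maps out of [X], agree. Zero maps therefore serve as unit and
    counit, and every equation is automatic. *)
Lemma zero_adjunction : adjunction (const_functor D X : functor D C)
                                   (const_functor C Z : functor C D).
Proof.
have un (A B : D) (f : hom A B) :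
    hzero B Z <o> f =h idm Z <o> hzero A Z by exact: hom_to_zero.
have cn (A B : C) (f : hom A B) :
    hzero X B <o> idm X =h f <o> hzero X A by exact: hom_from_zero.
exists (@NatTrans _ _ (functor_id D)
  (functor_comp (const_functor C Z) (const_functor D X)) (fun A => hzero A Z) un).
exists (@NatTrans _ _ (functor_comp (const_functor D X) (const_functor C Z))
  (functor_id C) (fun B => hzero X B) cn).
by split=> A; [exact: hom_from_zero | exact: hom_to_zero].
Qed.
End ZeroFunctor.

(** * Polynomial maps over an infinite field *)

Section InfiniteField.
Variable k : fieldType.
Hypothesis k_inf : infinite_field k.

Lemma infinite_uniq_seq n : exists s : seq k,
  [/\ size s = n, uniq s & 0 \notin s].
Proof.
elim: n => [|n [s [<- us s0]]]; first by exists [::].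
have [x] := k_inf (0 :: s); rewrite inE negb_or => /andP[x0 xs].
by exists (x :: s); rewrite /= xs us inE negb_or eq_sym x0 s0.
Qed.

(** An infinite field has more nonzero elements than a given nonzero polynomial has roots. *)
Lemma poly_vanish (p : {poly k}) : (forall g : k, g != 0 -> p.[g] = 0) -> p = 0.
Proof.
move=> p0; have [s [ss us s0]] := infinite_uniq_seq (size p).
apply: (@roots_geq_poly_eq0 _ p s) => //; last by rewrite ss.
apply/allP => x xs; rewrite /root p0 //.
by apply: contraNneq s0 => <-.
Qed.

Lemma coords_inj (W : vectType k) (x y : W) : coords x =1 coords y -> x = y.
Proof.
by move=> e; rewrite (coords_sum x) (coords_sum y); apply: eq_bigr => i _; rewrite e.
Qed.

Lemma coords_linear (W : vectType k) j : linear (fun x : W => coords x j : k^o).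
Proof. by move=> a x y; rewrite /coords linearP. Qed.

Lemma vpoly_vanish (W : vectType k) n (c : nat -> W) :
  (forall g : k, g != 0 -> \sum_(i < n) g ^+ i *: c i = 0) ->
  forall i, (i < n)%N -> c i = 0.
Proof.
move=> c0 i lin; apply: coords_inj => j.
have h : \poly_(i < n) coords (c i) j = 0.
  apply: poly_vanish => g g0; rewrite horner_poly.
  have /(congr1 (fun x => coords x j)) := c0 g g0.
  rewrite /coords linear0 linear_sum => e; rewrite -[RHS]e; apply: eq_bigr => l _.
  by rewrite linearZ mulrC.
have := congr1 (fun p : {poly k} => p`_i) h.
by rewrite /= coef_poly lin coef0 /coords linear0.
Qed.

(** Comparison of coefficients, the tool behind the weight arguments below. *)
Lemma vpoly_inj (W : vectType k) n (c d : nat -> W) :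
  (forall g : k, g != 0 ->
     \sum_(i < n) g ^+ i *: c i = \sum_(i < n) g ^+ i *: d i) ->
  forall i, (i < n)%N -> c i = d i.
Proof.
move=> e i lin; apply/eqP; rewrite -subr_eq0; apply/eqP.
apply: (@vpoly_vanish _ n (fun i => c i - d i)) => // g g0.
rewrite (eq_bigr (fun i : 'I_n => g ^+ i *: c i - g ^+ i *: d i)) => [|l _].
  by rewrite sumrB e // subrr.
by rewrite scalerBr.
Qed.

Lemma vpoly_monomial (W : vectType k) n j (c : nat -> W) (d : W) :
  (j < n)%N ->
  (forall g : k, g != 0 -> \sum_(i < n) g ^+ i *: c i = g ^+ j *: d) ->
  forall i, (i < n)%N -> c i = if i == j then d else 0.
Proof.
move=> ljn e; apply: (@vpoly_inj _ _ _ (fun i => if i == j then d else 0)) => g g0.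
rewrite e // (bigD1 (Ordinal ljn)) //= eqxx big1 ?addr0 // => i ij.
by rewrite ifN ?scaler0.
Qed.

Lemma poly_fun_line d (U : vectType k) (f : U -> k) (u w : U) :
  poly_fun_le d f -> exists q : {poly k}, forall x, f (u + x *: w) = q.[x].
Proof.
move=> [P [_ fP]].
pose q := \sum_(m <- msupp P) P@_m *:
  \prod_i ((coords u i)%:P + coords w i *: 'X) ^+ m i.
exists q => x; rewrite fP mevalE horner_sum; apply: eq_bigr => m _.
rewrite hornerZ horner_prod; congr (_ * _); apply: eq_bigr => i _.
rewrite horner_exp hornerD hornerC hornerZ hornerX /coords linearD linearZ /=.
by rewrite mulrC.
Qed.

(** Each coordinate of [f] restricts to a polynomial on the line, and the vector coefficients
    collect theirs. The length [m] is left free above [n], so that a prescribed exponent can be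
    brought into range when coefficients are compared. *)
Lemma poly_map_line (U W : vectType k) (f : U -> W) (u w : U) :
  poly_map f -> exists n (c : nat -> W), forall m, (n <= m)%N ->
    forall x, f (u + x *: w) = \sum_(i < m) x ^+ i *: c i.
Proof.
move=> [d fd].
have [q qP] : exists q : 'I_(\dim {:W}) -> {poly k},
    forall j x, coords (f (u + x *: w)) j = (q j).[x].
  apply: (@fin_all_exists _ (fun=> {poly k})
     (fun j q => forall x, coords (f (u + x *: w)) j = q.[x])) => j.
  exact: poly_fun_line (fd j).
exists (\max_j size (q j))%N, (fun i => \sum_j (q j)`_i *: (vbasis {:W})`_j).
move=> m lm x; rewrite [LHS]coords_sum.
under [RHS]eq_bigr => i _ do rewrite scaler_sumr.
rewrite exchange_big; apply: eq_bigr => j _; rewrite qP.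
under [RHS]eq_bigr => i _ do rewrite scalerA.
rewrite -scaler_suml; congr (_ *: _).
rewrite (@horner_coef_wide _ m).
  by apply: eq_bigr => i _; rewrite mulrC.
by apply: leq_trans lm; exact: (leq_bigmax j).
Qed.

(** Both sides of [f (g *: x) = g *: f x] are polynomials in [g]. Comparing the coefficients of [g]
    leaves in [f] only monomials of total degree 1, which are the coordinate functions. *)
Lemma homogeneous_poly_fun_linear d (U : vectType k) (f : U -> k^o) :
  poly_fun_le d f -> (forall (g : k) x, g != 0 -> f (g *: x) = g *: f x) -> linear f.
Proof.
move=> [P [_ fP]] fh.
have fE x : f x = \sum_(m <- msupp P | mdeg m == 1%N) P@_m * \prod_i coords x i ^+ m i.
  (* [Q] is [f (g *: x)] as a polynomial in [g]. *)
  pose Q := \sum_(m <- msupp P) (P@_m * \prod_i coords x i ^+ m i) *: 'X^(mdeg m).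
  have : Q = f x *: 'X.
    apply/eqP; rewrite -subr_eq0; apply/eqP; apply: poly_vanish => g g0.
    rewrite hornerD hornerN hornerZ hornerX mulrC -[g * f x]fh // fP mevalE.
    rewrite horner_sum -sumrB big1 // => m _; apply/eqP; rewrite subr_eq0; apply/eqP.
    rewrite hornerZ hornerXn -mulrA; congr (_ * _).
    rewrite mdegE -prodrXr -big_split; apply: eq_bigr => i _ /=.
    by rewrite /coords linearZ /= exprMn mulrC.
  move/(congr1 (fun p : {poly k} => p`_1)).
  rewrite /= coefZ coefX mulr1 => <-; rewrite coef_sum [RHS]big_mkcond.
  apply: eq_bigr => m _; rewrite coefZ coefXn eq_sym.
  by case: eqP; rewrite ?mulr1 ?mulr0.
move=> a x y; rewrite !fE scaler_sumr -big_split; apply: eq_bigr => m /mdeg1P[i /eqP ->] /=.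
have pE z : \prod_j coords z j ^+ U_(i)%MM j = coords z i.
  rewrite (bigD1 i) //= mnm1E eqxx big1 ?mulr1 // => j ji.
  by rewrite mnm1E eq_sym (negbTE ji).
rewrite !pE coords_linear mulrDr; congr (_ + _).
by rewrite /GRing.scale /= mulrCA.
Qed.

Lemma homogeneous_poly_map_linear (U W : vectType k) (f : U -> W) :
  poly_map f -> (forall (g : k) x, g != 0 -> f (g *: x) = g *: f x) -> linear f.
Proof.
move=> [d fd] fh a x y; apply: coords_inj => j.
rewrite coords_linear.
apply: (@homogeneous_poly_fun_linear d U (fun x => coords (f x) j)) => // g z g0.
by rewrite fh // /coords linearZ.
Qed.

End InfiniteField.

(** * Weights *)

Section Weights.
Variable k : fieldType.
Hypothesis k_inf : infinite_field k.
Implicit Types (M N : polyfun k) (U V W : vectType k).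

Lemma poly_map_affine U V W (f : U -> V) (c : V) (L : V -> W) :
  linear f -> linear L -> poly_map_le 1 (fun x => L (c + f x)).
Proof.
move=> lf lL; apply: (poly_map_post lL); apply: poly_map_add.
  exact: poly_map_mono (poly_map_const _ _).
exact: (poly_map_post lf (@poly_map_id _ U)).
Qed.

Lemma torusE V (g : k) x : torus V g x = (x.1, g *: x.2).
Proof. by rewrite dsum_mapE id_lfunE scale_lfunE id_lfunE. Qed.

Lemma torusM V (g h : k) : (torus V g \o torus V h)%VF = torus V (g * h).
Proof.
by apply/lfunP => x; rewrite comp_lfunE !torusE /= scalerA.
Qed.

Lemma torus1 V : torus V 1 = \1%VF.
Proof. by apply/lfunP => -[x y]; rewrite torusE id_lfunE /= scale1r. Qed.

Lemma pf_mapMx M V W U (f : 'Hom(W, U)) (g : 'Hom(V, W)) m :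
  pf_map M f (pf_map M g m) = pf_map M (f \o g)%VF m.
Proof. by rewrite pf_mapM comp_lfunE. Qed.

(** The endomorphisms [torus V g] form an affine line, with base point [torus V 0] and direction the
    projection to the summand [k]. *)
Lemma torus_expansion M V : exists n (c : nat -> 'End(pf_ob M (plus_line V))),
  forall m, (n <= m)%N -> forall g, pf_map M (torus V g) = \sum_(i < m) g ^+ i *: c i.
Proof.
have [n [c cP]] := poly_map_line (torus V 0) (dsum_map 0 \1)
  (pf_poly M (plus_line V) (plus_line V)).
exists n, c => m lm g; rewrite -cP //; congr (pf_map M _); apply/lfunP => x.
rewrite add_lfunE scale_lfunE !torusE dsum_mapE zero_lfunE id_lfunE scale0r.
by congr (_, _); rewrite /= ?scaler0 ?addr0 ?add0r.
Qed.

(** The projection is the coefficient of [g ^+ i] in the expansion of the torus action: on a vector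
    of weight [j] that action is [g ^+ j], so only the coefficient of index [j] survives. *)
Lemma weight_proj_exists M V i : exists p, @is_weight_proj k M V i p.
Proof.
have [n [c cP]] := torus_expansion M V.
(* From index [n] on, the weight spaces vanish, so the zero map is the projection. *)
exists (if (i < n)%N then c i else 0) => j x wx.
have h := @vpoly_monomial _ k_inf _ (maxn n j.+1) j (fun l => c l x) x.
have {}h : forall l, (l < maxn n j.+1)%N -> c l x = if l == j then x else 0.
  apply: h => [|g g0]; first by rewrite leq_max ltnSn orbT.
  by rewrite -wx // (cP _ (leq_maxl n j.+1)) sum_lfunE; apply: eq_bigr => l _;
    rewrite scale_lfunE.
case: ltnP => [lin|lni]; first by rewrite h 1?eq_sym // leq_max lin.
rewrite zero_lfunE; case: eqP => // ji; subst j.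
(* At [g = 1] the coefficients add up to the identity; all of them kill a vector whose weight is at
   least [n], so this vector is zero. *)
have := cP n (leqnn n) 1; rewrite torus1 pf_map1 => /lfunP /(_ x).
rewrite id_lfunE sum_lfunE big1 // => l _.
rewrite scale_lfunE h ?leq_max ?ltn_ord // ifN ?scaler0 //.
by rewrite neq_ltn (leq_trans (ltn_ord l) lni).
Qed.

Lemma weight_projP M V i j m : weight j m ->
  weight_proj M V i m = if j == i then m else 0.
Proof.
exact: (epsilon_spec (inhabits 0) (@is_weight_proj k M V i) (weight_proj_exists M V i) j m).
Qed.

Lemma weight_proj_id M V i m : weight i m -> weight_proj M V i m = m.
Proof. by move=> wm; rewrite (weight_projP i wm) eqxx. Qed.

(** The coefficients [c i] are identified with the weight projections. Comparing powers of [h] in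
    the actions of [g], [h] and [g * h] shows that [c i x] has weight [i], and at [g = 1] these
    vectors add up to [x]. *)
Lemma torus_weight_proj M V : exists n, forall m, (n <= m)%N -> forall g x,
  pf_map M (torus V g) x = \sum_(i < m) g ^+ i *: weight_proj M V i x.
Proof.
have [n [c cP]] := torus_expansion M V.
have wc i x : (i < n)%N -> weight i (c i x).
  move=> lin g g0.
  apply: (@vpoly_inj _ k_inf _ n (fun i => pf_map M (torus V g) (c i x))
            (fun i => g ^+ i *: c i x)) => // h h0.
  transitivity (pf_map M (torus V (g * h)) x).
    rewrite -torusM -pf_mapMx (cP _ (leqnn n) h) sum_lfunE linear_sum.
    by apply: eq_bigr => l _; rewrite scale_lfunE linearZ.
  rewrite (cP _ (leqnn n)) sum_lfunE; apply: eq_bigr => l _.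
  by rewrite scale_lfunE exprMn mulrC scalerA.
have sumc x : x = \sum_(i < n) c i x.
  have := cP n (leqnn n) 1; rewrite torus1 pf_map1 => /lfunP /(_ x).
  rewrite id_lfunE sum_lfunE => {1}->; apply: eq_bigr => i _.
  by rewrite scale_lfunE expr1n scale1r.
have cE i x : (i < n)%N -> weight_proj M V i x = c i x.
  move=> lin; rewrite {1}[x]sumc linear_sum (bigD1 (Ordinal lin)) //=.
  rewrite (weight_proj_id (wc _ _ lin)) big1 ?addr0 // => j ji.
  by rewrite (weight_projP i (wc _ _ (ltn_ord j))) ifN.
have c0 i x : (n <= i)%N -> weight_proj M V i x = 0.
  move=> lni; rewrite {1}[x]sumc linear_sum big1 // => j _ /=.
  rewrite (weight_projP i (wc _ _ (ltn_ord j))) ifN //.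
  by rewrite neq_ltn (leq_trans (ltn_ord j) lni).
exists n => m lm g x; rewrite (cP _ (leqnn n)) sum_lfunE.
rewrite (big_ord_widen m (fun i => (g ^+ i *: c i) x) lm) big_mkcond.
apply: eq_bigr => i _; case: ltnP => li; last by rewrite c0 ?scaler0.
by rewrite cE // scale_lfunE.
Qed.

Lemma weight_proj_weight M V i x : weight i (weight_proj M V i x).
Proof.
have [n nP] := torus_weight_proj M V.
move=> g g0.
apply: (@vpoly_inj _ k_inf _ (maxn n i.+1)
  (fun i => pf_map M (torus V g) (weight_proj M V i x))
  (fun i => g ^+ i *: weight_proj M V i x)) => [h h0|]; last first.
  by rewrite leq_max ltnSn orbT.
transitivity (pf_map M (torus V (g * h)) x).
  rewrite -torusM -pf_mapMx (nP _ (leq_maxl n i.+1) h) linear_sum.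
  by apply: eq_bigr => l _; rewrite linearZ.
rewrite (nP _ (leq_maxl n i.+1)); apply: eq_bigr => l _.
by rewrite exprMn mulrC scalerA.
Qed.

(** Apply [L] to the expansion of the torus action and compare coefficients of [g ^+ i]. *)
Lemma homogeneous_weight_proj M V W i (L : 'Hom(pf_ob M (plus_line V), W)) x :
  (forall (g : k) y, g != 0 -> L (pf_map M (torus V g) y) = g ^+ i *: L y) ->
  L (weight_proj M V i x) = L x.
Proof.
move=> Lh; have [n nP] := torus_weight_proj M V.
have lt : (i < maxn n i.+1)%N by rewrite leq_max ltnSn orbT.
rewrite (@vpoly_monomial _ k_inf _ (maxn n i.+1) i
  (fun i => L (weight_proj M V i x)) (L x)) ?eqxx // => g g0.
rewrite -Lh // (nP _ (leq_maxl n i.+1)) linear_sum.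
by apply: eq_bigr => l _; rewrite linearZ.
Qed.

Lemma weight_proj_torus M V i (g : k) x : 
  weight_proj M V i (pf_map M (torus V g) x) = g ^+ i *: weight_proj M V i x.
Proof.
have [n nP] := torus_weight_proj M V.
have lt : (i < maxn n i.+1)%N by rewrite leq_max ltnSn orbT.
rewrite (nP _ (leq_maxl n i.+1)) linear_sum (bigD1 (Ordinal lt)) //=.
rewrite linearZ /= (weight_proj_id (@weight_proj_weight _ _ _ _)).
rewrite big1 ?addr0 // => j ji; rewrite linearZ /=.
by rewrite (weight_projP i (@weight_proj_weight _ _ _ _)) ifN // scaler0.
Qed.

(** [weight] speaks of nonzero [g] only, but the expansion by weights holds at [g = 0] as well,
    where [0 ^+ 0 = 1] keeps exactly the term of weight 0. *)
Lemma torus0_weight0 M V x : weight 0 x -> pf_map M (torus V 0) x = x.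
Proof.
move=> wx; have [n nP] := torus_weight_proj M V.
have lt : (0 < maxn n 1)%N by rewrite leq_max orbT.
rewrite (nP _ (leq_maxl n 1)) (bigD1 (Ordinal lt)) //= expr0 scale1r.
rewrite (weight_proj_id wx) big1 ?addr0 // => -[[|j] lj] //= _.
by rewrite expr0n scale0r.
Qed.

(** The projection after [h] is homogeneous of degree [i], so it is unchanged when preceded by the
    projection. As [h] preserves weights, the outer projection can then be removed. *)
Lemma weight_proj_comm M N V W i
    (h : 'Hom(pf_ob M (plus_line V), pf_ob N (plus_line W))) x :
  (forall (g : k) y, g != 0 -> h (pf_map M (torus V g) y) = pf_map N (torus W g) (h y)) ->
  h (weight_proj M V i x) = weight_proj N W i (h x).
Proof.
move=> hc.
have := @homogeneous_weight_proj M V _ i (weight_proj N W i \o h)%VF x.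
rewrite !comp_lfunE => <- => [|g y g0].
  rewrite [RHS]weight_proj_id // => g g0.
  by rewrite -hc // (@weight_proj_weight _ _ _ _ g) // linearZ.
by rewrite !comp_lfunE hc // weight_proj_torus.
Qed.

Lemma weight_proj_pf_map M V W i (f : 'Hom(V, W)) x :
  pf_map M (dsum_map f \1%VF : 'Hom(plus_line V, plus_line W)) (weight_proj M V i x) =
  weight_proj M W i (pf_map M (dsum_map f \1%VF : 'Hom(plus_line V, plus_line W)) x).
Proof.
by apply: weight_proj_comm => g y _; rewrite !pf_mapMx torus_comm.
Qed.

Lemma weight_proj_pol M N (a : nattrans (pf_fun M) (pf_fun N)) V i x :
  pol_comp a (plus_line V) (weight_proj M V i x) =
  weight_proj N V i (pol_comp a (plus_line V) x).
Proof.
apply: weight_proj_comm => g y _.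
by rewrite -[LHS]comp_lfunE pol_nat comp_lfunE.
Qed.

Lemma val_weight1 M V m : vsval (@weight1 k M V m) = weight_proj M V 1 m.
Proof.
rewrite /weight1 vsprojK //; apply/weight_spaceP; exact: weight_proj_weight.
Qed.

End Weights.

(** * The natural transformations *)

Section Transformations.
Variable k : fieldType.
Hypothesis k_inf : infinite_field k.
Implicit Types (M N : polyfun k) (U V W : vectType k).
Local Notation F := (F_functor k).
Local Notation E := (E_functor k).
Local Notation Id := (functor_id (Pol k)).

Lemma tensor_ext U V W (f g : 'Hom(tensor U V, W)) :
  (forall u v, f (pure u v) = g (pure u v)) -> f = g.
Proof.
move=> e; apply/lfunP => t; rewrite (tensor_sum t) !linear_sum.
by apply: eq_bigr => i _; rewrite /= e.
Qed.

Lemma pureZr U V (u : U) (a : k) (v : V) : pure u (a *: v) = a *: pure u v.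
Proof. by apply/lfunP => xi; rewrite scale_lfunE !pureE linearZ scalerA. Qed.

Lemma tensor_map1rE U U' V (f : 'Hom(U, U')) (t : tensor U V) xi :
  tensor_map f \1 t xi = f (t xi).
Proof. by rewrite tensor_mapE !comp_lfunE dual_mapE comp_lfun1r. Qed.

Lemma tensor_mapxE U U' V V' (f : 'Hom(U, U')) (g : 'Hom(V, V')) (t : tensor U V) xi :
  tensor_map f g t xi = f (t (xi \o g)%VF).
Proof. by rewrite tensor_mapE !comp_lfunE dual_mapE. Qed.

Definition last_form V : dual (plus_line V) := linfun (fun x : V * k^o => x.2).

Lemma last_formE V x : last_form V x = x.2.
Proof. by rewrite linfunE. Qed.

Lemma weight1_linear M V : linear (@weight1 k M V).
Proof. by move=> a x y; rewrite /weight1 !linearP. Qed.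

(** Scaling [xi] composes [graph xi] with [torus V g], which multiplies the weight 1 part by [g].
    The map is thus homogeneous of degree 1, and it is polynomial because [graph] is affine in
    [xi]. *)
Lemma weight1_graph_linear M V (m : pf_ob M V) :
  linear (fun xi : dual V => weight1 (pf_map M (graph xi) m)).
Proof.
apply: homogeneous_poly_map_linear => // [|g xi g0].
  have [d hd] := pf_poly M V (plus_line V); exists d.
  apply: (@poly_map_pre k d _ _ _
    (fun f : 'Hom(V, plus_line V) => weight1 (pf_map M f m)) (@graph k V)).
    pose L (xi : dual V) : 'Hom(V, plus_line V) :=
      (linfun (fun a : k^o => (0, a) : plus_line V) \o xi)%VF.
    have inrE a : linfun (fun a : k^o => (0, a) : plus_line V) a = (0, a).
      by rewrite linfunE // => b x y; congr (_, _); rewrite /= scaler0 addr0.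
    apply: (@poly_map_eq _ _ _ _ (fun xi => inj_V V + L xi)).
      move=> xi; apply/lfunP => v.
      rewrite add_lfunE comp_lfunE inrE inj_VE graphE.
      by congr (_, _); rewrite /= ?addr0 ?add0r.
    apply: (@poly_map_affine _ _ _ _ L (inj_V V) id) => // a x y.
    by rewrite /L comp_lfunDr comp_lfunZr.
  apply: (@poly_map_post _ _ _ _ _ (fun f : 'Hom(V, plus_line V) => pf_map M f)
    (fun f : 'Hom(pf_ob M V, pf_ob M (plus_line V)) => weight1 (f m))) => //.
  by move=> a x y; rewrite add_lfunE scale_lfunE weight1_linear.
have -> : graph (g *: xi) = (torus V g \o graph xi)%VF.
  by apply/lfunP => v; rewrite comp_lfunE torusE !graphE scale_lfunE.
apply/val_inj; rewrite /= -pf_mapMx val_weight1 // weight_proj_torus //.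
by rewrite val_weight1.
Qed.

Definition eta1_comp M V : 'Hom(pf_ob M V, pf_ob (F_ob (E_ob M)) V) :=
  linfun (fun m => linfun (fun xi : dual V => weight1 (pf_map M (graph xi) m)) :
    tensor (pf_ob (E_ob M) V) V).

Lemma eta1_compE M V m xi :
  (eta1_comp M V m : tensor (pf_ob (E_ob M) V) V) xi =
  weight1 (pf_map M (graph xi) m).
Proof.
rewrite /eta1_comp linfunE; first by rewrite linfunE //; exact: weight1_graph_linear.
move=> a x y; apply/lfunP => z.
rewrite add_lfunE scale_lfunE !linfunE; try exact: weight1_graph_linear.
by rewrite linearP weight1_linear.
Qed.

Definition eta1_pol M : nattrans (pf_fun M) (pf_fun (F_ob (E_ob M))).
Proof.
exists (fun V => eta1_comp M V : @hom (Vect k) (pf_fun M V) (pf_fun (F_ob (E_ob M)) V)).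
move=> V W f; apply/lfunP => m; rewrite /= !comp_lfunE.
apply/lfunP => xi; rewrite eta1_compE tensor_mapxE eta1_compE.
apply/val_inj; rewrite [RHS]E_mapE /= !val_weight1 // weight_proj_pf_map //.
congr (weight_proj _ _ _ _); rewrite !pf_mapMx; congr (pf_map M _ m).
apply/lfunP => v; rewrite !comp_lfunE dsum_mapE !graphE /= id_lfunE.
by rewrite comp_lfunE.
Defined.

Definition eta1 : nattrans Id (functor_comp F E).
Proof.
exists (fun M : Pol k => eta1_pol M : @hom (Pol k) (Id M) (functor_comp F E M)).
move=> M N a V; apply/lfunP => m; rewrite /= !comp_lfunE.
apply/lfunP => xi; rewrite eta1_compE tensor_map1rE eta1_compE.
apply/val_inj; rewrite /= [RHS]restrictE ?E_mor_in // !val_weight1 //.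
rewrite weight_proj_pol //; congr (weight_proj _ _ _ _).
by rewrite -[LHS]comp_lfunE -[RHS]comp_lfunE pol_nat.
Defined.

(** Evaluation at [last_form] kills [pure n (v, 0)] and returns [m] on [pure m (0, 1)], so the
    formula is stated without decomposing [x]. *)
Definition eps1_comp M V : 'Hom(pf_ob (E_ob (F_ob M)) V, pf_ob M V) :=
  linfun (fun x : subvs_of (weight_space (F_ob M) V 1) =>
    pf_map M (proj_V V)
      ((vsval x : tensor (pf_ob M (plus_line V)) (plus_line V)) (last_form V))).

Lemma eps1_compE M V (x : subvs_of (weight_space (F_ob M) V 1)) :
  eps1_comp M V x = pf_map M (proj_V V)
      ((vsval x : tensor (pf_ob M (plus_line V)) (plus_line V)) (last_form V)).
Proof.
rewrite linfunE // => a y z.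
by rewrite linearP add_lfunE scale_lfunE linearP.
Qed.

Definition eps1_pol M : nattrans (pf_fun (E_ob (F_ob M))) (pf_fun M).
Proof.
exists (fun V => eps1_comp M V : @hom (Vect k) (pf_fun (E_ob (F_ob M)) V) (pf_fun M V)).
move=> V W f; apply/lfunP => x; rewrite /= [LHS]comp_lfunE [RHS]comp_lfunE !eps1_compE.
rewrite E_mapE [X in pf_map _ _ X]tensor_mapxE !pf_mapMx.
congr (pf_map M _ _).
  by apply/lfunP => v; rewrite !comp_lfunE !proj_VE dsum_mapE.
congr (fun_of_lfun _ _); apply/lfunP => v.
by rewrite comp_lfunE !last_formE dsum_mapE id_lfunE.
Defined.

Definition eps1 : nattrans (functor_comp E F) Id.
Proof.
exists (fun M : Pol k => eps1_pol M : @hom (Pol k) (functor_comp E F M) (Id M)).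
move=> M N a V; apply/lfunP => x; rewrite /= [LHS]comp_lfunE [RHS]comp_lfunE !eps1_compE.
rewrite restrictE; last exact: (E_mor_in (F_mor a) x).
rewrite tensor_map1rE /=.
by rewrite -[LHS]comp_lfunE -[RHS]comp_lfunE -pol_nat.
Defined.

(** [torus V g] fixes the image of [inj_V] and scales [(0, 1)] by [g]; the weight comes from the
    second tensor factor. *)
Lemma eta2_weight M V (m : pf_ob M V) :
  (pure (pf_map M (inj_V V) m) ((0, 1) : plus_line V) : pf_ob (F_ob M) (plus_line V))
    \in weight_space (F_ob M) V 1.
Proof.
apply/weight_spaceP => g g0.
rewrite [LHS](tensor_map_pure (pf_map M (torus V g))) pf_mapMx.
have -> : (torus V g \o inj_V V)%VF = inj_V V.
  apply/lfunP => v; rewrite comp_lfunE torusE inj_VE.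
  by congr (_, _); rewrite /= scaler0.
have -> : torus V g (0, 1) = g *: ((0, 1) : plus_line V).
  by rewrite torusE; congr (_, _); rewrite /= scaler0.
by rewrite pureZr expr1.
Qed.

Definition eta2_comp M V : 'Hom(pf_ob M V, pf_ob (E_ob (F_ob M)) V) :=
  linfun (fun m : pf_ob M V => vsproj (weight_space (F_ob M) V 1)
    (pure (pf_map M (inj_V V) m) ((0, 1) : plus_line V) : pf_ob (F_ob M) (plus_line V))).

Lemma eta2_compE M V m : vsval (eta2_comp M V m : subvs_of (weight_space (F_ob M) V 1)) =
  pure (pf_map M (inj_V V) m) ((0, 1) : plus_line V).
Proof.
rewrite linfunE; first by rewrite vsprojK //; exact: eta2_weight.
by move=> a x y; rewrite linearP pure_linl linearP.
Qed.

Definition eta2_pol M : nattrans (pf_fun M) (pf_fun (E_ob (F_ob M))).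
Proof.
exists (fun V => eta2_comp M V : @hom (Vect k) (pf_fun M V) (pf_fun (E_ob (F_ob M)) V)).
move=> V W f; apply/lfunP => m; rewrite /= [LHS]comp_lfunE [RHS]comp_lfunE.
apply/val_inj; rewrite /= E_mapE !eta2_compE.
rewrite [RHS](tensor_map_pure (pf_map M _)) !pf_mapMx; congr (pure _ _).
  congr (pf_map M _ m); apply/lfunP => v.
  by rewrite !comp_lfunE dsum_mapE !inj_VE id_lfunE.
by rewrite dsum_mapE id_lfunE linear0.
Defined.

Definition eta2 : nattrans Id (functor_comp E F).
Proof.
exists (fun M : Pol k => eta2_pol M : @hom (Pol k) (Id M) (functor_comp E F M)).
move=> M N a V; apply/lfunP => m; rewrite /= [LHS]comp_lfunE [RHS]comp_lfunE.
apply/val_inj; rewrite /= restrictE; last exact: (E_mor_in (F_mor a)).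
rewrite !eta2_compE [RHS](tensor_map_pure (pol_comp a _)) id_lfunE; congr (pure _ _).
by rewrite -[LHS]comp_lfunE -[RHS]comp_lfunE pol_nat.
Defined.

(** [shear (g *: v)] is [shear v] after [torus V g], and [m] has weight 1, so the map is homogeneous
    of degree 1. It is polynomial since [shear v] is affine in [v]. *)
Lemma shear_pf_map_linear M V (m : pf_ob M (plus_line V)) : weight 1 m ->
  linear (fun v : V => pf_map M (shear v) m).
Proof.
move=> wm; apply: homogeneous_poly_map_linear => // [|g v g0].
  have [d hd] := pf_poly M (plus_line V) V; exists d.
  apply: (@poly_map_pre k d _ _ _
    (fun f : 'Hom(plus_line V, V) => pf_map M f m) (@shear k V)).
    pose L (v : V) : 'Hom(plus_line V, V) := shear v - proj_V V.
    have LE v x : L v x = (x.2 : k) *: v.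
      by rewrite add_lfunE opp_lfunE shearE proj_VE addrC addKr.
    apply: (@poly_map_eq _ _ _ _ (fun v => proj_V V + L v)).
      by move=> v; rewrite addrC subrK.
    apply: (@poly_map_affine _ _ _ _ L (proj_V V) id) => // a x y.
    apply/lfunP => z. rewrite [RHS]add_lfunE scale_lfunE !LE scalerDr !scalerA.
    by rewrite mulrC.
  apply: (@poly_map_post _ _ _ _ _ (fun f : 'Hom(plus_line V, V) => pf_map M f)
    (fun f : 'Hom(pf_ob M (plus_line V), pf_ob M V) => f m)) => //.
  by move=> a x y; rewrite add_lfunE scale_lfunE.
have -> : shear (g *: v) = (shear v \o torus V g)%VF.
  by apply/lfunP => x; rewrite comp_lfunE torusE !shearE /= scalerA mulrC.
by rewrite -pf_mapMx (wm g g0) linearZ.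
Qed.

Lemma eps2_ex M V : exists h : 'Hom(tensor (subvs_of (weight_space M V 1)) V, pf_ob M V),
  forall m v, h (pure m v) = pf_map M (shear v) (vsval m).
Proof.
have [||h [hP _]] := @tensor_univ k (subvs_of (weight_space M V 1)) V (pf_ob M V)
  (fun m v => pf_map M (shear v) (vsval m)); last by exists h.
- by move=> v a x y; rewrite !linearP.
- by move=> m; apply: shear_pf_map_linear; apply/weight_spaceP; exact: subvsP.
Qed.

(** The universal property of the tensor product gives a map with the prescribed values on pure
    tensors; a choice names it. *)
Definition eps2_comp M V : 'Hom(pf_ob (F_ob (E_ob M)) V, pf_ob M V) :=
  proj1_sig (constructive_indefinite_description _ (eps2_ex M V)).

Lemma eps2_compE M V (m : subvs_of (weight_space M V 1)) v :
  eps2_comp M V (pure m v) = pf_map M (shear v) (vsval m).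
Proof. exact: (proj2_sig (constructive_indefinite_description _ (eps2_ex M V))). Qed.

Definition eps2_pol M : nattrans (pf_fun (F_ob (E_ob M))) (pf_fun M).
Proof.
exists (fun V => eps2_comp M V : @hom (Vect k) (pf_fun (F_ob (E_ob M)) V) (pf_fun M V)).
move=> V W f; apply: tensor_ext => m v; rewrite /= [LHS]comp_lfunE [RHS]comp_lfunE.
rewrite tensor_map_pure !eps2_compE E_mapE [RHS]pf_mapMx pf_mapMx.
congr (pf_map M _ _); apply/lfunP => x.
by rewrite !comp_lfunE !shearE dsum_mapE /= id_lfunE linearD linearZ.
Defined.

Definition eps2 : nattrans (functor_comp F E) Id.
Proof.
exists (fun M : Pol k => eps2_pol M : @hom (Pol k) (functor_comp F E M) (Id M)).
move=> M N a V; apply: tensor_ext => m v; rewrite /= [LHS]comp_lfunE [RHS]comp_lfunE.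
rewrite tensor_map_pure !eps2_compE id_lfunE restrictE ?E_mor_in //.
by rewrite -[LHS]comp_lfunE -[RHS]comp_lfunE -pol_nat.
Defined.

(** Elements are read as bilinear maps on the two dual spaces, whose arguments are exchanged. The
    three spaces are independent, so that [flip_tensor_map] covers naturality of [tau] both in the
    vector space and in the polynomial functor. *)
Definition flip U V W : 'Hom(tensor (tensor U V) W, tensor (tensor U W) V) :=
  linfun (fun t : tensor (tensor U V) W => linfun (fun xi : dual V =>
    linfun (fun zeta : dual W => (t zeta : tensor U V) xi) : tensor U W) :
    tensor (tensor U W) V).

Lemma flipE U V W (t : tensor (tensor U V) W) xi zeta :
  (flip U V W t xi : tensor U W) zeta = (t zeta : tensor U V) xi.
Proof.
have l1 (s : tensor (tensor U V) W) x :
    linear (fun zeta : dual W => (s zeta : tensor U V) x).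
  by move=> a y z; rewrite linearP add_lfunE scale_lfunE.
have l2 (s : tensor (tensor U V) W) : linear (fun xi : dual V =>
    linfun (fun zeta : dual W => (s zeta : tensor U V) xi) : tensor U W).
  move=> a y z; apply/lfunP => x; rewrite add_lfunE scale_lfunE !linfunE //.
  by rewrite linearP.
rewrite linfunE; first by rewrite (linfunE (l2 t)) (linfunE (l1 t xi)).
move=> a y z; apply/lfunP => x; rewrite [RHS]add_lfunE scale_lfunE.
rewrite !(linfunE (l2 _)); apply/lfunP => w.
by rewrite [RHS]add_lfunE scale_lfunE !(linfunE (l1 _ x)) !add_lfunE !scale_lfunE.
Qed.

Lemma flip_tensor_map U U' V V' W W' (f : 'Hom(U, U')) (g : 'Hom(V, V'))
    (h : 'Hom(W, W')) (t : tensor (tensor U V) W) :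
  flip U' V' W' (tensor_map (tensor_map f g) h t) =
  tensor_map (tensor_map f h) g (flip U V W t).
Proof.
apply/lfunP => xi; apply/lfunP => zeta.
by rewrite flipE !tensor_mapxE flipE.
Qed.

Lemma flip_pure U V W (u : U) (v : V) (w : W) :
  flip U V W (pure (pure u v) w) = pure (pure u w) v.
Proof.
apply/lfunP => xi; apply/lfunP => zeta.
by rewrite flipE !pureE !scale_lfunE !pureE !scalerA mulrC.
Qed.

Definition tau_pol M : nattrans (pf_fun (F_ob (F_ob M))) (pf_fun (F_ob (F_ob M))).
Proof.
exists (fun V => flip (pf_ob M V) V V :
  @hom (Vect k) (pf_fun (F_ob (F_ob M)) V) (pf_fun (F_ob (F_ob M)) V)).
move=> V W f; apply/lfunP => t; rewrite /= [LHS]comp_lfunE [RHS]comp_lfunE.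
exact: flip_tensor_map.
Defined.

Definition tau : nattrans (functor_comp F F) (functor_comp F F).
Proof.
exists (fun M : Pol k => tau_pol M : @hom (Pol k) (functor_comp F F M) (functor_comp F F M)).
move=> M N a V; apply/lfunP => t; rewrite /= [LHS]comp_lfunE [RHS]comp_lfunE.
exact: flip_tensor_map.
Defined.
End Transformations.

(** * The relations *)

Section Relations.
Variable k : fieldType.
Hypothesis k_inf : infinite_field k.
Implicit Types (M N : polyfun k) (U V W : vectType k).

Local Notation eta1_pol := (eta1_pol k_inf).
Local Notation eps2_comp := (eps2_comp k_inf).
Local Notation eps2_pol := (eps2_pol k_inf).

Lemma E_morE M N (a : nattrans (pf_fun M) (pf_fun N)) V (x : subvs_of (weight_space M V 1)) :
  vsval (pol_comp (E_mor a) V x : subvs_of (weight_space N V 1)) =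
  pol_comp a (plus_line V) (vsval x).
Proof. by apply: restrictE; exact: E_mor_in. Qed.

Lemma F_morE M N (a : nattrans (pf_fun M) (pf_fun N)) V (t : tensor (pf_ob M V) V) xi :
  (pol_comp (F_mor a) V t : tensor (pf_ob N V) V) xi = pol_comp a V (t xi).
Proof. exact: tensor_map1rE. Qed.

Lemma F_mor_pure M N (a : nattrans (pf_fun M) (pf_fun N)) V (m : pf_ob M V) v :
  pol_comp (F_mor a) V (pure m v) = pure (pol_comp a V m) v :> tensor (pf_ob N V) V.
Proof. by rewrite [LHS]tensor_map_pure id_lfunE. Qed.

Lemma F_mapE M V W (f : 'Hom(V, W)) (t : tensor (pf_ob M V) V) xi :
  (pf_map (F_ob M) f t : tensor (pf_ob M W) W) xi = pf_map M f (t (xi \o f)%VF).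
Proof. exact: tensor_mapxE. Qed.

Lemma F_map_pure M V W (f : 'Hom(V, W)) (m : pf_ob M V) v :
  pf_map (F_ob M) f (pure m v) = pure (pf_map M f m) (f v) :> tensor (pf_ob M W) W.
Proof. exact: tensor_map_pure. Qed.

Lemma weight_proj_vsval M V (x : subvs_of (weight_space M V 1)) :
  weight_proj M V 1 (vsval x) = vsval x.
Proof. by apply: weight_proj_id => //; apply/weight_spaceP; exact: subvsP. Qed.

Lemma pf_map_idE M V (f : 'End(V)) m : f =1 id -> pf_map M f m = m.
Proof.
move=> e; have -> : f = \1%VF by apply/lfunP => v; rewrite id_lfunE e.
by rewrite pf_map1 id_lfunE.
Qed.

(** The composite is induced by [(v, a) |-> ((v, a), a) |-> (v, a)], and the weight projection fixes
    [x]. *)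
Lemma zigzag_eta1_eps1_E M V (x : subvs_of (weight_space M V 1)) :
  eps1_comp (E_ob M) V (pol_comp (E_mor (eta1_pol M)) V x) = x.
Proof.
rewrite eps1_compE E_morE eta1_compE //.
apply/val_inj; rewrite /= [LHS]E_mapE val_weight1 // weight_proj_pf_map // pf_mapMx.
rewrite pf_map_idE ?weight_proj_vsval //.
move=> v; rewrite comp_lfunE dsum_mapE proj_VE id_lfunE graphE last_formE /=.
by case: v.
Qed.

(* The formula for eps1 makes sense on all of M(V (+) k) (x) (V (+) k), where it
   is homogeneous of degree 1, so the projection to weight 1 may be dropped. *)
Lemma eps1_weight_proj M V (y : tensor (pf_ob M (plus_line V)) (plus_line V)) :
  pf_map M (proj_V V)
    ((weight_proj (F_ob M) V 1 y : tensor (pf_ob M (plus_line V)) (plus_line V))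
       (last_form V)) =
  pf_map M (proj_V V) (y (last_form V)).
Proof.
pose f (y : tensor (pf_ob M (plus_line V)) (plus_line V)) :=
  pf_map M (proj_V V) (y (last_form V)).
have lf : linear f by move=> a u v; rewrite /f add_lfunE scale_lfunE linearP.
have fE : linfun f =1 f := linfunE lf.
have := @homogeneous_weight_proj k k_inf (F_ob M) V _ 1 (linfun f) y.
rewrite !fE; apply => g z g0; rewrite !fE /f.
rewrite [X in pf_map _ _ X]tensor_mapxE pf_mapMx.
have -> : (proj_V V \o torus V g)%VF = proj_V V.
  by apply/lfunP => v; rewrite comp_lfunE !proj_VE torusE.
have -> : (last_form V \o torus V g)%VF = g *: last_form V.
  by apply/lfunP => v; rewrite comp_lfunE scale_lfunE !last_formE torusE.
by rewrite !linearZ.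
Qed.

(** Once the weight projection is dropped, the claim follows because [graph xi] is a section of
    [proj_V] and pulls [last_form] back to [xi]. *)
Lemma zigzag_eta1_eps1_F M V (x : tensor (pf_ob M V) V) :
  pol_comp (F_mor (eps1_pol M)) V (eta1_comp (F_ob M) V x) = x.
Proof.
apply/lfunP => xi; rewrite F_morE eta1_compE // [LHS]eps1_compE val_weight1 //.
rewrite eps1_weight_proj F_mapE pf_mapMx pf_map_idE; last first.
  by move=> v; rewrite comp_lfunE graphE proj_VE.
congr (fun_of_lfun _ _); apply/lfunP => v.
by rewrite comp_lfunE graphE last_formE.
Qed.

Lemma shear_inj V (v : V) w : shear v (inj_V V w) = w.
Proof. by rewrite shearE inj_VE /= scale0r addr0. Qed.

Lemma shear01 V (v : V) : shear v ((0, 1) : plus_line V) = v.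
Proof. by rewrite shearE /= scale1r add0r. Qed.

Lemma zigzag_eta2_eps2_F M V (x : tensor (pf_ob M V) V) :
  eps2_comp (F_ob M) V (pol_comp (F_mor (eta2_pol M)) V x) = x.
Proof.
rewrite -[LHS]comp_lfunE -[RHS]id_lfunE; congr (fun_of_lfun _ x).
apply: tensor_ext => m v; rewrite [LHS]comp_lfunE id_lfunE F_mor_pure.
rewrite eps2_compE eta2_compE F_map_pure pf_mapMx pf_map_idE ?shear01 // => w.
by rewrite comp_lfunE shear_inj.
Qed.

(** [(w, a)] goes to [((w, 0), a)] and then to [(w, 0) + a (0, 1)]. The zigzag on E and the
    computation of [triangle_comp] both end in this map. *)
Lemma shear_inj_last V w :
  (shear ((0, 1) : plus_line V) \o dsum_map (inj_V V) \1)%VF w = w.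
Proof.
rewrite comp_lfunE dsum_mapE inj_VE id_lfunE shearE /=.
by case: w => w a; congr (_, _); rewrite /= ?scaler0 ?addr0 ?add0r // /GRing.scale /= mulr1.
Qed.

Lemma zigzag_eta2_eps2_E M V (x : subvs_of (weight_space M V 1)) :
  pol_comp (E_mor (eps2_pol M)) V (eta2_comp (E_ob M) V x) = x.
Proof.
apply/val_inj; rewrite [LHS]E_morE eta2_compE [LHS]eps2_compE.
by rewrite [X in pf_map _ _ X]E_mapE pf_mapMx pf_map_idE // => w; rewrite shear_inj_last.
Qed.

Lemma eps1_eta2 M V x : eps1_comp M V (eta2_comp M V x) = x.
Proof.
rewrite eps1_compE eta2_compE pureE last_formE scale1r pf_mapMx pf_map_idE // => v.
by rewrite comp_lfunE inj_VE proj_VE.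
Qed.

Lemma flipK U V W (t : tensor (tensor U V) W) : flip _ _ _ (flip _ _ _ t) = t.
Proof. by apply/lfunP => xi; apply/lfunP => zeta; rewrite !flipE. Qed.

Lemma tau_polE M V (t : tensor (tensor (pf_ob M V) V) V) xi zeta :
  ((pol_comp (tau_pol M) V t : tensor (tensor (pf_ob M V) V) V) xi :
     tensor (pf_ob M V) V) zeta =
  (t zeta : tensor (pf_ob M V) V) xi.
Proof. exact: flipE. Qed.

(** [s] exchanges the first two dual arguments and [s'] the last two; both sides reverse the order
    of all three. *)
Lemma flip_braid M V (t : tensor (tensor (tensor (pf_ob M V) V) V) V) :
  let s := pol_comp (tau_pol (F_ob M)) V in
  let s' := pol_comp (F_mor (tau_pol M)) V in
  s' (s (s' t)) = s (s' (s t)).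
Proof.
move=> s s'; apply/lfunP => xi; apply/lfunP => zeta; apply/lfunP => w.
by rewrite /s /s' !(F_morE (tau_pol M), tau_polE, @tau_polE (F_ob M)).
Qed.

(** After [tau], [last_form] is evaluated on the factor coming from [V] instead of on [(0, 1)], and
    it vanishes on the image of [inj_V]. *)
Lemma left_curl M V (x : tensor (pf_ob M V) V) :
  eps1_comp (F_ob M) V (pol_comp (E_mor (tau_pol M)) V (eta2_comp (F_ob M) V x)) = 0.
Proof.
rewrite eps1_compE E_morE eta2_compE.
apply/lfunP => xi; rewrite F_mapE flipE pureE scale_lfunE F_mapE zero_lfunE.
have -> : (last_form V \o inj_V V)%VF = 0.
  by apply/lfunP => v; rewrite comp_lfunE zero_lfunE last_formE inj_VE.
by rewrite !linear0.
Qed.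

(** The component of [ktriangle] at [M] and [V], with unitors and associators omitted; [square_comp]
    is the same for [ksquare]. *)
Definition triangle_comp M V (t : tensor (subvs_of (weight_space M V 1)) V) :
    subvs_of (weight_space (F_ob M) V 1) :=
  pol_comp (E_mor (F_mor (eps2_pol M))) V
    (pol_comp (E_mor (tau_pol (E_ob M))) V (eta2_comp (F_ob (E_ob M)) V t)).

Definition square_comp M V (x : subvs_of (weight_space (F_ob M) V 1)) :
    tensor (subvs_of (weight_space M V 1)) V :=
  eps1_comp (F_ob (E_ob M)) V
    (pol_comp (E_mor (tau_pol (E_ob M))) V
       (pol_comp (E_mor (F_mor (eta1_pol M))) V x)).

(** [tau] moves [xi] onto the factor coming from [t], where it is restricted along [inj_V]; then
    [eps2] undoes [eta2] as in the zigzag on E. *)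
Lemma triangle_compE M V t xi :
  (vsval (@triangle_comp M V t) : tensor (pf_ob M (plus_line V)) (plus_line V)) xi =
  vsval (t (xi \o inj_V V)%VF).
Proof.
rewrite E_morE F_morE E_morE eta2_compE [X in pol_comp _ _ X](_ : _ =
  pure (pf_map (E_ob M) (inj_V V) (t (xi \o inj_V V)%VF)) ((0, 1) : plus_line V)).
  rewrite [LHS]eps2_compE [X in pf_map _ _ X]E_mapE pf_mapMx pf_map_idE // => w.
  exact: shear_inj_last.
by apply/lfunP => zeta; rewrite tau_polE [in LHS]pureE scale_lfunE pureE [in LHS]F_mapE.
Qed.

(** [tau] exchanges the pullback of [zeta] with [last_form]. Hence [eta1] is evaluated at
    [last_form], whose graph followed by the projection in the [V] part is the identity. *)
Lemma square_compE M V x zeta :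
  @square_comp M V x zeta =
  weight1 ((vsval x : tensor (pf_ob M (plus_line V)) (plus_line V)) (zeta \o proj_V V)%VF).
Proof.
rewrite /square_comp eps1_compE (@F_mapE (E_ob M)) E_morE (@tau_polE (E_ob M)).
rewrite E_morE (F_morE (eta1_pol M)) eta1_compE //.
apply/val_inj; rewrite /= [LHS]E_mapE !val_weight1 // weight_proj_pf_map // pf_mapMx.
rewrite pf_map_idE // => v; rewrite comp_lfunE dsum_mapE proj_VE id_lfunE graphE last_formE /=.
by case: v.
Qed.

Lemma proj_inj V : (proj_V V \o inj_V V)%VF = \1%VF.
Proof. by apply/lfunP => v; rewrite comp_lfunE inj_VE proj_VE id_lfunE. Qed.

Lemma square_triangle M V t : square_comp (@triangle_comp M V t) = t.
Proof.
apply/lfunP => zeta; rewrite square_compE triangle_compE.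
rewrite -comp_lfunA proj_inj comp_lfun1r.
by apply/val_inj; rewrite /= val_weight1 // weight_proj_vsval.
Qed.

(** Split [xi] into its restriction to [V], pulled back along [proj_V], and a multiple of
    [last_form]. The first part gives the composite of square and triangle, the second gives [eta2]
    after [eps1]. As [x] has weight 1, its values on the two parts have weights 1 and 0, which makes
    the weight projection and [torus V 0] act trivially. *)
Lemma triangle_square M V x :
  triangle_comp (@square_comp M V x) =
  x + (-1) *: (eta2_comp M V (eps1_comp M V x) : subvs_of (weight_space (F_ob M) V 1)).
Proof.
apply/val_inj; rewrite /=; apply/lfunP => xi.
rewrite triangle_compE square_compE val_weight1 // add_lfunE scale_lfunE scaleN1r.
rewrite eta2_compE pureE eps1_compE pf_mapMx.
set X := vsval x : tensor (pf_ob M (plus_line V)) (plus_line V).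
(* The weight 1 condition on [x], written for a linear map on the dual space. *)
have wX : forall g, g != 0 -> forall xi,
    pf_map M (torus V g) (X (xi \o torus V g)%VF) = g *: X xi.
  move=> g g0 zeta; rewrite -[LHS](F_mapE (M := M)).
  have /weight_spaceP/(_ g g0) -> := subvsP x.
  by rewrite expr1 scale_lfunE.
have proj_torus g : (proj_V V \o torus V g = proj_V V)%VF.
  by apply/lfunP => v; rewrite comp_lfunE torusE !proj_VE.
have decomp :
    xi = (xi \o (inj_V V \o proj_V V) + (xi ((0, 1) : plus_line V) : k) *: last_form V)%VF.
  apply/lfunP => -[v a]; rewrite add_lfunE scale_lfunE !comp_lfunE.
  rewrite proj_VE inj_VE last_formE /=.
  have -> : (v, a) = ((v, 0) : plus_line V) + (a : k) *: ((0, 1) : plus_line V).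
    by congr (_, _); rewrite /= ?scaler0 ?addr0 ?add0r // /GRing.scale /= mulr1.
  by rewrite linearD linearZ /= [X in _ + X]mulrC.
have w0 : weight 0 (X (last_form V)).
  (* [last_form] after [torus V g] is [g] times [last_form], so [wX] can be divided by [g]. *)
  move=> g g0; rewrite expr0 scale1r; apply: (scalerI g0).
  rewrite -linearZ -[RHS]wX //; congr (pf_map M _ _); rewrite -linearZ.
  congr (fun_of_lfun _ _).
  by apply/lfunP => v; rewrite comp_lfunE scale_lfunE !last_formE torusE.
have -> : (inj_V V \o proj_V V)%VF = torus V 0.
  by apply/lfunP => v; rewrite comp_lfunE torusE inj_VE proj_VE scale0r.
rewrite torus0_weight0 // weight_proj_id // => [|g g0].
  by rewrite {2}decomp linearD linearZ /= addrK comp_lfunA.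
by rewrite expr1 -[RHS]wX // -(comp_lfunA (xi \o inj_V V)) proj_torus.
Qed.

(** The component of [kmate1] at [M] and [V] without structure isomorphisms, with nested units and
    counits applied one after the other. *)
Definition mate1_comp M V (x : subvs_of (weight_space (E_ob M) V 1)) :
    subvs_of (weight_space (E_ob M) V 1) :=
  eps1_comp (E_ob (E_ob M)) V
    (pol_comp (E_mor (eps1_pol (F_ob (E_ob (E_ob M))))) V
      (pol_comp (E_mor (E_mor (tau_pol (E_ob (E_ob M))))) V
        (pol_comp (E_mor (E_mor (F_mor (eta1_pol (E_ob M))))) V
          (pol_comp (E_mor (E_mor (eta1_pol M))) V x)))).

Definition mate2_comp M V (x : subvs_of (weight_space (E_ob M) V 1)) :
    subvs_of (weight_space (E_ob M) V 1) :=
  pol_comp (E_mor (E_mor (eps2_pol M))) V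
    (pol_comp (E_mor (E_mor (F_mor (eps2_pol (E_ob M))))) V
      (pol_comp (E_mor (E_mor (tau_pol (E_ob (E_ob M))))) V
        (pol_comp (E_mor (eta2_pol (F_ob (E_ob (E_ob M))))) V
           (eta2_comp (E_ob (E_ob M)) V x)))).

Definition swap_lines V : 'End(plus_line (plus_line V)) :=
  linfun (fun x : plus_line (plus_line V) =>
    ((x.1.1, x.2), x.1.2) : plus_line (plus_line V)).

Lemma swap_linesE V x : swap_lines V x = ((x.1.1, x.2), x.1.2).
Proof. by rewrite linfunE. Qed.

Definition vsval2 M V (x : subvs_of (weight_space (E_ob M) V 1)) :
    pf_ob M (plus_line (plus_line V)) :=
  vsval (vsval x : subvs_of (weight_space M (plus_line V) 1)).

Lemma E_mor2E M N (a : nattrans (pf_fun M) (pf_fun N)) V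
    (x : subvs_of (weight_space (E_ob M) V 1)) :
  vsval2 (pol_comp (E_mor (E_mor a)) V x) =
  pol_comp a (plus_line (plus_line V)) (vsval2 x).
Proof. by rewrite /vsval2 !E_morE. Qed.

Lemma E_map2E M V W (f : 'Hom(V, W)) (x : subvs_of (weight_space (E_ob M) V 1)) :
  vsval2 (pf_map (E_ob (E_ob M)) f x) =
  pf_map M (dsum_map (dsum_map f \1%VF) \1%VF :
    'Hom(plus_line (plus_line V), plus_line (plus_line W))) (vsval2 x).
Proof. by rewrite /vsval2 [X in vsval X]E_mapE [LHS]E_mapE. Qed.

(** The two [eta2] insert the basis vectors of the two lines, [tau] exchanges them, and each [eps2]
    sends one line of [x] to one of them. The inclusions and shears compose to the swap. *)
Lemma vsval2_mate2 M V x :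
  vsval2 (@mate2_comp M V x) = pf_map M (swap_lines V) (vsval2 x).
Proof.
rewrite /mate2_comp !E_mor2E.
set y := vsval2 _.
have -> : y = pure (pure (pf_map (E_ob (E_ob M)) (inj_V (plus_line V) \o inj_V V)%VF x)
    (inj_V (plus_line V) (0, 1))) ((0, 1) : plus_line (plus_line V)).
  rewrite /y /vsval2 E_morE eta2_compE [LHS]eta2_compE F_map_pure pf_mapMx.
  by [].
rewrite [pol_comp (tau_pol _) _ _]flip_pure F_mor_pure [LHS]eps2_compE.
rewrite [pol_comp (eps2_pol _) _ _]eps2_compE [X in pf_map _ _ X]E_mapE.
rewrite [X in pf_map _ _ (pf_map _ _ X)]E_map2E !pf_mapMx; congr (pf_map M _ _).
apply/lfunP => -[[v a] b]; rewrite !comp_lfunE swap_linesE !dsum_mapE !shearE /=.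
rewrite !comp_lfunE !id_lfunE !inj_VE.
by congr (_, _, _); rewrite /= ?scaler0 ?addr0 ?add0r // /GRing.scale /= mulr1.
Qed.

Lemma eps1_eps1E N V (y : subvs_of (weight_space (E_ob (F_ob (F_ob N))) V 1)) :
  eps1_comp N V (pol_comp (E_mor (eps1_pol (F_ob N))) V y) =
  pf_map N (proj_V V \o proj_V (plus_line V))%VF
    (((vsval2 y :
       tensor (tensor (pf_ob N (plus_line (plus_line V))) (plus_line (plus_line V)))
         (plus_line (plus_line V))) (last_form (plus_line V)) :
       tensor (pf_ob N (plus_line (plus_line V))) (plus_line (plus_line V)))
     (last_form V \o proj_V (plus_line V))%VF).
Proof.
rewrite eps1_compE E_morE.
rewrite [pol_comp (eps1_pol (F_ob N)) _ _](@eps1_compE k (F_ob N) (plus_line V) (vsval y)).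
by rewrite F_mapE pf_mapMx.
Qed.

(** The evaluations of the two counits become graphs under [eta1]. Up to weight projections, the
    graphs and projections also compose to the swap of lines. *)
Lemma mate1_mate2 M V x : @mate1_comp M V x = mate2_comp x.
Proof.
rewrite /mate1_comp eps1_eps1E !E_mor2E (@tau_polE (E_ob (E_ob M))).
rewrite (F_morE (eta1_pol (E_ob M))) [pol_comp (eta1_pol (E_ob M)) _ _ _]eta1_compE //.
rewrite [pol_comp (eta1_pol M) _ _ _]eta1_compE //.
apply/val_inj; rewrite /= [LHS]E_mapE val_weight1 // weight_proj_pf_map // pf_mapMx.
(* The outer weight projection acts as the identity once [y] is recognized as a value of
   [mate2_comp], which has weight 1. *)
set y := pf_map _ _ _; have -> : y = vsval (mate2_comp x);
  last exact: (@weight_proj_vsval (E_ob M) V (mate2_comp x)).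
apply/val_inj; rewrite /= [LHS]E_mapE val_weight1 // weight_proj_pf_map // pf_mapMx.
(* With the right side written as its own weight projection, only the two maps under [pf_map] remain
   to be compared. *)
rewrite -[RHS]weight_proj_vsval -[X in _ = weight_proj _ _ _ X]/(vsval2 (mate2_comp x)).
rewrite vsval2_mate2; congr (weight_proj _ _ _ (pf_map M _ _)).
apply/lfunP => -[[v a] b]; rewrite !comp_lfunE dsum_mapE graphE !comp_lfunE swap_linesE.
by rewrite dsum_mapE graphE !comp_lfunE !id_lfunE !proj_VE !last_formE.
Qed.
End Relations.

(** * The functor on objects and morphisms *)

Section Omega.
Variable k : fieldType.
Implicit Types (U V W : vectType k).

(** * Direct sums and the zero object in P *)

Section PolSum.
Variables M N : polyfun k.

Definition pf_sum_fun : functor (Vect k) (Vect k).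
Proof.
refine (@Functor (Vect k) (Vect k) (fun V => (pf_ob M V * pf_ob N V)%type : vectType k)
  (fun V W f => dsum_map (pf_map M f) (pf_map N f)) _ _ _).
- by move=> V W f g ->.
- by move=> V; rewrite /= !pf_map1 dsum_map1.
- by move=> U V W g f; rewrite /= !pf_mapM dsum_mapM.
Defined.

Lemma dsum_map_poly_le d e V W (A A' B B' : vectType k) (f : 'Hom(V, W) -> 'Hom(A, A'))
    (g : 'Hom(V, W) -> 'Hom(B, B')) :
  poly_map_le d f -> poly_map_le e g ->
  @poly_map_le k (maxn d e) _ _ (fun x => dsum_map (f x) (g x)).
Proof.
move=> fd ge.
apply: (@poly_map_eq _ _ _ _ (fun x => dsum_map (f x) 0 + dsum_map 0 (g x))).
  move=> x; apply/lfunP => y; rewrite add_lfunE !dsum_mapE !zero_lfunE.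
  by congr (_, _); rewrite /= ?addr0 ?add0r.
apply: poly_map_add.
  apply: poly_map_mono (leq_maxl _ _) _.
  apply: (@poly_map_post _ _ _ _ _ f (fun h => dsum_map h 0)) fd => a x y.
  apply/lfunP => z; rewrite add_lfunE scale_lfunE !dsum_mapE add_lfunE scale_lfunE.
  by rewrite !zero_lfunE; congr (_, _); rewrite /= scaler0 addr0.
apply: poly_map_mono (leq_maxr _ _) _.
apply: (@poly_map_post _ _ _ _ _ g (fun h => dsum_map 0 h)) ge => a x y.
apply/lfunP => z; rewrite add_lfunE scale_lfunE !dsum_mapE add_lfunE scale_lfunE.
by rewrite !zero_lfunE; congr (_, _); rewrite /= scaler0 addr0.
Qed.

Definition pf_sum : polyfun k.
Proof.
exists pf_sum_fun.
- move=> V W; have [d hd] := pf_poly M V W; have [e he] := pf_poly N V W.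
  by exists (maxn d e); exact: dsum_map_poly_le.
- have [d hd] := pf_bounded M; have [e he] := pf_bounded N.
  by exists (maxn d e) => V; exact: dsum_map_poly_le.
Defined.

Definition dsum_inl V W : 'Hom(V, (V * W)%type) := linfun (fun x => (x, 0)).
Definition dsum_inr V W : 'Hom(W, (V * W)%type) := linfun (fun x => (0, x)).
Definition dsum_prl V W : 'Hom((V * W)%type, V) := linfun (fun x : V * W => x.1).
Definition dsum_prr V W : 'Hom((V * W)%type, W) := linfun (fun x : V * W => x.2).

Lemma dsum_inlE V W x : dsum_inl V W x = (x, 0).
Proof. by rewrite linfunE // => a y z; congr (_, _); rewrite /= scaler0 addr0. Qed.

Lemma dsum_inrE V W x : dsum_inr V W x = (0, x).
Proof. by rewrite linfunE // => a y z; congr (_, _); rewrite /= scaler0 addr0. Qed.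

Lemma dsum_prlE V W x : dsum_prl V W x = x.1.
Proof. by rewrite linfunE. Qed.

Lemma dsum_prrE V W x : dsum_prr V W x = x.2.
Proof. by rewrite linfunE. Qed.

Definition pol_inl : nattrans (pf_fun M) (pf_fun pf_sum).
Proof.
exists (fun V => dsum_inl (pf_ob M V) (pf_ob N V) :
  @hom (Vect k) (pf_fun M V) (pf_fun pf_sum V)).
move=> V W f; apply/lfunP => x; rewrite /= [LHS]comp_lfunE [RHS]comp_lfunE.
by rewrite !dsum_inlE dsum_mapE /= linear0.
Defined.

Definition pol_inr : nattrans (pf_fun N) (pf_fun pf_sum).
Proof.
exists (fun V => dsum_inr (pf_ob M V) (pf_ob N V) :
  @hom (Vect k) (pf_fun N V) (pf_fun pf_sum V)).
move=> V W f; apply/lfunP => x; rewrite /= [LHS]comp_lfunE [RHS]comp_lfunE.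
by rewrite !dsum_inrE dsum_mapE /= linear0.
Defined.

Definition pol_prl : nattrans (pf_fun pf_sum) (pf_fun M).
Proof.
exists (fun V => dsum_prl (pf_ob M V) (pf_ob N V) :
  @hom (Vect k) (pf_fun pf_sum V) (pf_fun M V)).
move=> V W f; apply/lfunP => x; rewrite /= [LHS]comp_lfunE [RHS]comp_lfunE.
by rewrite !dsum_prlE dsum_mapE.
Defined.

Definition pol_prr : nattrans (pf_fun pf_sum) (pf_fun N).
Proof.
exists (fun V => dsum_prr (pf_ob M V) (pf_ob N V) :
  @hom (Vect k) (pf_fun pf_sum V) (pf_fun N V)).
move=> V W f; apply/lfunP => x; rewrite /= [LHS]comp_lfunE [RHS]comp_lfunE.
by rewrite !dsum_prrE dsum_mapE.
Defined.

Definition pol_biproduct : biproduct (M : Pol k) (N : Pol k).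
Proof.
refine (@Biproduct k (Pol k) M N pf_sum pol_inl pol_inr pol_prl pol_prr _ _ _ _ _);
  move=> V; apply/lfunP => x /=; rewrite ?id_lfunE ?zero_lfunE ?[LHS]comp_lfunE.
- by rewrite dsum_inlE dsum_prlE.
- by rewrite dsum_inrE dsum_prrE.
- by rewrite dsum_inrE dsum_prlE.
- by rewrite dsum_inlE dsum_prrE.
rewrite [LHS]add_lfunE !comp_lfunE dsum_inlE dsum_inrE dsum_prlE dsum_prrE.
by case: x => x1 x2; congr (_, _); rewrite /= ?addr0 ?add0r.
Defined.
End PolSum.

Definition pf_zero : polyfun k.
Proof.
exists (const_functor (Vect k) ('rV[k]_0 : Vect k)).
- by move=> V W; exists 0%N; exact: poly_map_const.
- by exists 0%N => V; exact: poly_map_const.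
Defined.

Lemma pf_zero_idm : idm (pf_zero : Pol k) =h hzero _ _.
Proof.
move=> V /=; apply/lfunP => x; rewrite zero_lfunE id_lfunE.
by apply/rowP => -[].
Qed.

Hypothesis k_inf : infinite_field k.
Local Notation F := (F_functor k).
Local Notation E := (E_functor k).

(** The values are bare functors. Exactness and adjoints follow by an induction in which the adjoint
    of a value is again a value. *)
Fixpoint Omega_obj (A : kob) : functor (Pol k) (Pol k) :=
  match A with
  | Qp => F
  | Qm => E
  | K1 => functor_id (Pol k)
  | Ktens A B => functor_comp (Omega_obj A) (Omega_obj B)
  | K0 => const_functor (Pol k) (pf_zero : Pol k)
  | Ksum A B => @sum_functor k (Pol k) (Pol k) pol_biproduct (Omega_obj A) (Omega_obj B)
  end.

Fixpoint Omega_mor A B (f : khom k A B) : nattrans (Omega_obj A) (Omega_obj B) :=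
  match f in khom _ A B return nattrans (Omega_obj A) (Omega_obj B) with
  | kid A => nat_id _
  | kcomp _ _ _ g f => nat_comp (Omega_mor g) (Omega_mor f)
  | kzero A B => @nat_zero k (Pol k) (Pol k) _ _
  | kadd _ _ f g => @nat_add k (Pol k) (Pol k) _ _ (Omega_mor f) (Omega_mor g)
  | kscale _ _ c f => @nat_scale k (Pol k) (Pol k) _ _ c (Omega_mor f)
  | ktens _ _ _ _ f g => nat_hcomp (Omega_mor f) (Omega_mor g)
  | kassoc A B C => nat_assoc (Omega_obj A) (Omega_obj B) (Omega_obj C)
  | kassoci A B C => nat_associ (Omega_obj A) (Omega_obj B) (Omega_obj C)
  | klunit A => nat_lunit (Omega_obj A)
  | kluniti A => nat_luniti (Omega_obj A)
  | krunit A => nat_runit (Omega_obj A)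
  | kruniti A => nat_runiti (Omega_obj A)
  | kinl A B => @sum_inl k (Pol k) (Pol k) pol_biproduct (Omega_obj A) (Omega_obj B)
  | kinr A B => @sum_inr k (Pol k) (Pol k) pol_biproduct (Omega_obj A) (Omega_obj B)
  | kprl A B => @sum_prl k (Pol k) (Pol k) pol_biproduct (Omega_obj A) (Omega_obj B)
  | kprr A B => @sum_prr k (Pol k) (Pol k) pol_biproduct (Omega_obj A) (Omega_obj B)
  | keta1 => eta1 k_inf
  | keps1 => eps1 k
  | keta2 => eta2 k
  | keps2 => eps2 k_inf
  | ktau => tau k
  end.

Definition fmap_at A (M N : polyfun k) (a : @hom (Pol k) M N) V :
    'Hom(pf_ob (Omega_obj A M : polyfun k) V, pf_ob (Omega_obj A N : polyfun k) V) :=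
  pol_comp (fmap (Omega_obj A) a) V.

Implicit Types M N : polyfun k.

Lemma pol_id M V x : pol_comp (@idm (Pol k) M) V x = x.
Proof. exact: id_lfunE. Qed.

Lemma pol_compE M N R (b : @hom (Pol k) N R) (a : @hom (Pol k) M N) V x :
  pol_comp (b <o> a) V x = pol_comp b V (pol_comp a V x).
Proof. exact: comp_lfunE. Qed.

Lemma pol_add M N (b a : @hom (Pol k) M N) V x :
  pol_comp (b +h a) V x = pol_comp b V x + pol_comp a V x.
Proof. exact: add_lfunE. Qed.

Lemma pol_scale M N c (a : @hom (Pol k) M N) V x :
  pol_comp (c *h a) V x = c *: pol_comp a V x.
Proof. exact: scale_lfunE. Qed.

Lemma pol_zero M N V x : pol_comp (@hzero k (Pol k) M N) V x = 0.
Proof. exact: zero_lfunE. Qed.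

Lemma fmap_at1 A M V x : fmap_at A (@idm (Pol k) M) V x = x.
Proof.
have := fmap1 (Omega_obj A) M V => /lfunP /(_ x) e.
exact: (etrans e (@pol_id (Omega_obj A M) V x)).
Qed.

Lemma fmap_atM A M N R (b : @hom (Pol k) N R) (a : @hom (Pol k) M N) V x :
  fmap_at A (b <o> a) V x = fmap_at A b V (fmap_at A a V x).
Proof.
have := fmapM (Omega_obj A) b a V => /lfunP /(_ x) e.
exact: (etrans e (pol_compE (fmap (Omega_obj A) b) (fmap (Omega_obj A) a) x)).
Qed.

(* The map A(B(M))(V) -> A(B'(M))(V) induced by a morphism B -> B', in which the
   structure isomorphisms, being identities, have disappeared. *)
Fixpoint strict_at B B' (g : khom k B B') : forall A M V,
    pf_ob (Omega_obj A (Omega_obj B M) : polyfun k) V ->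
    pf_ob (Omega_obj A (Omega_obj B' M) : polyfun k) V :=
  match g in khom _ B B' return forall A M V,
    pf_ob (Omega_obj A (Omega_obj B M) : polyfun k) V ->
    pf_ob (Omega_obj A (Omega_obj B' M) : polyfun k) V
  with
  | kid _ => fun A M V x => x
  | kcomp _ _ _ g f => fun A M V x => strict_at g (strict_at f x)
  | kzero B B' => fun A M V x => fmap_at A (Omega_mor (kzero k B B') M) V x
  | kadd _ _ f g => fun A M V x => fmap_at A (Omega_mor (kadd f g) M) V x
  | kscale _ _ c f => fun A M V x => fmap_at A (Omega_mor (kscale c f) M) V x
  | ktens X X' Y Y' f g => fun A M V x =>
      @strict_at X X' f A (Omega_obj Y' M) V (@strict_at Y Y' g (Ktens A X) M V x)
  | kassoc _ _ _ => fun A M V x => x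
  | kassoci _ _ _ => fun A M V x => x
  | klunit _ => fun A M V x => x
  | kluniti _ => fun A M V x => x
  | krunit _ => fun A M V x => x
  | kruniti _ => fun A M V x => x
  | kinl X Y => fun A M V x => fmap_at A (Omega_mor (kinl k X Y) M) V x
  | kinr X Y => fun A M V x => fmap_at A (Omega_mor (kinr k X Y) M) V x
  | kprl X Y => fun A M V x => fmap_at A (Omega_mor (kprl k X Y) M) V x
  | kprr X Y => fun A M V x => fmap_at A (Omega_mor (kprr k X Y) M) V x
  | keta1 => fun A M V x => fmap_at A (eta1 k_inf M) V x
  | keps1 => fun A M V x => fmap_at A (eps1 k M) V x
  | keta2 => fun A M V x => fmap_at A (eta2 k M) V x
  | keps2 => fun A M V x => fmap_at A (eps2 k_inf M) V x
  | ktau => fun A M V x => fmap_at A (tau k M) V x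
  end.

(** At [A = K1] this turns the component of a composite diagram into explicit operations on vectors.
    The outer functor [A] is general because the right factor of a tensor product acts inside the
    left one. *)
Lemma fmap_at_strict B B' (g : khom k B B') A M V x :
  fmap_at A (Omega_mor g M) V x = strict_at g x.
Proof.
elim: g A M V x => {B B'} //= [B|A B C g IHg f IHf|A A' B B' f IHf g IHg||||||] *;
  try exact: fmap_at1.
- by rewrite fmap_atM IHg IHf.
- by rewrite fmap_atM IHf; congr (strict_at _ _); exact: (IHg (Ktens _ _)).
Qed.
End Omega.

(** * Exactness and adjoints of the values, and compatibility with the relations *)

Section EndL.
Variable k : fieldType.
Hypothesis k_inf : infinite_field k.
Implicit Types (M N : polyfun k) (U V W : vectType k).
Local Notation F := (F_functor k).
Local Notation E := (E_functor k).

(* Unfolded too early, these make the kernel compare whole functor records. *)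
Strategy 1000 [E_ob F_ob].
Strategy 500 [tensor pf_map weight_space eta1_comp eps1_comp eta2_comp eps2_comp
  eta1_pol eps1_pol eta2_pol eps2_pol].
Strategy 300 [nat_comp nat_hcomp functor_comp nat_assoc nat_associ nat_lunit
  nat_luniti nat_runit nat_runiti nat_add nat_scale nat_zero nat_id].

Lemma adjunction_E_F : adjunction E F.
Proof.
exists (eta1 k_inf), (eps1 k); split=> M V; apply/lfunP => x.
  apply: (etrans (@pol_compE k (E_ob M) (E_ob (F_ob (E_ob M))) (E_ob M)
    (eps1_pol (E_ob M)) (E_mor (eta1_pol k_inf M)) V x)).
  apply: etrans (zigzag_eta1_eps1_E k_inf x) _.
  by apply: esym; exact: (@pol_id k (E_ob M) V x).
apply: (etrans (@pol_compE k (F_ob M) (F_ob (E_ob (F_ob M))) (F_ob M)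
  (F_mor (eps1_pol M)) (eta1_pol k_inf (F_ob M)) V x)).
apply: etrans (zigzag_eta1_eps1_F k_inf x) _.
by apply: esym; exact: (@pol_id k (F_ob M) V x).
Qed.

Lemma adjunction_F_E : adjunction F E.
Proof.
exists (eta2 k), (eps2 k_inf); split=> M V; apply/lfunP => x.
  apply: (etrans (@pol_compE k (F_ob M) (F_ob (E_ob (F_ob M))) (F_ob M)
    (eps2_pol k_inf (F_ob M)) (F_mor (eta2_pol M)) V x)).
  apply: etrans (zigzag_eta2_eps2_F k_inf x) _.
  by apply: esym; exact: (@pol_id k (F_ob M) V x).
apply: (etrans (@pol_compE k (E_ob M) (E_ob (F_ob (E_ob M))) (E_ob M)
  (E_mor (eps2_pol k_inf M)) (eta2_pol (E_ob M)) V x)).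
apply: etrans (zigzag_eta2_eps2_E k_inf x) _.
by apply: esym; exact: (@pol_id k (E_ob M) V x).
Qed.

Lemma linear_addZ U W (l : U -> W) : linear l ->
  (forall x y, l (x + y) = l x + l y) /\ (forall a x, l (a *: x) = a *: l x).
Proof.
move=> ll; pose g : {linear U -> W} := HB.pack l (GRing.isLinear.Build k U W *:%R l ll).
have l0 : l 0 = 0 := linear0 g.
by split=> [x y|a x]; [exact: (linearD g) | rewrite -[a *: x]addr0 ll l0 addr0].
Qed.

Lemma F_linear : @linear_functor k (Pol k) (Pol k) F.
Proof.
have lF M N V := linear_addZ (@tensor_map_linl k (pf_ob M V) (pf_ob N V) V V \1).
by split=> [M N f g|M N c f] V; have [FD FZ] := lF M N V; [exact: FD | exact: FZ].
Qed.

Lemma E_linear : @linear_functor k (Pol k) (Pol k) E.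
Proof.
have lE M N V := linear_addZ (@restrict_linear k (pf_ob M (plus_line V))
  (pf_ob N (plus_line V)) (weight_space M V 1) (weight_space N V 1)).
by split=> [M N f g|M N c f] V; have [ED EZ] := lE M N V; [exact: ED | exact: EZ].
Qed.

Lemma Omega_obj_linear A : @linear_functor k (Pol k) (Pol k) (Omega_obj k A).
Proof.
elim: A => [|||A [IHDA IHZA] B [IHDB IHZB]||A IHA B IHB] /=.
- exact: F_linear.
- exact: E_linear.
- by split=> *; exact: heq_refl.
- split=> [M N f g|M N c f].
    exact: heq_trans (fmap_heq (Omega_obj k A) (IHDB _ _ f g)) (IHDA _ _ _ _).
  exact: heq_trans (fmap_heq (Omega_obj k A) (IHZB _ _ c f)) (IHZA _ _ _ _).
- exact: (@zero_functor_linear k (Pol k) (Pol k) (pf_zero k) (@pf_zero_idm k)).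
- exact: (@sum_functor_linear k (Pol k) (Pol k)).
Qed.

(** E and F are adjoint to each other on both sides. The two-sided adjoint of a tensor expression is
    therefore the reversed expression with [Qp] and [Qm] exchanged, and sums are treated
    termwise. *)
Lemma Omega_obj_adjoints A :
  exists B, adjunction (Omega_obj k B) (Omega_obj k A) /\
    adjunction (Omega_obj k A) (Omega_obj k B).
Proof.
elim: A => [|||A [A' [lA rA]] B [B' [lB rB]]||A [A' [lA rA]] B [B' [lB rB]]].
- by exists Qm; split; [exact: adjunction_E_F | exact: adjunction_F_E].
- by exists Qp; split; [exact: adjunction_F_E | exact: adjunction_E_F].
- by exists K1; split; exact: adjunction_id.
- by exists (Ktens B' A'); split; exact: adjunction_comp.
- exists K0; split;
    exact: (@zero_adjunction k (Pol k) (Pol k) _ _ (@pf_zero_idm k) (@pf_zero_idm k)).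
- by exists (Ksum A' B'); split; exact: (@sum_adjunction k (Pol k) (Pol k)).
Qed.

Definition Omega_ob (A : kob) : endL k.
Proof.
exists (Omega_obj k A).
  have [B [l r]] := Omega_obj_adjoints A.
  by apply: exact_of_adjoints; [exact: Omega_obj_linear
    | exists (Omega_obj k B) | exists (Omega_obj k B)].
by have [B [l _]] := Omega_obj_adjoints A; exists (Omega_obj k B).
Defined.
Local Notation Omega_mor := (Omega_mor k_inf).

Lemma Omega_mor_pointwise A B (f g : khom k A B) :
  (forall M V x, @strict_at k k_inf A B f K1 M V x = strict_at k_inf g x) ->
  nat_heq (Omega_mor f) (Omega_mor g).
Proof.
move=> e M V; apply/lfunP => x.
have := e M V x; rewrite -!fmap_at_strict; exact.
Qed.

(** The axioms of a linear monoidal category hold in [EndL], whose operations [Omega_mor] copies;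
    those of direct sums are the biproduct equations. The defining relations reduce to the
    identities between vectors proved above. *)
Lemma Omega_mor_heq A B (f g : khom k A B) : kheq f g -> nat_heq (Omega_mor f) (Omega_mor g).
Proof.
elim=> {A B f g}.
- by move=> A B f; exact: (@heq_refl (EndL k) (Omega_ob A) (Omega_ob B)).
- by move=> A B f g _; exact: (@heq_sym (EndL k) (Omega_ob A) (Omega_ob B)).
- by move=> A B f g h _ e _; exact: (@heq_trans (EndL k) (Omega_ob A) (Omega_ob B) _ _ _ e).
- by move=> A B C g g' f f' _ eg _;
  exact: (@comp_heq (EndL k) (Omega_ob A) (Omega_ob B) (Omega_ob C) _ _ _ _ eg).
- by move=> A B f f' g g' _ ef _;
  exact: (@hadd_heq k (EndL k) (Omega_ob A) (Omega_ob B) _ _ _ _ ef).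
- by move=> A B c f f' _; exact: (@hscale_heq k (EndL k) (Omega_ob A) (Omega_ob B)).
- by move=> A A' B B' f f' g g' _ ef _;
  exact: (@tensm_heq k (EndL k) (Omega_ob A) (Omega_ob A') (Omega_ob B) (Omega_ob B') _ _ _ _ ef).
- by move=> A B C D h g f;
  exact: (@compA (EndL k) (Omega_ob A) (Omega_ob B) (Omega_ob C) (Omega_ob D)).
- by move=> A B f; exact: (@comp1m (EndL k) (Omega_ob A) (Omega_ob B)).
- by move=> A B f; exact: (@compm1 (EndL k) (Omega_ob A) (Omega_ob B)).
- by move=> A B f g h; exact: (@haddA k (EndL k) (Omega_ob A) (Omega_ob B)).
- by move=> A B f g; exact: (@haddC k (EndL k) (Omega_ob A) (Omega_ob B)).
- by move=> A B f; exact: (@hadd0 k (EndL k) (Omega_ob A) (Omega_ob B)).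
- by move=> A B a b f; exact: (@hscaleA k (EndL k) (Omega_ob A) (Omega_ob B)).
- by move=> A B f; exact: (@hscale1 k (EndL k) (Omega_ob A) (Omega_ob B)).
- by move=> A B f; exact: (@hscale0 k (EndL k) (Omega_ob A) (Omega_ob B)).
- by move=> A B a b f; exact: (@hscaleDl k (EndL k) (Omega_ob A) (Omega_ob B)).
- by move=> A B a f g; exact: (@hscaleDr k (EndL k) (Omega_ob A) (Omega_ob B)).
- by move=> A B C g g' f; exact: (@compDl k (EndL k) (Omega_ob A) (Omega_ob B) (Omega_ob C)).
- by move=> A B C g f f'; exact: (@compDr k (EndL k) (Omega_ob A) (Omega_ob B) (Omega_ob C)).
- by move=> A B C a g f; exact: (@compZl k (EndL k) (Omega_ob A) (Omega_ob B) (Omega_ob C)).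
- by move=> A B C a g f; exact: (@compZr k (EndL k) (Omega_ob A) (Omega_ob B) (Omega_ob C)).
- by move=> A B; exact: (@tensm1 k (EndL k) (Omega_ob A) (Omega_ob B)).
- by move=> A A' A'' B B' B'' f' f g' g;
  exact: (@tensmM k (EndL k) (Omega_ob A) (Omega_ob A') (Omega_ob A'')
    (Omega_ob B) (Omega_ob B') (Omega_ob B'')).
- by move=> A A' B B' f f' g;
  exact: (@tensmDl k (EndL k) (Omega_ob A) (Omega_ob A') (Omega_ob B) (Omega_ob B')).
- by move=> A A' B B' f g g';
  exact: (@tensmDr k (EndL k) (Omega_ob A) (Omega_ob A') (Omega_ob B) (Omega_ob B')).
- by move=> A A' B B' c f g;
  exact: (@tensmZl k (EndL k) (Omega_ob A) (Omega_ob A') (Omega_ob B) (Omega_ob B')).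
- by move=> A A' B B' c f g;
  exact: (@tensmZr k (EndL k) (Omega_ob A) (Omega_ob A') (Omega_ob B) (Omega_ob B')).
- by move=> A B C; exact: (@assocK k (EndL k) (Omega_ob A) (Omega_ob B) (Omega_ob C)).
- by move=> A B C; exact: (@associK k (EndL k) (Omega_ob A) (Omega_ob B) (Omega_ob C)).
- by move=> A; exact: (@lunitK k (EndL k) (Omega_ob A)).
- by move=> A; exact: (@lunitiK k (EndL k) (Omega_ob A)).
- by move=> A; exact: (@runitK k (EndL k) (Omega_ob A)).
- by move=> A; exact: (@runitiK k (EndL k) (Omega_ob A)).
- by move=> A A' B B' C C' f g h;
  exact: (@assoc_nat k (EndL k) (Omega_ob A) (Omega_ob A') (Omega_ob B) (Omega_ob B')
    (Omega_ob C) (Omega_ob C')).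
- by move=> A A' f; exact: (@lunit_nat k (EndL k) (Omega_ob A) (Omega_ob A')).
- by move=> A A' f; exact: (@runit_nat k (EndL k) (Omega_ob A) (Omega_ob A')).
- by move=> A B C D;
  exact: (@pentagon k (EndL k) (Omega_ob A) (Omega_ob B) (Omega_ob C) (Omega_ob D)).
- by move=> A B; exact: (@triangle k (EndL k) (Omega_ob A) (Omega_ob B)).
- by move=> M; exact: (@pf_zero_idm k).
- by move=> A B M; exact: bp_prl_inl.
- by move=> A B M; exact: bp_prr_inr.
- by move=> A B M; exact: bp_prl_inr.
- by move=> A B M; exact: bp_prr_inl.
- by move=> A B M; exact: bp_sum.
- by apply: Omega_mor_pointwise => M V x; exact: zigzag_eta1_eps1_E.
- by apply: Omega_mor_pointwise => M V x; exact: zigzag_eta1_eps1_F.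
- by apply: Omega_mor_pointwise => M V x; exact: zigzag_eta2_eps2_F.
- by apply: Omega_mor_pointwise => M V x; exact: zigzag_eta2_eps2_E.
- by apply: Omega_mor_pointwise => M V x; exact: mate1_mate2.
- by apply: Omega_mor_pointwise => M V x; exact: eps1_eta2.
- by apply: Omega_mor_pointwise => M V x; exact: flipK.
- by apply: Omega_mor_pointwise => M V x; exact: flip_braid.
- apply: Omega_mor_pointwise => M V x; apply: etrans (@left_curl k M V x) _.
  by apply: esym; exact: (@pol_zero k (F_ob M) (F_ob M) V x).
- by apply: Omega_mor_pointwise => M V x; exact: square_triangle.
apply: Omega_mor_pointwise => M V x; apply: etrans (@triangle_square k k_inf M V x) _.
apply: esym.
apply: etrans (@pol_add k (E_ob (F_ob M)) (E_ob (F_ob M)) (idm _)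
  (@hscale k (Pol k) _ _ (-1) (eta2 k M <o> eps1 k M)) V x) _.
congr (_ + _); first exact: (@pol_id k (E_ob (F_ob M)) V x).
apply: etrans (@pol_scale k (E_ob (F_ob M)) (E_ob (F_ob M)) (-1)
  (eta2 k M <o> eps1 k M) V x) _.
congr (_ *: _); exact: (@pol_compE k (E_ob (F_ob M)) M (E_ob (F_ob M))
  (eta2_pol M) (eps1_pol M) V x).
Qed.
End EndL.

(** * The monoidal functor and its values on the generators *)

Section Final.
Variable k : fieldType.
Hypothesis k_inf : infinite_field k.
Implicit Types (M N : polyfun k) (U V W : vectType k).
Local Notation F := (F_functor k).
Local Notation E := (E_functor k).
Local Notation Omega_ob := (Omega_ob k_inf).
Local Notation Omega_mor := (Omega_mor k_inf).

Definition Omega_functor : functor (Khovanov k) (EndL k) :=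
  @Functor (Khovanov k) (EndL k) Omega_ob (fun A B f => Omega_mor f)
    (fun A B f g e => Omega_mor_heq k_inf e)
    (fun A => @heq_refl (EndL k) (Omega_ob A) (Omega_ob A) _)
    (fun A B C g f => @heq_refl (EndL k) (Omega_ob A) (Omega_ob C) _).

(** Tensor products go to composites on the nose, so the structure maps are identities. *)
Definition Omega_mu (A B : Khovanov k) :
  @hom (EndL k) (Omega_functor A (x) Omega_functor B) (Omega_functor (A (x) B)) :=
  nat_id (functor_comp (Omega_obj k A) (Omega_obj k B)).

Definition Omega_mui (A B : Khovanov k) :
  @hom (EndL k) (Omega_functor (A (x) B)) (Omega_functor A (x) Omega_functor B) :=
  nat_id (functor_comp (Omega_obj k A) (Omega_obj k B)).

Definition Omega : monfunctor (Khovanov k) (EndL k).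
Proof.
refine (@MonFunctor k (Khovanov k) (EndL k) Omega_functor Omega_mu Omega_mui
  (nat_id (functor_id (Pol k))) (nat_id (functor_id (Pol k))) _ _ _ _ _ _ _ _).
- by move=> A B M; exact: (@comp1m (Pol k) _ _ (idm (Omega_obj k A (Omega_obj k B M)))).
- by move=> A B M; exact: (@comp1m (Pol k) _ _ (idm (Omega_obj k A (Omega_obj k B M)))).
- by move=> M; exact: (@comp1m (Pol k) _ _ (idm M)).
- by move=> M; exact: (@comp1m (Pol k) _ _ (idm M)).
- move=> A A' B B' f g.
  move=> M; pose fg := nat_hcomp (Omega_mor f) (Omega_mor g) M.
  by apply: (@heq_trans (Pol k) _ _ _ fg _ (comp1m _)); apply: heq_sym; exact: compm1.
- move=> A B C M.
  pose X := Omega_obj k A (Omega_obj k B (Omega_obj k C M)).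
  have id1 := idm_fmap1 (Omega_obj k A) (Omega_obj k B (Omega_obj k C M)).
  have idid : @idm (Pol k) X <o> @idm (Pol k) X =h @idm (Pol k) X by exact: comp1m.
  have idAB : @idm (Pol k) X <o>
      fmap (functor_comp (Omega_obj k A) (Omega_obj k B)) (@idm (Pol k) (Omega_obj k C M)) =h
      @idm (Pol k) X.
    exact: idm_fmap1.
  apply: heq_trans (comp_congr _ (comp_congr _ idAB)) _.
  apply: heq_trans (comp_congr _ (idid)) _; apply: heq_trans (idid) _; apply: heq_sym.
  apply: heq_trans (comp_congr _ (comp_congl _ id1)) _.
  by apply: heq_trans (comp_congr _ idid) _.
- move=> A M.
  pose X := Omega_obj k A M.
  have idid : @idm (Pol k) X <o> @idm (Pol k) X =h @idm (Pol k) X by exact: comp1m.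
  apply: heq_trans (comp_congr _ (comp_congr _ idid)) _.
  by apply: heq_trans (comp_congr _ idid) _.
- move=> A M.
  pose X := Omega_obj k A M.
  have idid : @idm (Pol k) X <o> @idm (Pol k) X =h @idm (Pol k) X by exact: comp1m.
  have id1 := idm_fmap1 (Omega_obj k A) M.
  apply: heq_trans (comp_congr _ (comp_congr _ id1)) _.
  by apply: heq_trans (comp_congr _ idid) _.
Defined.

Lemma Omega_linear : linear_functor Omega.
Proof.
split=> [A B f g|A B c f].
  exact: (@heq_refl (EndL k) (Omega_ob A) (Omega_ob B)).
exact: (@heq_refl (EndL k) (Omega_ob A) (Omega_ob B)).
Qed.

(** [xi] is the combination of the basis dual to [e] with coefficients [xi e_i]; linearity in [xi]
    then produces the sum. *)
Lemma eta1_formula : is_eta1 (eta1 k_inf).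
Proof.
move=> M V e m be.
apply/lfunP => xi; rewrite [LHS]eta1_compE // sum_lfunE.
pose l (xi : dual V) := weight1 (pf_map M (graph xi) m).
have lin : linear l by exact: weight1_graph_linear.
rewrite -[LHS]/(l xi) -(linfunE lin).
have xiE : xi = \sum_(i < \dim {:V})
    (xi e`_i : k) *: (linfun (fun v => coord e i v : k^o) : dual V).
  apply/lfunP => v; rewrite {1}(coord_basis be (memvf v)) linear_sum sum_lfunE.
  apply: eq_bigr => i _; rewrite linearZ scale_lfunE linfunE ?mulrC //.
    by rewrite /GRing.scale /= mulrC.
  by move=> a x y; rewrite linearP.
rewrite {1}xiE linear_sum; apply: eq_bigr => i _.
by rewrite linearZ /= (linfunE lin) pureE.
Qed.

Lemma eps1_formula : is_eps1 (eps1 k).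
Proof.
move=> M V x n m v wn wm xE.
by rewrite [LHS]eps1_compE xE add_lfunE !pureE !last_formE scale0r scale1r add0r.
Qed.

Lemma eta2_formula : is_eta2 (eta2 k).
Proof. by move=> M V m; exact: eta2_compE. Qed.

Lemma eps2_formula : is_eps2 (eps2 k_inf).
Proof. by move=> M V m v; exact: eps2_compE. Qed.

Lemma tau_formula : is_tau (tau k).
Proof. by move=> M V m v w; exact: flip_pure. Qed.

Lemma at_comp_idl (G H : functor (Pol k) (Pol k)) (p : nattrans H H)
    (a : nattrans G H) M V x :
  nat_heq p (nat_id H) -> at_comp (nat_comp p a) M V x = at_comp a M V x.
Proof.
move=> p1; have /(_ V) : nat_comp p a M =h a M.
  exact: heq_trans (comp_congl _ (p1 M)) (comp1m _).
by rewrite /at_comp /pol_comp => ->.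
Qed.

Lemma at_comp_idr (G H : functor (Pol k) (Pol k)) (q : nattrans G G)
    (a : nattrans G H) M V x :
  nat_heq q (nat_id G) -> at_comp (nat_comp a q) M V x = at_comp a M V x.
Proof.
move=> q1; have /(_ V) : nat_comp a q M =h a M.
  exact: heq_trans (comp_congr _ (q1 M)) (compm1 _).
by rewrite /at_comp /pol_comp => ->.
Qed.

Lemma at_comp_id (G H : functor (Pol k) (Pol k)) (a : nattrans G H) M V x :
  at_comp (nat_comp (nat_id H) (nat_comp a (nat_id G))) M V x = at_comp a M V x.
Proof.
have id1 (K : functor (Pol k) (Pol k)) : nat_heq (nat_id K) (nat_id K).
  by move=> N; exact: heq_refl.
exact: (etrans (at_comp_idl (nat_comp a (nat_id G)) x (id1 H)) (at_comp_idr a x (id1 G))).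
Qed.

(** Both equalities of objects are [erefl], so the comparison maps are horizontal composites of
    identities, which [hcomp_id] removes; [at_comp_id] removes the structure maps of [Omega]. *)
Lemma Omega_extends : extends_assignment Omega.
Proof.
exists erefl, erefl; split.
- move=> M V e m be; rewrite -(eta1_formula m be).
  apply: etrans (at_comp_id (eta1 k_inf) m).
  exact: (@at_comp_idl _ _ _ (nat_comp (nat_id _) (nat_comp (eta1 k_inf) (nat_id _)))
    M V m (hcomp_id F E)).
- move=> M V x n m v wn wm xE; rewrite -(eps1_formula wn wm xE).
  apply: etrans (at_comp_id (eps1 k) x).
  exact: (@at_comp_idr _ _ _ (nat_comp (nat_id _) (nat_comp (eps1 k) (nat_id _)))
    M V x (hcomp_id E F)).
- move=> M V m; rewrite -eta2_formula; congr (vsval _).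
  apply: etrans (at_comp_id (eta2 k) m).
  exact: (@at_comp_idl _ _ _ (nat_comp (nat_id _) (nat_comp (eta2 k) (nat_id _)))
    M V m (hcomp_id E F)).
- move=> M V m v; rewrite -eps2_formula.
  apply: etrans (at_comp_id (eps2 k_inf) (pure m v)).
  exact: (@at_comp_idr _ _ _ (nat_comp (nat_id _) (nat_comp (eps2 k_inf) (nat_id _)))
    M V (pure m v) (hcomp_id F E)).
- move=> M V m v w; rewrite -[RHS]tau_formula.
  pose t := nat_comp (nat_id _) (nat_comp (tau k) (nat_id (functor_comp F F))).
  apply: etrans (at_comp_id (tau k) (pure (pure m v) w)).
  apply: etrans (@at_comp_idr _ _ _ t M V (pure (pure m v) w) (hcomp_id F F)).
  exact: (@at_comp_idl _ _ _ (nat_comp t (nat_hcomp (nat_id F) (nat_id F)))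
    M V (pure (pure m v) w) (hcomp_id F F)).
Qed.

End Final.

Theorem proposition7p7 (k : fieldType) (k_inf : infinite_field k) :
  exists Omega : monfunctor (Khovanov k) (EndL k),
    linear_functor Omega /\ extends_assignment Omega.
Proof.
by exists (Omega k_inf); split; [exact: Omega_linear | exact: Omega_extends].
Qed.
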